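(* Assume that the model is identifiable, i.e. $\operatorname{Com}(Q)\cap\ker(A)=\{0\}$. If the time gaps distribution $\mu$ satisfies the moment condition $\mathbb E_\mu(\tau)=\sum_{k\ge1}k\,\mu(k)<\infty$, then the matrix $$\Gamma=\sum_{k\ge1}\Big(\sum_{j=1}^{k}(P^{j-1})^\top\otimes P^{k-j}\Big)\mu(k)$$ is well defined and, as $n\to\infty$, $$\sqrt n\,\big(\hat q-g_\mu(\hat P)\big)\ \stackrel{d}{\longrightarrow}\ \mathcal N\Big(0,\ (\mathrm I-\Gamma B)\,\Sigma\,(\mathrm I-\Gamma B)^\top\Big),$$ where $B=\Phi\big[\Phi^\top\Delta(Q)^\top\Delta(Q)\Phi\big]^{-1}\Phi^\top\Delta(Q)^\top\Delta(P)$.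
   Context: **Model.** Let $N\ge 3$ and let $X=(X_m)_{m\in\mathbb N}$ be an irreducible, aperiodic, homogeneous Markov chain on $\{1,\dots,N\}$ with transition matrix $P$ and invariant distribution $\pi=(\pi_1,\dots,\pi_N)$ (so all $\pi_i>0$). The chain is observed at random times $T_1,\dots,T_n$ only: $Y_k=X_{T_k}$, $k=1,\dots,n$, where the gaps $\tau_k=T_k-T_{k-1}$ (with $T_0=0$) are i.i.d. random variables with distribution $\mu$ on $\mathbb N=\{0,1,2,\dots\}$, $\mu\neq\delta_0$, independent of $X$. Then $(Y_k)$ is a Markov chain with transition matrix $Q=G_\mu(P)$, where $G_\mu(M)=\sum_{\ell\ge0}\mu(\ell)M^\ell$; $Q$ is irreducible and aperiodic with invariant distribution $\pi$. **Notation.** $\operatorname{vec}(M)=(M_{11},\dots,M_{N1},\dots,M_{1N},\dots,M_{NN})^\top$ is the column-stacking vectorization; $p=\operatorname{vec}(P)$, $q=\operatorname{vec}(Q)$, $g_\mu(M)=\operatorname{vec}(G_\mu(M))$. For $M\in\mathbb R^{N\times N}$, $\Delta(M)=\mathrm I\otimes M-M^\top\otimes \mathrm I\in\mathbb R^{N^2\times N^2}$, where $\otimes$ is the Kronecker product and $\mathrm I$ the identity. $\operatorname{Com}(Q)$ is the set of matrices commuting with $Q$, identified through $\operatorname{vec}$ with a subspace of $\mathbb R^{N^2}$, i.e. $\operatorname{Com}(Q)=\ker\Delta(Q)$. **Constraints.** $A\in\mathbb R^{r\times N^2}$ is a known matrix of full rank $r$, $b\in\mathbb R^r$ is known, $\mathcal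 M=\{m\in\mathbb R^{N^2}:Am=b\}$ has dimension $d=N^2-r$, and it is assumed that $p\in\mathcal M$. $p_0$ is a fixed element of $\mathcal M$, and $\Phi\in\mathbb R^{N^2\times d}$ is a matrix whose columns form a basis of $\ker(A)$. Identifiability is equivalent to $\Delta(Q)\Phi$ having full rank $d$. **Estimators.** $\hat Q$ is the empirical transition matrix, $$\hat Q_{ij}=\frac{\sum_{k=1}^{n-1}\mathbf 1\{Y_k=i,Y_{k+1}=j\}}{\sum_{k=1}^{n-1}\mathbf 1\{Y_k=i\}}$$ (defined when each state $i$ has been observed, an event of probability tending to $1$), and $\hat q=\operatorname{vec}(\hat Q)$. It is a known fact that $\sqrt n(\hat q-q)\to\mathcal N(0,\Sigma)$ in distribution, where $\Sigma\in\mathbb R^{N^2\times N^2}$ is the matrix whose entry at the positions of $(i,j)$ and $(k,\ell)$ in the vectorization equals $Q_{ij}(1-Q_{ij})/\pi_i$ if $(i,j)=(k,\ell)$; $-Q_{ij}Q_{i\ell}/\pi_i$ if $i=k$ and $j\neq\ell$; and $0$ otherwise. The estimator $\hat P$ of $P$ is defined by $\operatorname{vec}(\hat P)=\hat p$ with $$\hat p=\Big(\mathrm I-\Phi\big(\Phi^\top\Delta(\hat Q)^\top\Delta(\hat Q)\Phi\big)^{-1}\Phi^\top\Delta(\hat Q)^\top\Delta(\hat Q)\Big)p_0$$ (the inverse exists with probability tending to $1$ under identifiability). It is known from earlier work that, under identifiability, $\sqrt n(\hat p-p)=\sqrt n\,B(\hat q-q)+o_P(1)$ with $B$ the matrix given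 in the claim.
   Formalization: The limit law is stated under the condition that either the constraints Am=b force all row sums to equal 1, or the series g_μ(P̂) converges with probability tending to 1; otherwise g_μ(P̂) can diverge with non-vanishing probability when μ has radius of convergence 1. *)

(* Defs.v *)
From HB Require Import structures.
From mathcomp Require Import all_boot all_order all_algebra.
From mathcomp Require Import all_classical all_reals all_analysis.
From mathcomp Require Import mxtens.

Set Implicit Arguments.
Unset Strict Implicit.
Unset Printing Implicit Defensive.

Import Order.TTheory GRing.Theory Num.Theory.
Import numFieldNormedType.Exports.

Local Open Scope classical_set_scope.
Local Open Scope ring_scope.

Section Matrices.
Variables (R : realType) (N : nat).
Implicit Types (M P Q : 'M[R]_N) (mu : probability nat R).

(* Column stacking: the entry (i, j) sits at position j * N + i, which is
   [mxtens_index (j, i)], so that [vec (L *m M *m K) = (K^T *t L) *m vec M]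
   with the library's Kronecker product [*t]. (The library's [mxvec] stacks
   rows.) *)
Definition vec M : 'cV[R]_(N * N) :=
  \col_s M (mxtens_unindex s).2 (mxtens_unindex s).1.

Definition unvec (v : 'cV[R]_(N * N)) : 'M[R]_N :=
  \matrix_(i, j) v (mxtens_index (j, i)) 0.

Definition Delta M : 'M[R]_(N * N) := 1%:M *t M - M^T *t 1%:M.

Definition stochastic_mx P : Prop :=
  (forall i j, 0 <= P i j) /\ (forall i, \sum_j P i j = 1).

Definition irreducible_mx P : Prop :=
  forall i j, exists k : nat, 0 < (P ^+ k) i j.

Definition aperiodic_mx P : Prop :=
  forall (i : 'I_N) (g : nat),
    (forall k : nat, (0 < k)%N -> 0 < (P ^+ k) i i -> (g %| k)%N) -> g = 1%N.

Definition invariant_distribution P (pi : 'rV[R]_N) : Prop :=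
  [/\ forall i, 0 <= pi 0 i, \sum_i pi 0 i = 1 & pi *m P = pi].

Definition mass mu (l : nat) : R := fine (mu [set l]).

Definition G_series mu M : nat -> 'M[R]_N := series (fun l => mass mu l *: M ^+ l).

(* A junk value when the power series diverges at M. *)
Definition G mu M : 'M[R]_N := limn (G_series mu M).

Definition Gamma_series mu P : nat -> 'M[R]_(N * N) :=
  series (fun k => mass mu k *:
    \sum_(1 <= j < k.+1) (P ^+ j.-1)^T *t (P ^+ (k - j))).

Definition Gamma mu P : 'M[R]_(N * N) := limn (Gamma_series mu P).

Definition Sigma Q (pi : 'rV[R]_N) : 'M[R]_(N * N) :=
  \matrix_(s, t)
    let (j, i) := mxtens_unindex s in
    let (l, k) := mxtens_unindex t in
    if i == k then
      if j == l then Q i j * (1 - Q i j) / pi 0 i else - (Q i j * Q i l) / pi 0 i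
    else 0.

Definition identifiable r (A : 'M[R]_(r, N * N)) Q : Prop :=
  forall M, comm_mx M Q -> A *m vec M = 0 -> M = 0.

Definition contains_row_sum_constraint r (A : 'M[R]_(r, N * N)) (b : 'cV[R]_r) : Prop :=
  forall M, A *m vec M = b -> M *m const_mx 1 = const_mx 1 :> 'cV[R]_N.

Definition column_basis_of_ker r d (A : 'M[R]_(r, N * N)) (Phi : 'M[R]_(N * N, d)) : Prop :=
  row_free Phi^T /\ (Phi^T :=: kermx A^T)%MS.

(* When the bracketed matrix is singular, [invmx] is the identity function:
   this is a junk value. *)
Definition p_estimator d (Phi : 'M[R]_(N * N, d)) (p0 : 'cV[R]_(N * N)) Q :
    'cV[R]_(N * N) :=
  (1%:M - Phi *m invmx (Phi^T *m (Delta Q)^T *m Delta Q *m Phi) *m Phi^T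
          *m (Delta Q)^T *m Delta Q) *m p0.

Definition Bmx d (Phi : 'M[R]_(N * N, d)) P Q : 'M[R]_(N * N) :=
  Phi *m invmx (Phi^T *m (Delta Q)^T *m Delta Q *m Phi) *m Phi^T
      *m (Delta Q)^T *m Delta P.

End Matrices.

Section Model.
Context {d : measure_display} {Omega : measurableType d} {R : realType}.
Variables (Pr : probability Omega R) (N : nat).
Implicit Types (X : nat -> Omega -> 'I_N) (tau : nat -> {RV Pr >-> nat}).

(* No condition is put on the law of [X 0]. *)
Definition markov_chain X (P : 'M[R]_N) : Prop :=
  (forall m i, measurable (X m @^-1` [set i])) /\
  (forall (m : nat) (x : nat -> 'I_N),
    Pr (\bigcap_(k < m.+2) X k @^-1` [set x k]) =
    (Pr (\bigcap_(k < m.+1) X k @^-1` [set x k]) * (P (x m) (x m.+1))%:E)%E).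

Definition iid tau (mu : probability nat R) : Prop :=
  (forall k (B : set nat), distribution Pr (tau k) B = mu B) /\
  (forall (n : nat) (B : nat -> set nat),
    Pr (\bigcap_(k < n) tau k @^-1` B k) = (\prod_(k < n) Pr (tau k @^-1` B k))%E).

Definition independent_processes X tau : Prop :=
  forall (m n : nat) (C : nat -> set 'I_N) (B : nat -> set nat),
    Pr ((\bigcap_(k < m) X k @^-1` C k) `&` (\bigcap_(k < n) tau k @^-1` B k)) =
    (Pr (\bigcap_(k < m) X k @^-1` C k) * Pr (\bigcap_(k < n) tau k @^-1` B k))%E.

(* [tau k] is the gap between the k-th and the (k+1)-st observation times;
   the zeroth one is 0 and is not an observation. *)
Definition obs_time tau (k : nat) (w : Omega) : nat := (\sum_(l < k) tau l w)%N.

Definition obs X tau (k : nat) (w : Omega) : 'I_N := X (obs_time tau k w) w.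

(* A row is 0 as long as the corresponding state has not been observed. *)
Definition empirical_mx (Y : nat -> Omega -> 'I_N) (n : nat) (w : Omega) : 'M[R]_N :=
  \matrix_(i, j)
    ((\sum_(1 <= k < n) ((Y k w == i) && (Y k.+1 w == j)))%N%:R
     / (\sum_(1 <= k < n) (Y k w == i))%N%:R).

(* The estimator [Phat n] of P need not be a stochastic matrix, so the power
   series G_mu may diverge at it: if the constraints do not force the rows to
   sum to 1, the largest eigenvalue of [Phat n] can exceed 1, and E_mu(tau) finite
   only yields a radius of convergence at least 1. *)
Definition plugin_defined (mu : probability nat R)
    (Phat : nat -> Omega -> 'M[R]_N) : Prop :=
  Pr [set w | cvgn (G_series mu (Phat n w))] @[n --> \oo] --> 1%E.

End Model.

Section ConvergenceInLaw.
Variable R : realType.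

(* The Borel sigma-algebra of R^m. *)
Definition borel_cV (m : nat) := g_sigma_algebraType (@open 'cV[R]_m).

(* The case v = 0 is separate because [normal_prob _ 0] is not a Dirac mass in
   the library. *)
Definition normal_law0 (v : R) : set (measurableTypeR R) -> \bar R :=
  if v == 0 then \d_(0 : R) else normal_prob 0 (Num.sqrt v).

(* [nu] is N(0, V), V possibly singular: every linear form is normal. *)
Definition gaussian_law (m : nat) (V : 'M[R]_m) (nu : probability (borel_cV m) R) : Prop :=
  forall (a : 'cV[R]_m) (U : set (measurableTypeR R)), measurable U ->
    nu [set x | U ((a^T *m (x : 'cV[R]_m)) 0 0)] = normal_law0 ((a^T *m V *m a) 0 0) U.

Definition cvg_in_law (d : measure_display) (Omega : measurableType d)
    (Pr : probability Omega R) (m : nat) (Z : nat -> Omega -> 'cV[R]_m)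
    (nu : probability (borel_cV m) R) : Prop :=
  forall f : 'cV[R]_m -> R, continuous f -> (exists C, forall x, `|f x| <= C) ->
    (\int[Pr]_w (f (Z n w))%:E)%E @[n --> \oo] --> (\int[nu]_x (f x)%:E)%E.

Definition cvg_to_gaussian (d : measure_display) (Omega : measurableType d)
    (Pr : probability Omega R) (m : nat) (Z : nat -> Omega -> 'cV[R]_m) (V : 'M[R]_m) : Prop :=
  exists2 nu : probability (borel_cV m) R, gaussian_law V nu & cvg_in_law Pr Z nu.

End ConvergenceInLaw.

(* Main.v *)
(* The empirical matrix satisfies sqrt n (Qhat - Q)_ij ~ n^(-1/2) S_ij / pi_i, where S_ij is the
   martingale with increments 1{Y_k = i} (1{Y_(k+1) = j} - Q_ij). The central limit theorem for
   S is proved by following E[cos (th + S_k / sqrt n) (1 - h(Y_k) / 2n)] step by step, where the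
   solution h of a Poisson equation makes the conditional variance constant; the same equation
   gives the law of large numbers for the occupation times. Convergence of characteristic
   functions implies convergence in law because continuous functions on a cube are approximated
   by trigonometric polynomials (Fejér interpolation), tightness being part of the hypotheses.

   On the deterministic side, p_est(Q') - p = B(Q') (q' - q) holds exactly as soon as the normal
   matrix at Q' is invertible, because Delta(Q') p = - Delta(P) q' and Delta(P) q = 0. The
   delicate point is the expansion of G_mu at P: the first moment of mu only gives radius of
   convergence at least 1, and Phat need not be stochastic. If the radius is larger than 1, the
   powers of a matrix M close to P grow slower than the radius allows. If it is 1, let M be close
   to P with G_mu(M) convergent: M^m has positive entries for m large, so an unbounded sequence
   of powers would grow geometrically and make the radius larger than 1; hence the powers of M are
   bounded, uniformly in M. In both cases dominated convergence applies to the telescoping sum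
   M^k - P^k = sum_j P^(k-j) (M - P) M^(j-1). *)
Require Import Defs.
From HB Require Import structures.
From mathcomp Require Import all_boot all_order all_algebra.
From mathcomp Require Import all_classical all_reals all_analysis.
From mathcomp Require Import measurable_realfun.
From mathcomp Require Import mxtens ring lra zify.
Set Implicit Arguments.
Unset Strict Implicit.
Unset Printing Implicit Defensive.
Import Order.TTheory GRing.Theory Num.Theory.
Import numFieldNormedType.Exports.
Local Open Scope classical_set_scope.
Local Open Scope ring_scope.

(** The limit law is constructed beforehand: [Sigma] equals L L^T for an explicit L, and a linear
    image of a standard Gaussian vector has the required law. Only expectations of cosines then have
    to be compared, and the approximating trigonometric polynomial must keep the bound of the
    function off the cube, whence nonnegative interpolation weights. The state space being finite,
    every statistic of n observations is a function of a path in a finite set. Measurability is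
    automatic, even for a value of G_mu at a point of divergence; increments are bounded, so one
    step of the characteristic function costs O(n^(-3/2)), and n steps O(n^(-1/2)). The expansion of
    G_mu needs an error o(|M - P|) without a second moment of mu: the head of the series gains an
    extra factor |M - P|, the tail uses the first moment. This requires one majorant of the powers
    of M, valid on a neighbourhood of P and summable against k mu(k). Divergence at the estimator is
    absorbed by a set [good], whose complement has vanishing probability. *)

Section BoundedExpectation.
Context {d : measure_display} {T : measurableType d} {R : realType}.
Variable P : probability T R.
Implicit Types f g : T -> R.

Definition bounded_rv f := measurable_fun setT f /\ exists C, forall x, `|f x| <= C.

Definition Exp f : R := \int[P]_x f x.

Lemma bounded_rv_integrable f : bounded_rv f -> P.-integrable setT (EFin \o f).
Proof.
move=> [mf [C fC]]; apply: measurable_bounded_integrable => //.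
  by rewrite (le_lt_trans (probability_le1 _ _))// ltry.
exists C; split; first exact: num_real.
by move=> M CM x _; apply: le_trans (fC x) (ltW CM).
Qed.

Lemma Exp_EFin f : bounded_rv f -> (\int[P]_x (f x)%:E)%E = (Exp f)%:E.
Proof.
by move=> /bounded_rv_integrable fi; rewrite /Exp /Rintegral fineK//; exact: integrable_fin_num.
Qed.

Lemma bounded_rv_cst c : bounded_rv (cst c).
Proof. by split; [exact: measurable_cst|exists `|c|]. Qed.

Lemma bounded_rvD f g : bounded_rv f -> bounded_rv g -> bounded_rv (fun x => f x + g x).
Proof.
move=> [mf [C fC]] [mg [D gD]]; split; first exact: measurable_funD.
by exists (C + D) => x; rewrite (le_trans (ler_normD _ _))// lerD.
Qed.

Lemma bounded_rvM f g : bounded_rv f -> bounded_rv g -> bounded_rv (fun x => f x * g x).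
Proof.
move=> [mf [C fC]] [mg [D gD]]; split; first exact: measurable_funM.
by exists (C * D) => x; rewrite normrM ler_pM.
Qed.

Lemma bounded_rvZ c f : bounded_rv f -> bounded_rv (fun x => c * f x).
Proof. by apply: bounded_rvM (bounded_rv_cst c). Qed.

Lemma bounded_rvN f : bounded_rv f -> bounded_rv (fun x => - f x).
Proof.
by move=> /(bounded_rvZ (-1)); congr bounded_rv; apply/funext => x; rewrite mulN1r.
Qed.

Lemma bounded_rvB f g : bounded_rv f -> bounded_rv g -> bounded_rv (fun x => f x - g x).
Proof. by move=> bf /bounded_rvN; exact: bounded_rvD. Qed.

Lemma bounded_rv_norm f : bounded_rv f -> bounded_rv (fun x => `|f x|).
Proof.
move=> [mf [C fC]]; split; first exact: measurableT_comp.
by exists C => x; rewrite normr_id.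
Qed.

Lemma bounded_rv_sum (I : Type) (r : seq I) (F : I -> T -> R) :
  (forall i, bounded_rv (F i)) -> bounded_rv (fun x => \sum_(i <- r) F i x).
Proof.
move=> bF; elim: r => [|i r IH].
  by under eq_fun do rewrite big_nil; exact: bounded_rv_cst.
by under eq_fun do rewrite big_cons; exact: bounded_rvD.
Qed.

Lemma bounded_rv_indic (A : set T) : measurable A -> bounded_rv (\1_A).
Proof.
move=> mA; split; first exact: measurable_indic.
by exists 1 => x; rewrite indicE; case: (_ \in _); rewrite ?normr1 ?normr0.
Qed.

Lemma ExpD f g : bounded_rv f -> bounded_rv g ->
  Exp (fun x => f x + g x) = Exp f + Exp g.
Proof. by move=> bf bg; apply: RintegralD => //; exact: bounded_rv_integrable. Qed.

Lemma ExpZ c f : bounded_rv f -> Exp (fun x => c * f x) = c * Exp f.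
Proof. by move=> bf; apply: RintegralZl => //; exact: bounded_rv_integrable. Qed.

Lemma ExpB f g : bounded_rv f -> bounded_rv g ->
  Exp (fun x => f x - g x) = Exp f - Exp g.
Proof. by move=> bf bg; apply: RintegralB => //; exact: bounded_rv_integrable. Qed.

Lemma Exp_cst c : Exp (cst c) = c.
Proof. by rewrite /Exp Rintegral_cst//= (@probability_setT _ _ _ P) mulr1. Qed.

Lemma Exp_sum (I : Type) (r : seq I) (F : I -> T -> R) :
  (forall i, bounded_rv (F i)) ->
  Exp (fun x => \sum_(i <- r) F i x) = \sum_(i <- r) Exp (F i).
Proof.
move=> bF; elim: r => [|i r IH].
  by under eq_fun do rewrite big_nil; rewrite big_nil Exp_cst.
under eq_fun do rewrite big_cons.
by rewrite big_cons ExpD// ?IH//; exact: bounded_rv_sum.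
Qed.

Lemma Exp_le f g : bounded_rv f -> bounded_rv g -> (forall x, f x <= g x) ->
  Exp f <= Exp g.
Proof.
by move=> bf bg fg; apply: le_Rintegral => //; exact: bounded_rv_integrable.
Qed.

Lemma Exp_norm_le f : bounded_rv f -> `|Exp f| <= Exp (fun x => `|f x|).
Proof. by move=> bf; apply: le_normr_Rintegral => //; exact: bounded_rv_integrable. Qed.

Lemma Exp_le_cst f C : bounded_rv f -> (forall x, `|f x| <= C) -> `|Exp f| <= C.
Proof.
move=> bf fC; apply: le_trans (Exp_norm_le bf) _.
by rewrite -[leRHS]Exp_cst; apply: Exp_le => //; [exact: bounded_rv_norm|exact: bounded_rv_cst].
Qed.

Lemma Exp_indic (A : set T) : measurable A -> Exp (\1_A) = fine (P A).
Proof. by move=> mA; rewrite /Exp /Rintegral integral_indic// setIT. Qed.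

(** The exceptional event costs at most [C *+ 2] times its probability, whatever happens there; this
    is how small events are discarded in the convergence criterion. *)
Lemma Exp_close f g (E : set T) e p C : bounded_rv f -> bounded_rv g -> measurable E ->
  fine (P E) <= p -> 0 <= e -> (forall x, `|f x| <= C) -> (forall x, `|g x| <= C) ->
  (forall x, ~ E x -> `|f x - g x| <= e) -> `|Exp f - Exp g| <= e + C *+ 2 * p.
Proof.
move=> bf bg mE Ep e0 fC gC fg.
have C0 : 0 <= C by apply: le_trans (fC point).
have bE := bounded_rv_indic mE.
rewrite -ExpB//; apply: le_trans (Exp_norm_le (bounded_rvB bf bg)) _.
apply: (@le_trans _ _ (Exp (fun x => e + C *+ 2 * \1_E x))).
  apply: Exp_le; first exact/bounded_rv_norm/bounded_rvB.
    by apply: bounded_rvD (bounded_rv_cst e) _; exact: bounded_rvZ.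
  move=> x; have [Ex|nEx] := pselect (E x).
    rewrite indicE mem_set// mulr1 -[leLHS]add0r lerD//.
    by rewrite (le_trans (ler_normB _ _))// mulr2n lerD.
  by rewrite indicE memNset// mulr0 addr0 fg.
rewrite ExpD ?ExpZ ?Exp_cst ?Exp_indic//; last exact: bounded_rvZ.
  by rewrite lerD2l ler_wpM2l// mulrn_wge0.
exact: bounded_rv_cst.
Qed.

End BoundedExpectation.

(** * Fejér interpolation by trigonometric polynomials *)

Section TrigonometricPolynomials.
Context {R : realType}.

Definition dot m (t x : 'cV[R]_m) : R := (t^T *m x) 0 0.

Lemma dotE m (t x : 'cV[R]_m) : dot t x = \sum_i t i 0 * x i 0.
Proof. by rewrite /dot mxE; apply: eq_bigr => i _; rewrite mxE. Qed.

Lemma dotDl m (s t x : 'cV[R]_m) : dot (s + t) x = dot s x + dot t x.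
Proof. by rewrite /dot raddfD/= mulmxDl mxE. Qed.

Lemma dotNl m (t x : 'cV[R]_m) : dot (- t) x = - dot t x.
Proof. by rewrite /dot raddfN/= mulNmx mxE. Qed.

Lemma dotZl m a (t x : 'cV[R]_m) : dot (a *: t) x = a * dot t x.
Proof. by rewrite /dot linearZ/= -scalemxAl mxE. Qed.

(** The phase [theta] puts sines among the generators, so the algebra stays real and convergence has
    to be tested on cosines only. *)
Inductive trig_poly m : ('cV[R]_m -> R) -> Prop :=
| trig_cos t theta : trig_poly (fun x => cos (dot t x + theta))
| trigD f g : trig_poly f -> trig_poly g -> trig_poly (fun x => f x + g x)
| trigZ c f : trig_poly f -> trig_poly (fun x => c * f x).

Lemma trig_cst m c : trig_poly (fun _ : 'cV[R]_m => c).
Proof.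
have := trigZ c (trig_cos (0 : 'cV[R]_m) 0); congr trig_poly; apply/funext => x.
by rewrite dotE big1 ?addr0 ?cos0 ?mulr1// => i _; rewrite mxE mul0r.
Qed.

Lemma trig_sum m (I : Type) (r : seq I) (F : I -> 'cV[R]_m -> R) :
  (forall i, trig_poly (F i)) -> trig_poly (fun x => \sum_(i <- r) F i x).
Proof.
move=> tF; elim: r => [|i r IH].
  by under eq_fun do rewrite big_nil; exact: trig_cst.
by under eq_fun do rewrite big_cons; exact: trigD.
Qed.

Lemma trigM m (f g : 'cV[R]_m -> R) :
  trig_poly f -> trig_poly g -> trig_poly (fun x => f x * g x).
Proof.
move=> + tg; elim: tg f => [t th|g1 g2 _ IH1 _ IH2|c g1 _ IH1] f tf.
- elim: tf => [s th'|f1 f2 _ IH1 _ IH2|c f1 _ IH1].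
  + have := trigD (trigZ 2^-1 (trig_cos (s + t) (th' + th)))
                  (trigZ 2^-1 (trig_cos (s - t) (th' - th))).
    congr trig_poly; apply/funext => x; rewrite !dotDl dotNl.
    rewrite (_ : _ + (th' + th) = (dot s x + th') + (dot t x + th)); last by ring.
    rewrite (_ : _ + (th' - th) = (dot s x + th') - (dot t x + th)); last by ring.
    by rewrite cosD cosB; field.
  + by have := trigD IH1 IH2; congr trig_poly; apply/funext => x; rewrite mulrDl.
  + by have := trigZ c IH1; congr trig_poly; apply/funext => x; rewrite mulrA.
- have := trigD (IH1 _ tf) (IH2 _ tf).
  by congr trig_poly; apply/funext => x; rewrite mulrDr.
- by have := trigZ c (IH1 _ tf); congr trig_poly; apply/funext => x; rewrite mulrCA.
Qed.

Lemma trig_prod m (I : Type) (r : seq I) (F : I -> 'cV[R]_m -> R) :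
  (forall i, trig_poly (F i)) -> trig_poly (fun x => \prod_(i <- r) F i x).
Proof.
move=> tF; elim: r => [|i r IH].
  by under eq_fun do rewrite big_nil; exact: trig_cst.
by under eq_fun do rewrite big_cons; exact: trigM.
Qed.

(** The squared modulus of the exponential sum, divided by n^2 rather than n: the Fejér kernel
    normalised to be 1 at 0, so that its translates over n equidistant nodes form a partition of
    unity. *)
Definition fejer (n : nat) (x : R) : R :=
  n%:R^-2 * \sum_(k < n) \sum_(l < n) cos ((k%:R - l%:R) * x).

Lemma fejerE n x : fejer n x =
  n%:R^-2 * ((\sum_(k < n) cos (k%:R * x)) ^+ 2 + (\sum_(k < n) sin (k%:R * x)) ^+ 2).
Proof.
rewrite /fejer; congr (_ * _); rewrite !expr2 !big_distrlr/= -big_split/=.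
apply: eq_bigr => k _; rewrite -big_split/=; apply: eq_bigr => l _.
by rewrite mulrBl cosB.
Qed.

Lemma fejer_ge0 n x : 0 <= fejer n x.
Proof. by rewrite fejerE mulr_ge0 ?invr_ge0 ?exprn_ge0// addr_ge0 ?sqr_ge0. Qed.

(** Each term satisfies 2 sin h cos y = sin (y + h) - sin (y - h), and consecutive arguments differ
    by 2h. *)
Lemma sum_cos_telescope n (a h : R) :
  2 * sin h * \sum_(k < n) cos (a + k%:R * (2 * h)) =
  sin (a + n%:R * (2 * h) - h) - sin (a - h).
Proof.
elim: n => [|n IH]; first by rewrite big_ord0 mul0r addr0 mulr0 subrr.
rewrite big_ord_recr/= mulrDr IH -[n.+1%:R]natr1.
rewrite (_ : a + (n%:R + 1) * _ - h = (a + n%:R * (2 * h)) + h); last by ring.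
set y := a + n%:R * (2 * h).
by rewrite (sinD y h) (sinB y h); ring.
Qed.

Lemma sum_cos_le n (a x : R) : `|sin (x / 2)| * `|\sum_(k < n) cos (a + k%:R * x)| <= 1.
Proof.
have := sum_cos_telescope n a (x / 2); rewrite (_ : 2 * (x / 2) = x); last by field.
move=> /(congr1 Num.norm); rewrite !normrM (ger0_norm (ler0n _ _)) => e.
have := ler_normB (sin (a + n%:R * x - x / 2)) (sin (a - x / 2)).
have := sin_max (a + n%:R * x - x / 2); have := sin_max (a - x / 2).
rewrite -e; lra.
Qed.

(** The phases 0 and - pi / 2 in [sum_cos_le] treat the cosine sum and the sine sum separately; the
    factor 2 comes from adding the two bounds. *)
Lemma fejer_le n x : sin (x / 2) != 0 -> fejer n x <= 2 / (n%:R * sin (x / 2)) ^+ 2.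
Proof.
move=> s0; rewrite fejerE [leRHS](_ : _ = n%:R^-2 * (2 / sin (x / 2) ^+ 2)); last first.
  by rewrite exprMn invfM mulrCA.
rewrite ler_wpM2l ?invr_ge0 ?exprn_ge0//.
have s2 : 0 < sin (x / 2) ^+ 2 by rewrite exprn_even_gt0.
rewrite ler_pdivlMr//.
have c := sum_cos_le n 0 x; have s := sum_cos_le n (- (pi / 2)) x.
rewrite [leRHS](_ : _ = 1 ^+ 2 + 1 ^+ 2) ?mulrDl; last by rewrite !expr1n.
rewrite -!exprMn; apply: lerD.
  rewrite -[leLHS]real_normK ?num_real// ler_pXn2r ?nnegrE// normrM mulrC.
  by under [X in _ * `|X| <= _]eq_bigr do rewrite -[X in cos X]add0r.
rewrite -[leLHS]real_normK ?num_real// ler_pXn2r ?nnegrE// normrM mulrC.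
by under [X in _ * `|X| <= _]eq_bigr do rewrite -cosBpihalf addrC.
Qed.

(** Over the n nodes the argument advances by d full turns, so the two ends of the telescoped sum
    agree; [sin h] can be cancelled because k pi / n lies strictly between 0 and pi. *)
Lemma sum_cos_roots n (d a : R) k : (k < n)%N -> (0 < k)%N -> d = k%:R \/ d = - k%:R ->
  \sum_(j < n) cos (a + j%:R * (d * (pi *+ 2 / n%:R))) = 0.
Proof.
move=> kn k0 dk; pose h := d * (pi / n%:R).
have n_gt0 : (0 < n)%N := ltn_trans k0 kn.
have n0 : n%:R != 0 :> R by rewrite pnatr_eq0 -lt0n.
have sh : sin h != 0.
  have : (0 : R) < k%:R * (pi / n%:R) < @pi R.
    rewrite mulr_gt0 ?ltr0n ?divr_gt0 ?pi_gt0 ?ltr0n//=.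
    rewrite mulrCA -[ltRHS]mulr1 ltr_pM2l ?pi_gt0//.
    by rewrite ltr_pdivrMr ?mul1r ?ltr_nat// ltr0n.
  move/sin_gt0_pi; rewrite /h; case: dk => ->; first by move/gt_eqF/negbT.
  by rewrite mulNr sinN oppr_eq0 => /gt_eqF/negbT.
have := sum_cos_telescope n a h.
rewrite (_ : 2 * h = d * (pi *+ 2 / n%:R)); last by rewrite /h mulr2n; field.
rewrite (_ : sin (a + _ - h) = sin (a - h)).
  move/eqP; rewrite subrr mulf_eq0 mulf_eq0 (negbTE sh) pnatr_eq0/= => /eqP H.
  by rewrite -[RHS]H.
rewrite (_ : a + _ - h = (a - h) + d * (pi *+ 2)); last by rewrite mulr2n; field.
case: dk => ->; first by rewrite mulr_natl periodicn//; exact: sinD2pi.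
rewrite -[in RHS](subrK (k%:R * (pi *+ 2)) (a - h)) mulNr mulr_natl.
by apply/esym/periodicn; exact: sinD2pi.
Qed.

(** After exchanging the sums only the diagonal k = l survives, and it contributes n * n against the
    normalisation n^-2. *)
Lemma sum_fejer n x : (0 < n)%N ->
  \sum_(j < n) fejer n (x + j%:R * (pi *+ 2 / n%:R)) = 1.
Proof.
move=> n0; have nn : n%:R != 0 :> R by rewrite pnatr_eq0 -lt0n.
rewrite /fejer -mulr_sumr exchange_big/=.
rewrite (eq_bigr (fun=> n%:R)); last first.
  move=> k _; rewrite exchange_big/= (bigD1 k)//= [X in _ + X]big1 ?addr0.
    under eq_bigr do rewrite subrr mul0r cos0.
    by rewrite sumr_const card_ord.
  move=> l lk.
  under eq_bigr do rewrite mulrDr [(_ - _) * (_%:R * _)]mulrCA.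
  have [kl|kl] := ltnP k l.
    apply: (@sum_cos_roots _ _ _ (l - k)); rewrite ?subn_gt0//.
      by rewrite (leq_ltn_trans (leq_subr _ _)).
    by right; rewrite natrB ?opprB// ltnW.
  have lk' : (l < k)%N by rewrite ltn_neqAle kl lk.
  apply: (@sum_cos_roots _ _ _ (k - l)); rewrite ?subn_gt0//.
    by rewrite (leq_ltn_trans (leq_subr _ _)).
  by left; rewrite natrB.
by rewrite sumr_const card_ord -[X in _ * X]mulr_natr -expr2 mulVf// expf_neq0.
Qed.

End TrigonometricPolynomials.

Section TrigonometricInterpolation.
Context {R : realType}.
Variables (m : nat) (f : 'cV[R]_m -> R) (C K : R).
Hypotheses (cf : continuous f) (fC : forall x, `|f x| <= C) (K0 : 0 < K).

Let L := K *+ 4.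
(* The interpolation nodes form a grid of n points per period [L = 4K] in each
   coordinate, so that the kernel sees points of [-K, K] at their true distance. *)
Definition grid n (j : nat) : R := - (K *+ 2) + j%:R * (L / n%:R).
Definition grid_pt n (J : {ffun 'I_m -> 'I_n}) : 'cV[R]_m := \col_i grid n (J i).
Definition grid_wt n (J : {ffun 'I_m -> 'I_n}) (x : 'cV[R]_m) : R :=
  \prod_i fejer n ((grid n (J i) - x i 0) * (pi *+ 2 / L)).
Definition trig_interp n (x : 'cV[R]_m) : R :=
  \sum_(J : {ffun 'I_m -> 'I_n}) f (grid_pt J) * grid_wt J x.

Let L0 : 0 < L. Proof. by rewrite pmulrn_lgt0. Qed.

Lemma trig_interp_trig n : trig_poly (trig_interp n).
Proof.
apply: trig_sum => J; apply: trigZ; apply: trig_prod => i; apply: trigZ.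
apply: trig_sum => k; apply: trig_sum => l.
pose a : R := (k%:R - l%:R) * (pi *+ 2 / L).
have := trig_cos (- a *: delta_mx i 0) (a * grid n (J i)).
congr trig_poly; apply/funext => x; rewrite dotZl.
rewrite (_ : dot _ x = x i 0); first by congr cos; rewrite /a; ring.
by rewrite /dot trmx_delta -rowE mxE.
Qed.

Lemma grid_sum n (u : R) : (0 < n)%N ->
  \sum_(j < n) fejer n ((grid n j - u) * (pi *+ 2 / L)) = 1.
Proof.
move=> n0; rewrite -[RHS](sum_fejer ((- (K *+ 2) - u) * (pi *+ 2 / L)) n0).
apply: eq_bigr => j _; congr fejer; rewrite /grid.
have nn : n%:R != 0 :> R by rewrite pnatr_eq0 -lt0n.
by field; rewrite nn/= (gt_eqF K0).
Qed.

Lemma grid_wt_ge0 n (J : {ffun 'I_m -> 'I_n}) x : 0 <= grid_wt J x.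
Proof. by apply: prodr_ge0 => i _; exact: fejer_ge0. Qed.

Lemma grid_wt_sum n x : (0 < n)%N -> \sum_(J : {ffun 'I_m -> 'I_n}) grid_wt J x = 1.
Proof.
move=> n0; rewrite -(bigA_distr_bigA (fun i (j : 'I_n) => fejer n ((grid n j - x i 0) * (pi *+ 2 / L)))).
by rewrite big1// => i _; exact: grid_sum.
Qed.

Lemma grid_wt_marginal n x i (A : pred 'I_n) : (0 < n)%N ->
  \sum_(J : {ffun 'I_m -> 'I_n} | A (J i)) grid_wt J x =
  \sum_(j < n | A j) fejer n ((grid n j - x i 0) * (pi *+ 2 / L)).
Proof.
move=> n0.
(* Setting the kernel of coordinate i to 0 at the excluded nodes turns the restricted sum into a
   full product of sums, whose other factors are 1. *)
pose F k (j : 'I_n) := (if (k == i) && ~~ A j then 0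
  else fejer n ((grid n j - x k 0) * (pi *+ 2 / L))).
transitivity (\prod_k \sum_(j < n) F k j).
  rewrite bigA_distr_bigA/= [RHS](bigID (fun J : {ffun 'I_m -> 'I_n} => A (J i)))/=.
  rewrite [X in _ = _ + X]big1 ?addr0.
    apply: eq_bigr => J AJ; apply: eq_bigr => k _; rewrite /F.
    by case: eqP => // ->; rewrite AJ.
  by move=> J AJ; rewrite (bigD1 i)//= /F eqxx AJ mul0r.
rewrite (bigD1 i)//= [X in _ * X]big1 ?mulr1.
  rewrite [RHS]big_mkcond/=; apply: eq_bigr => j _; rewrite /F eqxx/=.
  by case: (A j).
move=> k ki; rewrite /F (negbTE ki)/=; exact: grid_sum.
Qed.

Lemma trig_interp_le n x : (0 < n)%N -> `|trig_interp n x| <= C.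
Proof.
move=> n0; rewrite (le_trans (ler_norm_sum _ _ _))//.
apply: (@le_trans _ _ (\sum_(J : {ffun 'I_m -> 'I_n}) C * grid_wt J x)).
  by apply: ler_sum => J _; rewrite normrM ler_pM// ger0_norm// grid_wt_ge0.
by rewrite -mulr_sumr grid_wt_sum// mulr1.
Qed.

Lemma grid_bound n (j : 'I_n) : - (K *+ 2) <= grid n j <= K *+ 2.
Proof.
have n0 : (0 < n)%N by case: n j => [[]|].
rewrite /grid; apply/andP; split.
  by rewrite lerDl mulr_ge0 ?divr_ge0// ltW.
rewrite addrC lerBlDr -mulrnDr.
rewrite mulrCA -[leRHS]mulr1 ler_pM2l// ler_pdivrMr ?ltr0n// mul1r ler_nat.
exact: ltnW.
Qed.

(** A node of [-2K, 2K] and a point of [-K, K] are at most 3K apart, a period being 4K; the angle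
    thus lies between delta pi / L <= pi / 4 and 3 pi / 4, where the sine cannot come back near 0.
    This is why the period is twice the width of the cube. *)
Lemma sin_grid_far (u v delta : R) : 0 < delta -> delta <= K ->
  `|u| <= K -> - (K *+ 2) <= v <= K *+ 2 -> delta <= `|v - u| ->
  sin (delta * pi / L) ^+ 2 <= sin ((v - u) * (pi *+ 2 / L) / 2) ^+ 2.
Proof.
move=> d0 dK uK vK dvu; set t := `|v - u| * pi / L.
have p0 := pi_gt0 R.
have -> : sin ((v - u) * (pi *+ 2 / L) / 2) ^+ 2 = sin t ^+ 2.
  rewrite (_ : _ / 2 = (v - u) * pi / L); last by field; rewrite gt_eqF.
  rewrite /t; case: (ger0P (v - u)) => // _.
  by rewrite !mulNr sinN sqrrN.
have tK : `|v - u| <= K * 3.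
  by move: uK vK; rewrite !ler_norml; lra.
have st : delta * pi / L <= t by rewrite ler_pM2r ?invr_gt0// ler_pM2r.
have s4 : delta * pi / L <= pi / 4.
  by rewrite ler_pdivrMr// (_ : pi / 4 * L = K * pi) ?ler_pM2r// /L; field.
have t4 : t <= pi * 3 / 4.
  rewrite /t ler_pdivrMr// (_ : pi * 3 / 4 * L = K * 3 * pi) ?ler_pM2r//.
  by rewrite /L; field.
have sd0 : 0 < delta * pi / L by rewrite divr_gt0// mulr_gt0.
have sle a b : 0 < a -> a <= b -> b <= pi / 2 -> sin a ^+ 2 <= sin b ^+ 2.
  move=> a0 ab b2.
  have sa : 0 <= sin a by apply: sin_ge0_pi; apply/andP; split; lra.
  have sb : 0 <= sin b by apply: sin_ge0_pi; apply/andP; split; lra.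
  rewrite ler_pXn2r ?nnegrE//; have [->|ab'] := eqVneq a b; first by [].
  by apply/ltW; rewrite ltr_sin ?lt_neqAle ?ab' ?ab// in_itv/=; apply/andP; split; lra.
have [t2|t2] := leP t (pi / 2); first exact: sle.
have -> : sin t = sin (pi - t).
  by rewrite sinB sinpi cospi; ring.
by apply: sle => //; lra.
Qed.

Lemma compact_cube : compact [set x : 'cV[R]_m | forall i, `|x i 0| <= K].
Proof.
have := @rV_compact R m (fun=> `[- K, K]%classic) (fun=> @segment_compact _ _ _).
have tc : continuous (@trmx R 1 m).
  move=> x A [B xB BA]; exists (fun i j => B j i) => [i j|y yB].
    by have := xB j i; rewrite mxE.
  by apply: BA => i j; rewrite mxE; exact: yB.
move=> /(continuous_compact (continuous_subspaceT tc)); congr compact.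
apply/seteqP; split => [_ [y yK <-] i|x xK].
  by have := yK i; rewrite /= in_itv/= -ler_norml mxE.
by exists x^T; [move=> i /=; rewrite in_itv/= -ler_norml mxE|rewrite trmxK].
Qed.

(** Only [x] is confined to the cube: the perturbed point may leave it, as happens to a statistic
    that is merely close to a bounded one. Compactness enters through the near-covering property,
    with a radius tending to 0 from the right. *)
Lemma unif_continuous_cube (e : R) : 0 < e -> exists delta : R, [/\ 0 < delta, delta <= K &
  forall x y : 'cV[R]_m, (forall i, `|x i 0| <= K) -> (forall i, `|y i 0 - x i 0| < delta) ->
    `|f y - f x| <= e].
Proof.
move=> e0; pose Q (dl : R) (x : 'cV[R]_m) := forall y : 'cV[R]_m,
  (forall i, `|y i 0 - x i 0| < dl) -> `|f y - f x| <= e.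
have /compact_near_coveringP/(_ R (0 : R)^'+ Q _) := compact_cube.
case.
  move=> x _; have e2 : 0 < e / 2 by rewrite divr_gt0.
  have /cvgrPdist_lt/(_ _ e2)/nbhs_ballP[r r0 xr] := @cf x.
  have r2 : 0 < r / 2 by rewrite divr_gt0.
  exists (ball x (r / 2), [set dl : R | dl < r / 2]) => /=.
    by split; [exact: nbhsx_ballx|exact: nbhs_right_lt].
  move=> [x' dl] [/= xx' dlr] y x'y.
  have fy : `|f x - f y| < e / 2.
    apply: xr; rewrite [r]splitr; apply: ball_triangle xx' _; split=> // i j.
    by rewrite ord1 /ball/= distrC (lt_trans (x'y i)).
  have fx' : `|f x - f x'| < e / 2.
    by apply: xr; apply: le_ball xx'; rewrite ler_pdivrMr// ler_peMr ?ltW// ltr1n.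
  rewrite (_ : f y - f x' = (f x - f x') - (f x - f y)); last by ring.
  rewrite (le_trans (ler_normB _ _))// [e]splitr; apply/ltW; exact: ltrD.
move=> dl /= dl0 H; pose dd := Num.min (dl / 2) K.
have dd0 : 0 < dd by rewrite lt_min K0 divr_gt0.
exists dd; split => //; first by rewrite ge_min lexx orbT.
move=> x y xK xy; apply: (H dd) => //=.
rewrite sub0r normrN gtr0_norm// gt_min; apply/orP; left.
by rewrite ltr_pdivrMr// ltr_pMr// ltr1n.
Qed.

Lemma trig_interp_approx (e : R) : 0 < e -> exists2 n, (0 < n)%N &
  forall x : 'cV[R]_m, (forall i, `|x i 0| <= K) -> `|f x - trig_interp n x| <= e.
Proof.
move=> e0; have e2 : 0 < e / 2 by rewrite divr_gt0.
have [dl [d0 dK fd]] := unif_continuous_cube e2.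
pose s := sin (dl * pi / L) ^+ 2.
have p0 := pi_gt0 R.
have s0 : 0 < s.
  rewrite exprn_gt0//; apply: sin_gt0_pi; rewrite divr_gt0 ?mulr_gt0//=.
  rewrite ltr_pdivrMr// mulrC ltr_pM2l// (le_lt_trans dK)//.
  by rewrite /L -[ltLHS]mulr1n ltr_pMn2l.
have C0 : 0 <= C := le_trans (normr_ge0 _) (fC 0).
(* A far node has weight at most 2 / (n^2 s) in the coordinate where it is far; with n nodes, m
   coordinates and an oscillation of f at most 2C, the far part is at most c / n. *)
pose c := C * 2 * (m%:R * (2 / s)).
have c0 : 0 <= c by rewrite !mulr_ge0// ?invr_ge0 ltW.
pose n := (Num.truncn (c / (e / 2))).+1.
exists n => // x xK.
have nn0 : 0 < n%:R :> R by rewrite ltr0n.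
rewrite -[f x]mulr1 -(grid_wt_sum x (ltn0Sn _ : (0 < n)%N)) mulr_sumr -sumrB.
rewrite (le_trans (ler_norm_sum _ _ _))//.
pose far i (J : {ffun 'I_m -> 'I_n}) := dl <= `|grid n (J i) - x i 0|.
apply: (@le_trans _ _ (\sum_(J : {ffun 'I_m -> 'I_n}) (e / 2 * grid_wt J x +
   \sum_i (if far i J then C * 2 * grid_wt J x else 0)))).
  apply: ler_sum => J _; rewrite -mulrBl normrM (ger0_norm (grid_wt_ge0 _ _)).
  have [/existsP[i Ji]|/existsPn near_J] := boolP [exists i, far i J].
    rewrite (bigD1 i)//= Ji addrCA -[leLHS]addr0 lerD//.
      rewrite ler_wpM2r ?grid_wt_ge0// (le_trans (ler_normB _ _))//.
      by rewrite mulr_natr mulr2n lerD.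
    rewrite addr_ge0 ?mulr_ge0 ?grid_wt_ge0 ?invr_ge0 ?(ltW e0)//.
    by apply: sumr_ge0 => j _; case: ifP => // _; rewrite !mulr_ge0 ?grid_wt_ge0.
  rewrite -[leLHS]addr0 lerD// ?ler_wpM2r ?grid_wt_ge0//.
    by rewrite distrC fd// => i; rewrite mxE ltNge; exact: near_J.
  by apply: sumr_ge0 => j _; case: ifP => // _; rewrite !mulr_ge0 ?grid_wt_ge0.
rewrite big_split/= -mulr_sumr grid_wt_sum// mulr1 exchange_big/= [leRHS]splitr lerD2l.
apply: (@le_trans _ _ (\sum_(i < m) C * 2 * (n%:R * (2 / (n%:R ^+ 2 * s))))).
  apply: ler_sum => i _; rewrite -big_mkcond/= -mulr_sumr ler_wpM2l ?mulr_ge0//.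
  rewrite (grid_wt_marginal x i (fun j : 'I_n => dl <= `|grid n j - x i 0|))//.
  apply: (@le_trans _ _ (\sum_(j < n | dl <= `|grid n j - x i 0|) 2 / (n%:R ^+ 2 * s))).
    apply: ler_sum => j jx.
    have sg := sin_grid_far d0 dK (xK i) (grid_bound j) jx.
    have sg0 := lt_le_trans s0 sg.
    apply: le_trans (fejer_le _ _) _; first by move: sg0; rewrite exprn_even_gt0.
    rewrite exprMn; apply: ler_wpM2l => //; have nn2 : 0 < n%:R ^+ 2 :> R by rewrite exprn_gt0.
    by rewrite lef_pV2 ?posrE ?(mulr_gt0 nn2)// ler_pM2l.
  rewrite sumr_const -[leLHS]mulr_natl; apply: ler_wpM2r.
    by rewrite divr_ge0// (mulr_ge0 (exprn_ge0 _ (ltW nn0)) (ltW s0)).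
  by rewrite ler_nat (leq_trans (max_card _))// card_ord.
rewrite sumr_const card_ord -[leLHS]mulr_natr.
rewrite (_ : _ * m%:R = c / n%:R); last first.
  by rewrite /c; field; rewrite (gt_eqF s0) gt_eqF.
rewrite ler_pdivrMr// mulrC -ler_pdivrMr//; apply/ltW.
by rewrite /n; have := truncnS_gt (c / (e / 2)).
Qed.

End TrigonometricInterpolation.

(** The bound C is kept on the whole space, because the interpolation weights are nonnegative with
    sum 1; a uniform approximation on the cube alone would say nothing about the part of the law
    outside it. *)
Lemma trig_poly_approx (R : realType) m (f : 'cV[R]_m -> R) (C K e : R) : continuous f ->
  (forall x, `|f x| <= C) -> 0 < K -> 0 < e ->
  exists g : 'cV[R]_m -> R, [/\ trig_poly g, forall x, `|g x| <= C &
    forall x : 'cV[R]_m, (forall i, `|x i 0| <= K) -> `|f x - g x| <= e].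
Proof.
move=> cf fC K0 e0; have [n n0 fn] := trig_interp_approx cf fC K0 e0.
exists (trig_interp f K n); split => //; first exact: trig_interp_trig.
by move=> x; exact: trig_interp_le.
Qed.

(** * A characteristic-function criterion for convergence in law *)

Section WeakConvergence.
Context {R : realType}.

(** Measurability is tested by continuous functions, which is what the expectations in the limit
    theorem require; it is immediate for an arbitrary function of a finite-valued variable. *)
Definition cont_measurable d (T : measurableType d) m (W : T -> 'cV[R]_m) :=
  forall f : 'cV[R]_m -> R, continuous f -> measurable_fun setT (f \o W).

Lemma normr_coord_le m (x : 'cV[R]_m) i : `|x i 0| <= `|x|.
Proof.
by rewrite [leRHS]/Num.norm/= mx_normrE; exact: (le_bigmax _ (fun ij => `|x ij.1 ij.2|) (i, 0)).
Qed.

Lemma open_measurable_borel_cV m (U : set 'cV[R]_m) : open U ->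
  measurable (U : set (borel_cV R m)).
Proof. exact: sub_sigma_algebra. Qed.

Lemma cont_measurable_borel m : @cont_measurable _ (borel_cV R m) m id.
Proof.
move=> f /continuousP cf; apply: (measurability _ (RGenOpens.measurableE R)).
move=> _ [U [a [b ->]] <-]; rewrite setTI.
by apply: open_measurable_borel_cV; apply: cf; exact: interval_open.
Qed.

Lemma cvg_sumr (V : normedModType R) (T : Type) (F : set_system T) {FF : Filter F}
    (I : Type) (r : seq I) (f : I -> T -> V) (l : I -> V) :
  (forall i, f i x @[x --> F] --> l i) ->
  \sum_(i <- r) f i x @[x --> F] --> \sum_(i <- r) l i.
Proof.
move=> fl; elim: r => [|i r IH].
  by rewrite big_nil; under eq_cvg do rewrite big_nil; exact: cvg_cst.
by rewrite big_cons; under eq_cvg do rewrite big_cons; exact: cvgD.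
Qed.

Lemma continuous_dot m (t : 'cV[R]_m) : continuous (dot t).
Proof.
move=> x; rewrite /continuous_at (_ : dot t = (fun x => \sum_i t i 0 * x i 0)).
  have := @cvg_sumr R^o _ (nbhs x) (nbhs_filter x) _ (index_enum 'I_m)
    (fun i (y : 'cV[R]_m) => t i 0 * y i 0) (fun i => t i 0 * x i 0); apply => i.
  by apply: (@cvgM _ _ (nbhs x) (nbhs_filter x)); [exact: cvg_cst|exact: coord_continuous].
by apply/funext => y; rewrite dotE.
Qed.

Lemma continuous_trig m (f : 'cV[R]_m -> R) : trig_poly f -> continuous f.
Proof.
elim=> [t th|f1 f2 _ c1 _ c2|c f1 _ c1] x.
- have h : (dot t y + th) @[y --> x] --> dot t x + th.
    by apply: (@cvgD _ R^o _ (nbhs x) (nbhs_filter x)); [exact: (@continuous_dot m t x)|exact: cvg_cst].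
  by apply: (continuous_comp h); exact: continuous_cos.
- by apply: (@cvgD _ R^o _ (nbhs x) (nbhs_filter x)); [exact: c1|exact: c2].
- by apply: (@cvgM _ _ (nbhs x) (nbhs_filter x)); [exact: cvg_cst|exact: c1].
Qed.

Lemma bounded_trig m (f : 'cV[R]_m -> R) : trig_poly f -> exists C, forall x, `|f x| <= C.
Proof.
elim=> [t th|f1 f2 _ [C1 c1] _ [C2 c2]|c f1 _ [C c1]].
- by exists 1 => x; exact: cos_max.
- by exists (C1 + C2) => x; rewrite (le_trans (ler_normD _ _))// lerD.
- by exists (`|c| * C) => x; rewrite normrM ler_wpM2l.
Qed.

Lemma bounded_rv_cont d (T : measurableType d) m (W : T -> 'cV[R]_m) (f : 'cV[R]_m -> R) :
  cont_measurable W -> continuous f -> (exists C, forall x, `|f x| <= C) ->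
  bounded_rv (f \o W).
Proof. by move=> mW cf [C fC]; split; [exact: mW|exists C => x /=]. Qed.

Lemma bounded_rv_trig d (T : measurableType d) m (W : T -> 'cV[R]_m) (f : 'cV[R]_m -> R) :
  cont_measurable W -> trig_poly f -> bounded_rv (f \o W).
Proof.
by move=> mW tf; apply: bounded_rv_cont => //; [exact: continuous_trig|exact: bounded_trig].
Qed.

Lemma tight_rv d (T : measurableType d) (P : probability T R) m (V : T -> 'cV[R]_m) (e : R) :
  cont_measurable V -> 0 < e ->
  exists K, [/\ 0 < K, measurable [set w | K < `|V w|] & fine (P [set w | K < `|V w|]) <= e].
Proof.
move=> mV e0; pose F (n : nat) : set T := [set w | n%:R < `|V w|].
have mF n : measurable (F n).
  have mn : measurable_fun setT (fun w => `|V w| : R).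
    by apply: (mV (fun x => `|x|)); exact: norm_continuous.
  rewrite (_ : F n = (fun w => `|V w| : R) @^-1` `]n%:R, +oo[); last first.
    by apply/seteqP; split => w; rewrite /F/= in_itv/= andbT.
  by rewrite -[X in measurable X]setTI; exact: mn.
have F0 : \bigcap_n F n = set0.
  rewrite -subset0 => x /(_ (Num.truncn `|V x|).+1 I).
  by rewrite /F/= ltNge ltW// truncnS_gt.
have := @nonincreasing_cvg_mu _ _ R P F.
rewrite F0 measure0 => H.
have {H} : P (F n) @[n --> \oo] --> 0%:E.
  apply: H => //.
- by rewrite (le_lt_trans (probability_le1 _ _))// ltry.
- move=> n k nk; apply/subsetPset => x /=; apply: le_lt_trans; by rewrite ler_nat.
move=> /fine_cvg /= /cvgrPdist_le /(_ _ e0)[n _ /(_ n.+1 (leqnSn n))].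
rewrite sub0r normrN => H; exists n.+1%:R; split => //; first exact: mF.
by apply: le_trans H; exact: ler_norm.
Qed.

Lemma Exp_trig_cvg d (T : measurableType d) (P : probability T R)
    d' (T' : measurableType d') (P' : probability T' R) m
    (W : nat -> T -> 'cV[R]_m) (V : T' -> 'cV[R]_m) :
  (forall n, cont_measurable (W n)) -> cont_measurable V ->
  (forall t theta, Exp P (fun w => cos (dot t (W n w) + theta)) @[n --> \oo] -->
     Exp P' (fun w => cos (dot t (V w) + theta))) ->
  forall f, trig_poly f -> Exp P (f \o W n) @[n --> \oo] --> Exp P' (f \o V).
Proof.
move=> mW mV cW f; elim=> [t th|f1 f2 t1 c1 t2 c2|c f1 t1 c1]; first exact: cW.
- rewrite (ExpD P' (bounded_rv_trig mV t1) (bounded_rv_trig mV t2)).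
  under eq_cvg do rewrite (ExpD P (bounded_rv_trig (mW _) t1) (bounded_rv_trig (mW _) t2)).
  exact: cvgD.
- rewrite (ExpZ P' _ (bounded_rv_trig mV t1)).
  under eq_cvg do rewrite (ExpZ P _ (bounded_rv_trig (mW _) t1)).
  by apply: cvgM => //; exact: cvg_cst.
Qed.

(** In the last hypothesis [K] is chosen before [eta]: W is tight, and Z - W tends to 0 in
    probability. Four replacements lead from f(Z) to f(V) through f(W), g(W) and g(V), where g is a
    trigonometric polynomial close to f on a cube. *)
Lemma Exp_cvg_of_trig d (T : measurableType d) (P : probability T R)
    d' (T' : measurableType d') (P' : probability T' R) m
    (Z W : nat -> T -> 'cV[R]_m) (V : T' -> 'cV[R]_m) :
  (forall n, cont_measurable (Z n)) -> (forall n, cont_measurable (W n)) ->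
  cont_measurable V ->
  (forall t theta, Exp P (fun w => cos (dot t (W n w) + theta)) @[n --> \oo] -->
     Exp P' (fun w => cos (dot t (V w) + theta))) ->
  (forall e : R, 0 < e -> exists K : R, forall eta : R, 0 < eta ->
     \forall n \near \oo, exists E, [/\ measurable E, fine (P E) <= e &
       forall w, ~ E w -> `|W n w| <= K /\ `|Z n w - W n w| <= eta]) ->
  forall f : 'cV[R]_m -> R, continuous f -> (exists C, forall x, `|f x| <= C) ->
    Exp P (f \o Z n) @[n --> \oo] --> Exp P' (f \o V).
Proof.
move=> mZ mW mV cW tZ f cf [C fC].
have C0 : 0 <= C := le_trans (normr_ge0 _) (fC 0).
apply/cvgrPdist_le => /= e0 e0_gt0.
(* The replacement of g(W) by g(V) costs e, each of the three others e + 2C e. *)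
pose e := e0 / (4 + C * 2 * 3).
have e_gt0 : 0 < e by rewrite divr_gt0// ltr_wpDr ?mulr_ge0.
have [K1 K1H] := tZ _ e_gt0.
have [K2 [K2_gt0 mK2 K2H]] := tight_rv P' mV e_gt0.
pose K := Num.max K1 K2.
have K0 : 0 < K by rewrite lt_max K2_gt0 orbT.
have [dl [dl0 _ fdl]] := @unif_continuous_cube R m f K cf K0 e e_gt0.
have [g [tg gC fg]] := trig_poly_approx cf fC K0 e_gt0.
have dl2 : 0 < dl / 2 by rewrite divr_gt0.
have bfn : bounded_rv (f \o V) by apply: bounded_rv_cont => //; exists C.
have bgn : bounded_rv (g \o V) by exact: bounded_rv_trig.
have /cvgrPdist_le/(_ _ e_gt0) h3' := Exp_trig_cvg mW mV cW tg.
near=> n.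
have [E [mE PE EH]] : exists E, [/\ measurable E, fine (P E) <= e &
       forall w, ~ E w -> `|W n w| <= K1 /\ `|Z n w - W n w| <= dl / 2].
  by near: n; exact: K1H.
have bfZ : bounded_rv (f \o Z n) by apply: bounded_rv_cont => //; exists C.
have bfW : bounded_rv (f \o W n) by apply: bounded_rv_cont => //; exists C.
have bgW : bounded_rv (g \o W n) by exact: bounded_rv_trig.
have WK w : ~ E w -> forall i, `|W n w i 0| <= K.
  move=> /EH[WK1 _] i; rewrite (le_trans (normr_coord_le _ _))// (le_trans WK1)//.
  by rewrite le_max lexx.
have h1 : `|Exp P (f \o Z n) - Exp P (f \o W n)| <= e + C *+ 2 * e.
  apply: (@Exp_close _ _ _ P _ _ E) => //=; first exact: ltW.
  move=> w Ew; apply: fdl; first exact: WK.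
  move=> i; have [_ ZW] := EH _ Ew; have := normr_coord_le (Z n w - W n w) i.
  rewrite !mxE => /le_lt_trans; apply; apply: le_lt_trans ZW _.
  by rewrite ltr_pdivrMr// ltr_pMr// ltr1n.
have h2 : `|Exp P (f \o W n) - Exp P (g \o W n)| <= e + C *+ 2 * e.
  apply: (@Exp_close _ _ _ P _ _ E) => //=; first exact: ltW.
  by move=> w Ew; apply: fg; exact: WK.
have h3 : `|Exp P' (g \o V) - Exp P (g \o W n)| <= e.
  by near: n.
have h4 : `|Exp P' (f \o V) - Exp P' (g \o V)| <= e + C *+ 2 * e.
  apply: (@Exp_close _ _ _ P' _ _ [set w | K2 < `|V w|]) => //=; first exact: ltW.
  move=> x /negP; rewrite -leNgt => xK; apply: fg => i.
  rewrite (le_trans (normr_coord_le _ _))// (le_trans xK)//.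
  by rewrite le_max lexx orbT.
have -> : e0 = e + 3 * (e + C *+ 2 * e).
  rewrite /e -mulr_natr; field.
  by rewrite gt_eqF// ltr_wpDr ?mulr_ge0.
move: h1 h2 h3 h4; rewrite !ler_norml; set a1 := Exp _ _; set a2 := Exp _ _.
set a3 := Exp _ _; set a4 := Exp _ _; set a5 := Exp _ _; lra.
Unshelve. all: by end_near. Qed.

Lemma cvg_in_law_of_trig d (T : measurableType d) (P : probability T R) m
    (Z W : nat -> T -> 'cV[R]_m) (nu : probability (borel_cV R m) R) :
  (forall n, cont_measurable (Z n)) -> (forall n, cont_measurable (W n)) ->
  (forall t theta, Exp P (fun w => cos (dot t (W n w) + theta)) @[n --> \oo] -->
     Exp nu (fun x => cos (dot t (x : 'cV[R]_m) + theta))) ->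
  (forall e : R, 0 < e -> exists K : R, forall eta : R, 0 < eta ->
     \forall n \near \oo, exists E, [/\ measurable E, fine (P E) <= e &
       forall w, ~ E w -> `|W n w| <= K /\ `|Z n w - W n w| <= eta]) ->
  cvg_in_law P Z nu.
Proof.
move=> mZ mW cW tZ f cf bf.
rewrite (Exp_EFin nu (bounded_rv_cont (@cont_measurable_borel m) cf bf)).
under eq_cvg do rewrite (Exp_EFin P (bounded_rv_cont (mZ _) cf bf)).
apply: cvg_EFin; first exact: nearW.
exact: (Exp_cvg_of_trig mZ mW (@cont_measurable_borel m) cW tZ cf bf).
Qed.

End WeakConvergence.

(** * Gaussian vectors *)

Section NormalCharacteristicFunction.
Context {R : realType}.
Notation mu := lebesgue_measure.
Variable s : R.
Hypothesis s0 : s != 0.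
Let phi := normal_pdf 0 s.

Let phiE x : phi x = normal_peak s * expR (- x ^+ 2 / (s ^+ 2 *+ 2)).
Proof. by rewrite /phi normal_pdfE// /normal_fun subr0. Qed.

Let phi0 x : 0 <= phi x. Proof. exact: normal_pdf_ge0. Qed.
Let mphi : measurable_fun setT phi. Proof. exact: measurable_normal_pdf. Qed.

Let s2 : 0 < s ^+ 2. Proof. by rewrite exprn_even_gt0. Qed.

(** The density agrees almost everywhere with the Radon-Nikodym derivative, since both integrate to
    the same measure. *)
Lemma integral_normal_prob (f : R -> R) : bounded_rv (f : measurableTypeR R -> R) ->
  Exp (normal_prob 0 s) f = \int[mu]_x (f x * phi x).
Proof.
move=> bf; rewrite /Exp /Rintegral; congr fine.
have intf := bounded_rv_integrable (normal_prob 0 s) bf.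
have dom := normal_prob_dominates 0 s.
rewrite -(Radon_Nikodym_change_of_variables dom)//=.
under [RHS]eq_integral do rewrite EFinM.
apply: ae_eq_integral => //.
- apply: emeasurable_funM; first exact: (measurable_int _ intf).
  apply: (measurable_int mu).
  by apply: Radon_Nikodym_integrable; exact: dom.
- apply: emeasurable_funM; first exact: (measurable_int _ intf).
  by apply/measurable_EFinP; exact: measurable_normal_pdf.
- apply: ae_eqe_mul2l => /=.
  rewrite Radon_NikodymE//=.
  case: cid => /= h [h1 h2 h3].
  apply: integral_ae_eq => //=.
  + by apply/measurable_EFinP; exact: measurable_normal_pdf.
  + by move=> E _ mE; rewrite -h3.
Qed.

Lemma is_derive_normal_pdf (x : R) : is_derive x 1 phi (- (x / s ^+ 2) * phi x).
Proof.
rewrite /phi normal_pdfE//.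
apply: is_derive_eq.
by rewrite /GRing.scale/= /normal_fun; field.
Qed.

Lemma normal_abs_integrable : mu.-integrable setT (fun x : R => (`|x| * phi x)%:E).
Proof.
have s20 : s * 2 != 0 by rewrite mulf_neq0.
(* The dominating function is a multiple of the density with parameter 2s: with y = |x| / |s| the
   quotient of the exponentials is exp (- 3 y^2 / 8), and y exp (- 3 y^2 / 8) <= 2. *)
pose c := 2 * `|s| * normal_peak s / normal_peak (s * 2).
have := integrableZl measurableT c (integrable_normal_pdf 0 (s * 2)).
apply: le_integrable => //.
  apply/measurable_EFinP; apply: measurable_funM; last exact: measurable_normal_pdf.
  exact: normr_measurable.
move=> x _; rewrite -EFinM !abse_EFin lee_fin (ger0_norm (mulr_ge0 (normr_ge0 _) (phi0 x))) ger0_norm; last first.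
  by rewrite !mulr_ge0 ?normal_pdf_ge0 ?normal_peak_ge0 ?invr_ge0 ?normal_peak_ge0.
rewrite phiE normal_pdfE// /normal_fun subr0 /c.
have p2 : normal_peak (s * 2) != 0 by rewrite gt_eqF ?normal_peak_gt0.
rewrite (_ : _ * (_ * expR (- x ^+ 2 / ((s * 2) ^+ 2 *+ 2))) =
  normal_peak s * (2 * `|s| * expR (- x ^+ 2 / ((s * 2) ^+ 2 *+ 2)))); last by field.
rewrite mulrCA ler_wpM2l ?normal_peak_ge0//.
pose y := `|x| / `|s|.
have as0 : 0 < `|s| by rewrite normr_gt0.
have y0 : 0 <= y by rewrite divr_ge0.
have xE : `|x| = y * `|s| by rewrite /y divfK// gt_eqF.
have x2 : x ^+ 2 = y ^+ 2 * s ^+ 2 by rewrite -[x ^+ 2]real_normK ?num_real// xE exprMn real_normK ?num_real.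
have eE : - x ^+ 2 / (s ^+ 2 *+ 2) = - x ^+ 2 / ((s * 2) ^+ 2 *+ 2) - y ^+ 2 * (3 / 8).
  by rewrite x2; field.
have ye : y * expR (- (y ^+ 2 * (3 / 8))) <= 2.
  rewrite expRN ler_pdivrMr ?expR_gt0//.
  have := expR_ge1Dx (y ^+ 2 * (3 / 8)).
  have : 0 <= (y - 1) ^+ 2 by exact: sqr_ge0.
  nra.
rewrite eE expRD xE; set E1 := expR (- x ^+ 2 / _).
rewrite (_ : _ * (_ * _) = y * expR (- (y ^+ 2 * (3 / 8))) * (`|s| * E1)); last by ring.
by rewrite -[leRHS]mulrA ler_wpM2r// mulr_ge0// expR_ge0.
Qed.


Lemma measurable_sin_affine (t th : R) : measurable_fun setT (fun x : R => sin (t * x + th)).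
Proof.
apply: continuous_measurable_fun => x; apply: continuous_comp; last exact: continuous_sin.
by apply: cvgD; [apply: cvgM; [exact: cvg_cst|exact: cvg_id]|exact: cvg_cst].
Qed.

Lemma measurable_cos_affine (t th : R) : measurable_fun setT (fun x : R => cos (t * x + th)).
Proof.
apply: continuous_measurable_fun => x; apply: continuous_comp; last exact: continuous_cos.
by apply: cvgD; [apply: cvgM; [exact: cvg_cst|exact: cvg_id]|exact: cvg_cst].
Qed.

Let g t th x := cos (t * x + th) * phi x.
Let h t th x := x * sin (t * x + th) * phi x.

Lemma integrable_g t th : mu.-integrable setT (EFin \o g t th).
Proof.
apply: le_integrable (integrable_normal_pdf 0 s) => //.
  by apply/measurable_EFinP; apply: measurable_funM => //; exact: measurable_cos_affine.
move=> x _; rewrite /= lee_fin normrM (ger0_norm (phi0 x)).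
by rewrite -[leRHS]mul1r ler_wpM2r// cos_max.
Qed.

Lemma integrable_h t th : mu.-integrable setT (EFin \o h t th).
Proof.
apply: le_integrable normal_abs_integrable => //.
  apply/measurable_EFinP; apply: measurable_funM => //; apply: measurable_funM => //.
  exact: measurable_sin_affine.
move=> x _; rewrite /= lee_fin !normrM (ger0_norm (phi0 x)) normr_id.
by rewrite ler_wpM2r// ler_piMr// sin_max.
Qed.

(* d/dx (sin (t x + th) phi x) = t g - h / s^2 *)
Lemma normal_by_parts t th : \int[mu]_x h t th x = s ^+ 2 * t * \int[mu]_x g t th x.
Proof.
pose H x := sin (t * x + th) * phi x.
pose H' x := t * g t th x - (s ^+ 2)^-1 * h t th x.
have dH (x : R) : is_derive x 1 H (H' x).
  have := is_derive_normal_pdf x => dphi; apply: is_derive_eq.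
  by rewrite /GRing.scale/= /H' /g /h; field.
have iH' : mu.-integrable setT (EFin \o H').
  have := integrableB measurableT (integrableZl measurableT t (integrable_g t th))
    (integrableZl measurableT (s ^+ 2)^-1 (integrable_h t th)).
  by [].
have cphi : continuous phi by exact: continuous_normal_pdf.
have caff (u v x : R) : (fun y : R => u * y + v) @ x --> u * x + v.
  by apply: cvgD; [apply: cvgM; [exact: cvg_cst|exact: cvg_id]|exact: cvg_cst].
have cH' : continuous H'.
  move=> x; apply: cvgB; apply: cvgM; (try exact: cvg_cst).
    apply: cvgM; last exact: cphi.
    by apply: (cvg_comp _ _ (caff t th x)); exact: continuous_cos.
  apply: cvgM; last exact: cphi.
  apply: cvgM; first exact: cvg_id.
  by apply: (cvg_comp _ _ (caff t th x)); exact: continuous_sin.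
have cH : continuous H.
  move=> x; apply: cvgM; last exact: cphi.
  by apply: (cvg_comp _ _ (caff t th x)); exact: continuous_sin.
pose k (n : nat) : R := n.+1%:R.
have H'n (n : nat) : (\int[mu]_(x in `[(- k n)%R, k n]) (H' x)%:E)%E =
    (H (k n) - H (- k n))%:E.
  rewrite EFinB; apply: continuous_FTC2.
  - by rewrite gtrN.
  - exact: continuous_subspaceT.
  - split; [by move=> x _; exact: ex_derive|exact/cvg_at_right_filter/cH|exact/cvg_at_left_filter/cH].
  - by move=> x _; rewrite derive1E derive_val.
have phin (x : R) (n : nat) : x ^+ 2 = n.+1%:R ^+ 2 -> `|H x| <= normal_peak s * (s ^+ 2 *+ 2) * n.+1%:R^-1.
  move=> xn; rewrite /H normrM (ger0_norm (phi0 x)).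
  apply: (@le_trans _ _ (phi x)); first by rewrite -[leRHS]mul1r ler_wpM2r// sin_max.
  rewrite phiE -mulrA ler_wpM2l ?normal_peak_ge0// mulNr expRN xn.
  rewrite -div1r ler_pdivrMr ?expR_gt0// mulrAC ler_pdivlMr ?ltr0n// mul1r.
  have := expR_ge1Dx (n.+1%:R ^+ 2 / (s ^+ 2 *+ 2)).
  have s22 : 0 < s ^+ 2 *+ 2 by rewrite pmulrn_lgt0.
  rewrite -(ler_pM2l s22); apply: le_trans.
  rewrite mulrDr mulrCA divff ?gt_eqF// !mulr1.
  apply: (@le_trans _ _ (n.+1%:R ^+ 2)); last by rewrite lerDr ltW.
  by rewrite expr2 ler_peMr// ler1n.
(* The integral of a derivative over [-k, k] is a difference of boundary values, of order 1 / k by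
   [phin]; dominated convergence passes to the whole line. *)
have H'0 : \int[mu]_x H' x = 0.
  pose F (n : nat) x := ((H' \_ `[- k n, k n]) x)%:E.
  have mH' : measurable_fun setT H' by exact: continuous_measurable_fun.
  have [] := @dominated_convergence _ _ _ mu setT measurableT F (EFin \o H') (fun x => `|(H' x)%:E|%E).
  - move=> n; apply/measurable_EFinP; apply/(measurable_restrictT _ _).1 => //.
    exact: measurable_funTS.
  - exact/measurable_EFinP.
  - apply: aeW => x _; apply: cvg_EFin; first exact: nearW.
    apply: cvg_near_cst; near=> n; rewrite /F/= patchE mem_set//= in_itv/= -ler_norml.
    by rewrite (le_trans (ltW (truncnS_gt _)))// ler_nat ltnS; near: n; exact: nbhs_infty_ge.
  - exact: integrable_abse.
  - apply: aeW => x n _; rewrite /F lee_fin patchE; case: ifP => // _.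
    by rewrite normr0.
  move=> _ _ FH.
  have F0 : (\int[mu]_x F n x)%E @[n --> \oo] --> 0%:E.
    rewrite (_ : (fun n => _) = (fun n : nat => (H (k n) - H (- k n))%:E)); last first.
      by apply/funext => n; rewrite -H'n /F [RHS]integral_mkcond; apply: eq_integral => x _; rewrite restrict_EFin.
    apply: cvg_EFin; first exact: nearW.
    have c0 : normal_peak s * (s ^+ 2 *+ 2) * 2 * n.+1%:R^-1 @[n --> \oo] --> (0 : R).
      rewrite -(mulr0 (normal_peak s * (s ^+ 2 *+ 2) * 2)).
      by apply: cvgM; [exact: cvg_cst|exact: cvg_harmonic].
    apply: norm_cvg0; apply: (@squeeze_cvgr _ _ _ _ (cst 0) _ _ _ _ _ c0); last exact: cvg_cst.
    apply: nearW => n; rewrite normr_ge0/=.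
    have h1 := phin n.+1%:R n erefl; have h2 := phin (- n.+1%:R) n (sqrrN _).
    apply: le_trans (ler_normB _ _) _; apply: le_trans (lerD h1 h2) _.
    by rewrite -subr_ge0 [X in 0 <= X](_ : _ = 0)//; ring.
  by rewrite /Rintegral; have := cvg_unique _ FH F0; rewrite /comp => ->.
have i1 := integrableZl measurableT t (integrable_g t th).
have i2 := integrableZl measurableT (s ^+ 2)^-1 (integrable_h t th).
move: H'0; rewrite (RintegralB measurableT i1 i2).
rewrite (RintegralZl _ measurableT (integrable_g t th)) (RintegralZl _ measurableT (integrable_h t th)).
move=> /eqP; rewrite subr_eq0 => /eqP e.
by rewrite mulrAC -mulrA [_ * t]mulrC e mulrA divff ?mul1r// gt_eqF.
Unshelve. all: by end_near. Qed.

(** As a function of u, the expectation G(u) of cos (u x + th) solves G' = - s^2 u G, by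
    differentiation under the integral and integration by parts; hence G(u) exp (s^2 u^2 / 2) is
    constant. *)
Lemma Exp_normal_cos t th :
  Exp (normal_prob 0 s) (fun x => cos (t * x + th)) = cos th * expR (- (s ^+ 2 * t ^+ 2) / 2).
Proof.
have bc u : bounded_rv (fun x : measurableTypeR R => cos (u * x + th)).
  by split; [exact: measurable_cos_affine|exists 1 => x; exact: cos_max].
rewrite (integral_normal_prob (bc t)).
pose G u := \int[mu]_x g u th x.
have dG (u : R) : is_derive u 1 G (- (s ^+ 2 * u) * G u).
  have I : `]u - 1, u + 1[%classic u by rewrite /= in_itv/=; lra.
  have dg (v x : R) : is_derive v 1 (g ^~ th ^~ x) (- h v th x).
    apply: is_derive_eq; rewrite /GRing.scale/= /h; ring.
  have dge : partial1of2 (g ^~ th) u = (fun x => - h u th x).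
    by apply/funext => x; rewrite partial1of2E; exact: derive_val.
  have Gb v x : `]u - 1, u + 1[%classic v -> setT x -> `|partial1of2 (g ^~ th) v x| <= `|x| * phi x.
    move=> _ _; rewrite partial1of2E derive_val /h normrN !normrM (ger0_norm (phi0 x)).
    by rewrite ler_wpM2r// ler_piMr// sin_max.
  have der v x : `]u - 1, u + 1[%classic v -> setT x -> derivable (g ^~ th ^~ x) v 1.
    by move=> _ _; exact: ex_derive.
  have a0 x : 0 <= `|x| * phi x by rewrite mulr_ge0.
  have ig v : `]u - 1, u + 1[%classic v -> mu.-integrable setT (EFin \o g v th).
    by move=> _; exact: integrable_g.
  apply: DeriveDef.
    exact: (derivable_under_integral measurableT I ig der a0 normal_abs_integrable Gb).
  rewrite -derive1E (differentiation_under_integral measurableT I ig der a0 normal_abs_integrable Gb).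
  rewrite (_ : (fun y => _) = (fun x => - h u th x))//.
  rewrite mulNr -normal_by_parts.
  rewrite -mulN1r -RintegralZl//; last exact: integrable_h.
  by apply: eq_Rintegral => x _; rewrite mulN1r.
have : G t * expR (s ^+ 2 * t ^+ 2 / 2) = G 0 * expR (s ^+ 2 * 0 ^+ 2 / 2).
  apply: (is_derive_0_is_cst (f := fun u => G u * expR (s ^+ 2 * u ^+ 2 / 2))) => u.
  by have := dG u => dGu; apply: is_derive_eq; rewrite /GRing.scale/=; field.
rewrite expr0n mulr0 mul0r expR0 mulr1 => GE.
rewrite -/(G t) mulNr expRN -[LHS](mulfK (lt0r_neq0 (expR_gt0 (s ^+ 2 * t ^+ 2 / 2)))) GE.
congr (_ / _); rewrite /G/g.
transitivity (\int[mu]_x (cos th * phi x)).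
  by apply: eq_Rintegral => x _; rewrite mul0r add0r.
rewrite RintegralZl//; last exact: integrable_normal_pdf.
by rewrite /Rintegral integral_normal_pdf/= mulr1.
Qed.

End NormalCharacteristicFunction.

Definition mfun_of d d' (T : measurableType d) (T' : measurableType d') (f : T -> T')
  (mf : measurable_fun setT f) : {mfun T >-> T'} := mfun_Sub (mem_set mf).

(** * Measurability of vectors, uniqueness of one-dimensional laws, existence of Gaussian vectors *)

Section VectorMeasurability.
Context {d : measure_display} {T : measurableType d} {R : realType}.
Variables (m : nat) (W : T -> 'cV[R]_m).
Hypothesis mW : forall i, measurable_fun setT (fun w => W w i 0).

Lemma measurable_coord_open (U : set 'cV[R]_m) : open U -> measurable (W @^-1` U).
Proof.
move=> oU.
(* Open sets are countable unions of boxes with rational centre and radius 1 / (k + 1); [unpickle]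
   enumerates the pairs of a centre and a k. *)
pose box (q : 'cV[rat]_m * nat) (x : 'cV[R]_m) :=
  forall i, `|x i 0 - ratr (q.1 i 0)| < q.2.+1%:R^-1.
pose F (n : nat) : set T := if unpickle n is Some q
  then [set w | box q (W w) /\ box q `<=` U] else set0.
rewrite (_ : W @^-1` U = \bigcup_n F n).
  apply: bigcupT_measurable => n; rewrite /F; case: unpickle => [q|]; last exact: measurable0.
  have [qU|qU] := pselect (box q `<=` U); last first.
    by rewrite (_ : [set _ | _] = set0)// -subset0 => w [].
  rewrite (_ : [set _ | _] = \bigcap_(i in [set: 'I_m]) [set w | `|W w i 0 - ratr (q.1 i 0)| < q.2.+1%:R^-1]); last first.
    apply/seteqP; split => w /=; first by move=> [bq _] i _; exact: bq.
    by move=> bq; split => // i; exact: bq.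
  apply: fin_bigcap_measurable => [|i _]; first exact: finite_finset.
  have mi : measurable_fun setT (fun w => `|W w i 0 - ratr (q.1 i 0)|).
    by apply: measurableT_comp => //; apply: measurable_funB.
  rewrite (_ : [set w | _] = (fun w => `|W w i 0 - ratr (q.1 i 0)|) @^-1` `]-oo, q.2.+1%:R^-1[).
    by rewrite -[X in measurable X]setTI; exact: mi.
  by apply/seteqP; split => w /=; rewrite in_itv.
apply/seteqP; split => [w Uw|w [n _]]; last by rewrite /F; case: unpickle => // q [bq]; exact.
have /nbhs_ballP[e /= e0 eU] : nbhs (W w) U by apply: open_nbhs_nbhs.
have e2 : 0 < e / 2 by rewrite divr_gt0.
pose k := Num.truncn (e / 2)^-1.
have ke : k.+1%:R^-1 < e / 2.
  by rewrite -[ltRHS]invrK ltf_pV2 ?posrE ?invr_gt0 ?ltr0n// truncnS_gt.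
have k0 : 0 < k.+1%:R^-1 :> R by rewrite invr_gt0 ltr0n.
have /choice[q Hq] : forall i, exists q : rat, `|W w i 0 - ratr q| < k.+1%:R^-1.
  move=> i; have lt : W w i 0 - k.+1%:R^-1 < W w i 0 + k.+1%:R^-1 by rewrite ltrD2l gtrN.
  have [q qi] := rat_in_itvoo lt; exists q; rewrite distrC.
  by move: qi; rewrite in_itv/= ltr_distl.
exists (pickle ((\col_i q i : 'cV[rat]_m), k)) => //; rewrite /F pickleK; split.
  by move=> i /=; rewrite mxE; exact: Hq.
move=> y By; apply: eU; split => // i j; rewrite ord1 /ball/=.
have := By i; have := Hq i; rewrite /= mxE => h1 h2.
rewrite (_ : _ - _ = (W w i 0 - ratr (q i)) - (y i 0 - ratr (q i))); last by ring.
by rewrite (le_lt_trans (ler_normB _ _))// [e]splitr ltrD// (lt_trans _ ke).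
Qed.

Lemma measurable_borel_cV : measurable_fun setT (W : T -> borel_cV R m).
Proof.
apply: (@measurability _ _ _ (borel_cV R m) _ _ open) => //.
by move=> _ [U oU <-]; rewrite setTI; exact: measurable_coord_open.
Qed.

Lemma cont_measurable_coord : cont_measurable W.
Proof.
move=> f cf; have := @cont_measurable_borel R m f cf.
by move=> mf; apply: (measurableT_comp mf); exact: measurable_borel_cV.
Qed.

End VectorMeasurability.

Lemma Exp_cvg_bounded d (T : measurableType d) (R : realType) (P : probability T R)
    (f_ : nat -> T -> R) (f : T -> R) (C : R) :
  (forall n, measurable_fun setT (f_ n)) -> measurable_fun setT f ->
  (forall n x, `|f_ n x| <= C) -> (forall x, f_ n x @[n --> \oo] --> f x) ->
  Exp P (f_ n) @[n --> \oo] --> Exp P f.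
Proof.
move=> mf_ mf fC cf.
have bf_ n : bounded_rv (f_ n) by split => //; exists C.
have bf : bounded_rv f.
  split => //; exists C => x.
  have h : `|f_ n x| @[n --> \oo] --> `|f x| by apply: cvg_norm; exact: cf.
  rewrite -(cvg_lim (@norm_hausdorff _ _) h); apply: limr_le; last exact: nearW.
  by apply/cvg_ex; eexists; exact: h.
have [] := @dominated_convergence _ _ _ P setT measurableT (fun n => EFin \o f_ n) (EFin \o f)
  (cst C%:E).
- by move=> n; exact/measurable_EFinP.
- exact/measurable_EFinP.
- by apply: aeW => x _; apply: cvg_EFin; [exact: nearW|exact: cf].
- exact: (bounded_rv_integrable P (bounded_rv_cst C)).
- by apply: aeW => x n _; rewrite /= lee_fin.
move=> _ _; rewrite /= (Exp_EFin P bf).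
under eq_cvg do rewrite (Exp_EFin P (bf_ _)).
exact: fine_cvg.
Qed.

Section CharacteristicUniqueness.
Context {d : measure_display} {T : measurableType d} {R : realType}.
Variables (P : probability T R) (X : T -> R) (nu : probability (measurableTypeR R) R).
Hypothesis mX : measurable_fun setT X.
Hypothesis charX : forall t th, Exp P (fun w => cos (t * X w + th)) =
  Exp nu (fun x => cos (t * x + th)).

Let cm_const d' (T' : measurableType d') (Y : T' -> R) : measurable_fun setT Y ->
  cont_measurable (fun w => const_mx (Y w) : 'cV[R]_1).
Proof. by move=> mY; apply: cont_measurable_coord => i; under eq_fun do rewrite mxE. Qed.

(** The convergence criterion in dimension 1, applied to a constant sequence, gives uniqueness. *)
Lemma Exp_eq_of_char (f : R -> R) : continuous f -> (exists C, forall x, `|f x| <= C) ->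
  Exp P (f \o X) = Exp nu f.
Proof.
move=> cf [C fC].
pose W (n : nat) w : 'cV[R]_1 := const_mx (X w).
pose V (x : measurableTypeR R) : 'cV[R]_1 := const_mx x.
have mW n : cont_measurable (W n) by exact: cm_const.
have mV : cont_measurable V by apply: cm_const; exact: measurable_id.
pose g (x : 'cV[R]_1) := f (x 0 0).
have cg : continuous g.
  by move=> x; apply: continuous_comp; [exact: coord_continuous|exact: cf].
have dotV (t : 'cV[R]_1) (a : R) : dot t (const_mx a : 'cV[R]_1) = t 0 0 * a.
  by rewrite dotE big_ord1 mxE.
have h := @Exp_cvg_of_trig R _ _ P _ _ nu 1 W W V mW mW mV _ _ g cg _.
have : Exp P (g \o W n) @[n --> \oo] --> Exp nu (g \o V).
  apply: h.
  - move=> t th.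
    rewrite (_ : (fun x => cos (dot t (V x) + th)) = (fun x => cos (t 0 0 * x + th))).
      rewrite -charX; apply: cvg_near_cst; apply: nearW => n; congr Exp.
      by apply/funext => w; rewrite dotV.
    by apply/funext => x; rewrite dotV.
  - move=> e e0; have [K [K0 mK PK]] := tight_rv P (mW 0%N) e0.
    exists K => eta eta0; apply: nearW => n; exists [set w | K < `|W n w|]; split => //.
    by move=> w /negP; rewrite -leNgt => wK; split; rewrite // subrr normr0 ltW.
  - by exists C => x; exact: fC.
rewrite (_ : g \o V = f); last by apply/funext => x; rewrite /g/V/= mxE.
rewrite (_ : (fun n => _) = cst (Exp P (f \o X))); last first.
  by apply/funext => n; congr Exp; apply/funext => w; rewrite /g/W/= mxE.
by move=> hh; have := cvg_unique _ hh (cvg_cst _) => ->.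
Qed.

(** Truncation of n (a - x) to [0, 1], written with absolute values so that continuity is immediate;
    it tends to the indicator of x < a. *)
Let ramp (a : R) (n : nat) (x : R) : R := (`|n%:R * (a - x)| - `|n%:R * (a - x) - 1| + 1) / 2.

Lemma law_eq_of_char (U : set (measurableTypeR R)) : measurable U -> P (X @^-1` U) = nu U.
Proof.
move=> mU.
have contramp a n : continuous (ramp a n).
  move=> x; have h : n%:R * (a - y) @[y --> x] --> n%:R * (a - x).
    by apply: cvgM; [exact: cvg_cst|apply: cvgB; [exact: cvg_cst|exact: cvg_id]].
  apply: cvgM; last exact: cvg_cst.
  apply: cvgD; last exact: cvg_cst.
  by apply: cvgB; apply: cvg_norm => //; apply: cvgB => //; exact: cvg_cst.
have rampb a n x : `|ramp a n x| <= 1.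
  rewrite /ramp ler_norml; set y := n%:R * (a - x).
  by have [] := ger0P y; have [] := ger0P (y - 1); move=> *; apply/andP; split; lra.
have rampcvg a x : ramp a n x @[n --> \oo] --> (\1_`]-oo, a[ x : R).
  rewrite indicE; have [xa|ax] := ltP x a; last first.
    rewrite memNset/=; last by rewrite in_itv/= ltNge ax.
    apply: cvg_near_cst; apply: nearW => n; rewrite /ramp.
    have y0 : n%:R * (a - x) <= 0 by rewrite mulr_ge0_le0// subr_le0.
    by rewrite ler0_norm// ler0_norm; lra.
  rewrite mem_set/=; last by rewrite in_itv/= xa.
  have ax0 : 0 < a - x by rewrite subr_gt0.
  apply: cvg_near_cst; near=> n; rewrite /ramp.
  have y1 : 1 <= n%:R * (a - x).
    rewrite -ler_pdivrMr// (le_trans (ltW (truncnS_gt _)))// ler_nat.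
    by near: n; exact: nbhs_infty_ge.
  by rewrite ger0_norm ?ger0_norm; lra.
pose X' := @mfun_of _ _ T (measurableTypeR R) X mX.
apply: (@measure_unique _ R (measurableTypeR R) (@RGenInftyO.G R) (fun n => `]-oo, n%:R[%classic)
  _ _ _ _ (distribution P X') nu) => //.
- exact: RGenInftyO.measurableE.
- move=> _ _ [a ->] [b ->]; exists (Num.min a b); apply/seteqP; split => x /=; rewrite !in_itv/= lt_min.
    by case=> -> ->.
  by move=> /andP.
- by move=> n; exists n%:R.
- rewrite -subTset => x _; exists (Num.truncn x).+1 => //=.
  by rewrite in_itv/= truncnS_gt.
- move=> _ [a ->]; rewrite /distribution /pushforward/=.
  have ma : measurable (`]-oo, a[%classic : set (measurableTypeR R)) by [].
  have mXa : measurable (X @^-1` `]-oo, a[) by rewrite -[X in measurable X]setTI; exact: mX.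
  rewrite -[LHS]fineK ?fin_num_measure// -[RHS]fineK ?fin_num_measure//; congr EFin.
  transitivity (fine (P (X @^-1` `]-oo, a[))) => //.
  rewrite -(Exp_indic P mXa) -(Exp_indic nu ma).
  have c1 : Exp P (ramp a n \o X) @[n --> \oo] --> Exp P (\1_(X @^-1` `]-oo, a[)).
    apply: (@Exp_cvg_bounded _ _ _ P _ _ 1) => //.
    - move=> n; apply: (measurableT_comp _ mX); exact: continuous_measurable_fun.
    - by move=> n x; exact: rampb.
    - by move=> x; exact: rampcvg.
  have c2 : Exp nu (ramp a n) @[n --> \oo] --> Exp nu (\1_(`]-oo, a[)).
    apply: (@Exp_cvg_bounded _ _ _ nu _ _ 1) => //.
    by move=> n; exact: continuous_measurable_fun.
  have e12 : (fun n => Exp P (ramp a n \o X)) = (fun n => Exp nu (ramp a n)).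
    by apply/funext => n; apply: Exp_eq_of_char => //; exists 1.
  by move: c1; rewrite e12 => c1; exact: (cvg_unique _ c1 c2).
- by move=> k; rewrite (le_lt_trans (probability_le1 _ _))// ltry.
Unshelve. all: by end_near. Qed.

End CharacteristicUniqueness.

Section StandardGaussian.
Context {R : realType}.

Definition gaussian_char d (T : measurableType d) (P : probability T R) (X : T -> R) (v : R) :=
  forall t th, Exp P (fun w => cos (t * X w + th)) = cos th * expR (- (v * t ^+ 2) / 2).

Lemma normal_law0_char d (T : measurableType d) (P : probability T R) (X : T -> R) (v : R)
    (U : set (measurableTypeR R)) : 0 <= v ->
  measurable_fun setT X -> gaussian_char P X v -> measurable U ->
  P (X @^-1` U) = normal_law0 v U.
Proof.
move=> v0 mX cX mU; rewrite /normal_law0; case: eqP => [v0'|/eqP v0'].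
  pose D := dirac (0 : measurableTypeR R) : probability (measurableTypeR R) R.
  suff h : forall t th, Exp P (fun w => cos (t * X w + th)) = Exp D (fun x => cos (t * x + th)).
    exact: (law_eq_of_char mX h mU).
  move=> t th.
  rewrite cX v0' mul0r oppr0 mul0r expR0 mulr1.
  rewrite /Exp /Rintegral integral_dirac//; last first.
    by apply/measurable_EFinP; exact: measurable_cos_affine.
  by rewrite diracT mul1e/= mulr0 add0r.
have sv0 : Num.sqrt v != 0 by rewrite gt_eqF// sqrtr_gt0 lt_neqAle eq_sym v0' v0.
apply: (@law_eq_of_char _ _ _ P X (normal_prob 0 (Num.sqrt v) : probability (measurableTypeR R) R)) => // t th.
by rewrite cX Exp_normal_cos// sqr_sqrtr.
Qed.

(** One normal factor is added to the product space at a time. By Fubini the new variable is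
    integrated first, with t S + th as its phase, and yields one exponential factor. *)
Lemma standard_gaussian_exists m : exists d (T : measurableType d) (P : probability T R)
    (G : 'I_m -> T -> R), (forall i, measurable_fun setT (G i)) /\
  forall (c : 'I_m -> R), gaussian_char P (fun w => \sum_i c i * G i w) (\sum_i c i ^+ 2).
Proof.
elim: m => [|m [d [T [P [G [mG cG]]]]]].
  exists _, (measurableTypeR R), (normal_prob 0 1 : probability (measurableTypeR R) R), (fun _ _ => 0).
  split=> [i|c t th]; first exact: measurable_cst.
  rewrite (_ : (fun x => _) = cst (cos th)); last first.
    by apply/funext => x; rewrite big_ord0 mulr0 add0r.
  by rewrite Exp_cst big_ord0 mul0r oppr0 mul0r expR0 mulr1.
pose N := normal_prob 0 1 : probability (measurableTypeR R) R.
pose G' (i : 'I_m.+1) (x : T * measurableTypeR R) : R :=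
  if unlift ord_max i is Some j then G j x.1 else x.2.
pose PN := (P \x N)%E : probability (T * measurableTypeR R)%type R.
have mG' i : measurable_fun setT (G' i).
  rewrite /G'; case: (unlift ord_max i) => [j|]; last exact: measurable_snd.
  exact: (measurableT_comp (mG j) measurable_fst).
exists _, (T * measurableTypeR R)%type, PN, G'; split => // c t th.
have mf : measurable_fun setT (fun x => cos (t * (\sum_i c i * G' i x) + th)).
  apply: measurableT_comp; first exact: (continuous_measurable_fun (@continuous_cos R)).
  apply: measurable_funD; last exact: measurable_cst.
  apply: measurable_funM; first exact: measurable_cst.
  apply: measurable_sum => i; apply: measurable_funM; first exact: measurable_cst.
  exact: mG'.
have bf : bounded_rv (fun x => cos (t * (\sum_i c i * G' i x) + th)).
  by split => //; exists 1 => x; exact: cos_max.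
pose S w := \sum_(i < m) c (widen_ord (leqnSn m) i) * G i w.
have sE w x : \sum_i c i * G' i (w, x) = S w + c ord_max * x.
  rewrite big_ord_recr/= /G' unlift_none; congr (_ + _); apply: eq_bigr => i _.
  have -> : widen_ord (leqnSn m) i = lift ord_max i by apply: val_inj; rewrite /= /bump leqNgt ltn_ord.
  by rewrite liftK.
have mS : measurable_fun setT S.
  by apply: measurable_sum => i; apply: measurable_funM; first exact: measurable_cst.
have bS : bounded_rv (fun w => cos (t * S w + th)).
  split; last by exists 1 => x; exact: cos_max.
  apply: measurableT_comp; first exact: (continuous_measurable_fun (@continuous_cos R)).
  by apply: measurable_funD => //; apply: measurable_funM.
have := @integral12_prod_meas1 _ _ _ _ R P N (EFin \o _) (bounded_rv_integrable PN bf).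
rewrite (Exp_EFin PN bf).
rewrite (eq_integral (fun w => (expR (- (c ord_max ^+ 2 * t ^+ 2) / 2) * cos (t * S w + th))%:E)); last first.
  move=> w _ /=; rewrite /fubini_F.
  have bw : bounded_rv (fun x : measurableTypeR R => cos (t * c ord_max * x + (t * S w + th))).
    by split; [exact: measurable_cos_affine|exists 1 => x; exact: cos_max].
  transitivity (\int[N]_x (cos (t * c ord_max * x + (t * S w + th)))%:E)%E.
    by apply: eq_integral => x _ /=; rewrite sE; congr (cos _)%:E; ring.
  rewrite (Exp_EFin N bw) Exp_normal_cos ?oner_neq0// mulrC.
  by rewrite expr1n mul1r exprMn [t ^+ 2 * _]mulrC.
rewrite (Exp_EFin P (bounded_rvZ _ bS)) ExpZ// => -[<-].
rewrite (cG (fun i => c (widen_ord (leqnSn m) i))) big_ord_recr/=.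
by rewrite mulrCA -expRD; congr (_ * expR _); ring.
Qed.

(** The law is the image of a standard vector under L. A covariance given as L L^T dispenses with
    the square root of a semidefinite matrix, and singular covariances are covered. *)
Lemma gaussian_law_exists m k (L : 'M[R]_(m, k)) :
  exists2 nu : probability (borel_cV R m) R, gaussian_law (L *m L^T) nu &
    forall t th, Exp nu (fun x => cos (dot t (x : 'cV[R]_m) + th)) =
      cos th * expR (- ((t^T *m (L *m L^T) *m t) 0 0) / 2).
Proof.
have [d [T [P [G [mG cG]]]]] := standard_gaussian_exists k.
pose W w : 'cV[R]_m := L *m (\col_i G i w).
have mW i : measurable_fun setT (fun w => W w i 0).
  under eq_fun do rewrite mxE.
  apply: measurable_sum => j; apply: measurable_funM; first exact: measurable_cst.
  by rewrite (_ : (fun w => _) = G j)//; apply/funext => w; rewrite mxE.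
have mbW : measurable_fun setT (W : T -> borel_cV R m) by exact: measurable_borel_cV.
pose X := mfun_of mbW.
pose c (a : 'cV[R]_m) (i : 'I_k) := (L^T *m a) i 0.
have dotW a w : dot a (W w) = \sum_i c a i * G i w.
  rewrite /dot /W mulmxA mxE; apply: eq_bigr => i _; rewrite [X in _ * X]mxE.
  by rewrite /c -[L in a^T *m L]trmxK -trmx_mul mxE.
have cV a : \sum_i c a i ^+ 2 = (a^T *m (L *m L^T) *m a) 0 0.
  rewrite mulmxA -mulmxA -[L in a^T *m L]trmxK -trmx_mul mxE.
  by apply: eq_bigr => i _; rewrite mxE expr2.
have mdot a : measurable_fun setT (fun w => dot a (W w)).
  by apply: (cont_measurable_coord mW); exact: continuous_dot.
have charW a : gaussian_char P (fun w => dot a (W w)) ((a^T *m (L *m L^T) *m a) 0 0).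
  by under eq_fun do rewrite dotW; rewrite -cV; exact: cG.
exists (distribution P X).
  move=> a U mU; rewrite -(normal_law0_char _ (mdot a) (charW a) mU)//.
  by rewrite -cV sumr_ge0// => i _; exact: sqr_ge0.
move=> t th; have := charW t 1 th; rewrite expr1n mulr1 => <-.
have bf : bounded_rv (fun x : borel_cV R m => cos (dot t (x : 'cV[R]_m) + th)).
  exact: (bounded_rv_trig (@cont_measurable_borel R m) (trig_cos t th)).
rewrite /Exp /Rintegral integral_distribution.
- by congr fine; apply: eq_integral => w _; rewrite /= mul1r.
- by apply/measurable_EFinP; case: bf.
- apply: (bounded_rv_integrable P (f := fun w => cos (dot t (W w) + th))).
  exact: (bounded_rv_trig (cont_measurable_coord mW) (trig_cos t th)).
Qed.

End StandardGaussian.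

(** * Markov chains observed at random times *)

Section FiniteValuedVariables.
Context {d : measure_display} {Omega : measurableType d} {R : realType}.
Variable Pr : probability Omega R.

Definition prb (A : set Omega) : R := fine (Pr A).

Lemma prbE A : measurable A -> Pr A = (prb A)%:E.
Proof. by move=> mA; rewrite /prb fineK// fin_num_measure. Qed.

Lemma prb0 : prb set0 = 0. Proof. by rewrite /prb measure0. Qed.

Lemma prb_le A B : measurable A -> measurable B -> A `<=` B -> prb A <= prb B.
Proof.
move=> mA mB AB; apply: fine_le; rewrite ?fin_num_measure//.
by apply: le_measure => //; rewrite inE.
Qed.

(** Preimages of arbitrary sets under such a variable are measurable, so that it may be composed
    with any map, for instance one defined as the limit of a power series. *)
Definition finval (F : finType) (c : Omega -> F) := forall t, measurable (c @^-1` [set t]).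

Lemma finval_pair (F F' : finType) (c : Omega -> F) (c' : Omega -> F') :
  finval c -> finval c' -> finval (fun w => (c w, c' w)).
Proof.
move=> mc mc' [t t']; rewrite (_ : _ @^-1` _ = c @^-1` [set t] `&` c' @^-1` [set t']).
  exact: measurableI.
by apply/seteqP; split => [w [<- <-]|w [/= <- <-]].
Qed.

Lemma finval_set (F : finType) (c : Omega -> F) (S : set F) : finval c -> measurable (c @^-1` S).
Proof.
move=> mc; rewrite (_ : _ @^-1` _ = \bigcup_(s in S) c @^-1` [set s]).
  by apply: fin_bigcup_measurable => [|s _]; [exact: finite_finset|exact: mc].
by apply/seteqP; split => [w Sw|w [s /= Ss ->]//]; exists (c w).
Qed.

Lemma finval_measurable (F : finType) (c : Omega -> F) d' (T' : measurableType d') (g : F -> T') :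
  finval c -> measurable_fun setT (g \o c).
Proof. by move=> mc _ B mB; rewrite setTI comp_preimage; exact: finval_set. Qed.

Lemma finval_bounded (F : finType) (c : Omega -> F) (g : F -> R) :
  finval c -> bounded_rv (g \o c).
Proof.
move=> mc; split; first exact: finval_measurable.
by exists (\sum_t `|g t|) => w; rewrite /= (bigD1 (c w))//= lerDl sumr_ge0.
Qed.

Lemma finval_cont_measurable (F : finType) (c : Omega -> F) m (g : F -> 'cV[R]_m) :
  finval c -> cont_measurable (g \o c).
Proof. by move=> mc f _; exact: (finval_measurable (f \o g)). Qed.

Lemma Exp_finval (F : finType) (c : Omega -> F) (g : F -> R) : finval c ->
  Exp Pr (g \o c) = \sum_t g t * prb (c @^-1` [set t]).
Proof.
move=> mc; rewrite (_ : g \o c = fun w => \sum_t g t * \1_(c @^-1` [set t]) w).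
  have bi t : bounded_rv (\1_(c @^-1` [set t]) : Omega -> R) by exact: bounded_rv_indic.
  rewrite Exp_sum => [|t]; last exact: bounded_rvZ.
  by apply: eq_bigr => t _; rewrite ExpZ// Exp_indic.
apply/funext => w; rewrite (bigD1 (c w))//= indicE mem_set// mulr1 big1 ?addr0// => t tc.
by rewrite indicE memNset ?mulr0//= => cw; rewrite cw eqxx in tc.
Qed.

Lemma prb_finval (F : finType) (c : Omega -> F) (A : set Omega) : measurable A -> finval c ->
  prb A = \sum_t prb (A `&` c @^-1` [set t]).
Proof.
move=> mA mc; rewrite /prb -(Exp_indic Pr mA).
rewrite (_ : \1_A = fun w => \sum_t \1_(A `&` c @^-1` [set t]) w).
  have mAc t : measurable (A `&` c @^-1` [set t]) by exact: measurableI.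
  rewrite Exp_sum => [|t]; last exact: bounded_rv_indic.
  by apply: eq_bigr => t _; rewrite Exp_indic.
apply/funext => w; rewrite (bigD1 (c w))//= big1 ?addr0 => [|t tc].
  by rewrite !indicE in_setI [X in _ && X]mem_set// andbT.
by rewrite indicE memNset//= => -[_ cw]; rewrite cw eqxx in tc.
Qed.

Lemma prb_markov (F : finType) (c : Omega -> F) (g : F -> R) (a : R) : finval c ->
  (forall t, 0 <= g t) -> 0 < a ->
  prb (c @^-1` [set t | a < g t]) <= Exp Pr (g \o c) / a.
Proof.
move=> mc g0 a0; have mA := finval_set [set t | a < g t] mc.
rewrite ler_pdivlMr// mulrC /prb -(Exp_indic Pr mA) -(ExpZ Pr a (bounded_rv_indic mA)).
apply: Exp_le; [exact: bounded_rvZ (bounded_rv_indic mA)|exact: finval_bounded|move=> w /=].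
rewrite indicE; have [ga|ga] := ltP a (g (c w)); first by rewrite mem_set// mulr1 ltW.
by rewrite memNset ?mulr0//= ltNge ga.
Qed.

End FiniteValuedVariables.

Section MarkovChains.
Context {d : measure_display} {Omega : measurableType d} {R : realType}.
Variables (Pr : probability Omega R) (N : nat).
Variables (X : nat -> Omega -> 'I_N) (P : 'M[R]_N).
Hypothesis hX : markov_chain Pr X P.

Let prb := prb Pr.

Definition path_of n (w : Omega) : {ffun 'I_n -> 'I_N} := [ffun k : 'I_n => X k w].

Lemma finval_chain n : finval (X n). Proof. by move=> t; exact: hX.1. Qed.

Lemma path_ofE n (x : {ffun 'I_n -> 'I_N}) (x' : nat -> 'I_N) : (forall k : 'I_n, x' k = x k) ->
  path_of n @^-1` [set x] = \bigcap_(k < n) X k @^-1` [set x' k].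
Proof.
move=> xx'; apply/seteqP; split => [w /= wx k kn|w /= wx].
  by have := xx' (Ordinal kn); rewrite -wx ffunE /= => ->.
by apply/ffunP => k; rewrite ffunE -xx'; exact: (wx k (ltn_ord k)).
Qed.

Lemma finval_path n : finval (path_of n).
Proof.
move=> x; rewrite (_ : _ @^-1` _ = \bigcap_(k in [set: 'I_n]) X k @^-1` [set x k]).
  by apply: fin_bigcap_measurable => [|k _]; [exact: finite_finset|exact: finval_chain].
apply/seteqP; split => [w /= <- k _|w /= wx]; first by rewrite /= ffunE.
by apply/ffunP => k; rewrite ffunE; exact: (wx k I).
Qed.

Definition cylinder (C : nat -> set 'I_N) n := \bigcap_(k < n) X k @^-1` C k.

Lemma measurable_cylinder C n : measurable (cylinder C n).
Proof. by apply: bigcap_measurableType => k _; exact: (finval_set _ (@finval_chain k)). Qed.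

Lemma prb_path_step n (x : {ffun 'I_n.+1 -> 'I_N}) j :
  prb (path_of n.+1 @^-1` [set x] `&` X n.+1 @^-1` [set j]) =
  prb (path_of n.+1 @^-1` [set x]) * P (x ord_max) j.
Proof.
pose x' k := if insub k is Some i then x i else j.
have xx' (k : 'I_n.+1) : x' k = x k by rewrite /x' valK.
have x'n : x' n.+1 = j by rewrite /x' insubF// ltnn.
have x'm : x' n = x ord_max by rewrite -(xx' ord_max).
have := hX.2 n x'; rewrite -(path_ofE xx') x'm x'n.
rewrite (_ : \bigcap_(k < n.+2) _ = path_of n.+1 @^-1` [set x] `&` X n.+1 @^-1` [set j]).
  by rewrite !prbE ?EFinM -?EFinM; [move=> []|exact: finval_path|apply: measurableI; [exact: finval_path|exact: finval_chain]].
rewrite (path_ofE xx'); apply/seteqP; split => [w wx|w [wx wj] k].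
  split; last by have := wx n.+1 (ltnSn _); rewrite /= x'n.
  by move=> k kn; apply: wx; exact: (ltn_trans kn).
by rewrite /= ltnS leq_eqVlt => /orP[/eqP->|kn]; [rewrite x'n|exact: wx].
Qed.

(** Only the present state has to be pinned; the past may be constrained by arbitrary sets. The
    event is split into individual paths, each either contained in the cylinder or disjoint from
    it. *)
Lemma prb_cylinder_step C n i j : (forall x, C n x -> x = i) ->
  prb (cylinder C n.+1 `&` X n.+1 @^-1` [set j]) = prb (cylinder C n.+1) * P i j.
Proof.
move=> Ci; have mC := measurable_cylinder C n.+1.
rewrite /prb (prb_finval Pr (measurableI _ _ mC (@finval_chain n.+1 j)) (@finval_path n.+1)).
rewrite (prb_finval Pr mC (@finval_path n.+1)) mulr_suml; apply: eq_bigr => x _.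
have [xC|xC] := pselect (forall k : 'I_n.+1, C k (x k)).
  have e : cylinder C n.+1 `&` path_of n.+1 @^-1` [set x] = path_of n.+1 @^-1` [set x].
    apply/setIidPr => w /= wx k kn /=.
    by have := xC (Ordinal kn); rewrite -wx ffunE.
  rewrite -setIA [X in _ `&` X]setIC setIA e -(Ci _ (xC ord_max)); exact: prb_path_step.
have e : cylinder C n.+1 `&` path_of n.+1 @^-1` [set x] = set0.
  rewrite -subset0 => w [wC wx]; apply: xC => k.
  by rewrite -wx ffunE; exact: (wC k (ltn_ord k)).
by rewrite -setIA [X in _ `&` X]setIC setIA e set0I !prb0 mul0r.
Qed.

Lemma prb_cylinder_steps C n i g j : (forall x, C n x -> x = i) ->
  prb (cylinder C n.+1 `&` X (n + g)%N @^-1` [set j]) =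
  prb (cylinder C n.+1) * (P ^+ g) i j.
Proof.
move=> Ci; elim: g j => [|g IH] j.
  rewrite addn0 expr0 mxE; have [ij|ij] := eqVneq i j.
    rewrite mulr1; congr (fine (Pr _)); apply/setIidPl => w wC /=.
    by rewrite -ij; apply: Ci; exact: (wC n (ltnSn n)).
  rewrite mulr0 (_ : _ `&` _ = set0) ?/prb ?prb0// -subset0 => w [wC /= wj].
  by move/eqP: ij; apply; rewrite -wj; apply/esym/Ci; exact: (wC n (ltnSn n)).
rewrite addnS exprSr mxE mulr_sumr.
have mCj : measurable (cylinder C n.+1 `&` X (n + g).+1 @^-1` [set j]).
  by apply: measurableI; [exact: measurable_cylinder|exact: finval_chain].
rewrite /prb (prb_finval Pr mCj (@finval_chain (n + g)%N)).
apply: eq_bigr => l _; rewrite mulrA -IH.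
(* Times strictly between n and n + g are unconstrained. When g = 0 both constraints bear on the
   same time. *)
pose C' m := [set x | ((m <= n)%N -> C m x) /\ (m = (n + g)%N -> x = l)].
have e : cylinder C' (n + g).+1 = cylinder C n.+1 `&` X (n + g)%N @^-1` [set l].
  apply/seteqP; split => [w wC|w [wC wl] m mn /=].
    split; last by have [] := wC (n + g)%N (ltnSn _) => _; exact.
    move=> m /= mn; have [] := wC m (leq_trans mn (leq_addr g n.+1)).
    by move=> + _; apply.
  split; first by move=> mn'; exact: wC.
  by move=> ->.
rewrite -setIA [X in _ `&` X]setIC setIA -e; apply: prb_cylinder_step => x [_].
by apply.
Qed.

Lemma Exp_path_step n (h : {ffun 'I_n.+1 -> 'I_N} -> 'I_N -> R) :
  Exp Pr (fun w => h (path_of n.+1 w) (X n.+1 w)) =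
  Exp Pr (fun w => \sum_j P (X n w) j * h (path_of n.+1 w) j).
Proof.
rewrite (_ : (fun w => \sum_j _) =
  (fun x : {ffun 'I_n.+1 -> 'I_N} => \sum_j P (x ord_max) j * h x j) \o path_of n.+1).
  rewrite (@Exp_finval _ _ _ Pr _ (path_of n.+1) _ (@finval_path n.+1)).
  have := Exp_finval Pr (fun t => h t.1 t.2) (finval_pair (@finval_path n.+1) (@finval_chain n.+1)).
  rewrite /comp/= => ->.
  transitivity (\sum_x \sum_j h x j *
      prb (path_of n.+1 @^-1` [set x] `&` X n.+1 @^-1` [set j])).
    rewrite pair_bigA; apply: eq_bigr => -[x j] _ /=; congr (_ * fine (Pr _)).
    by apply/seteqP; split => [w [<- <-]|w [/= <- <-]].
  apply: eq_bigr => x _; rewrite mulr_suml; apply: eq_bigr => j _.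
  by rewrite prb_path_step /prb; ring.
by apply/funext => w /=; rewrite ffunE.
Qed.

Definition additive_functional (xi : 'I_N -> 'I_N -> R) n w : R :=
  \sum_(1 <= k < n) xi (X k w) (X k.+1 w).

Let S_path xi n (x : {ffun 'I_n.+1 -> 'I_N}) : R :=
  \sum_(1 <= k < n) xi (x (inord k)) (x (inord k.+1)).

Lemma additive_functional_path xi n w :
  additive_functional xi n w = S_path xi (path_of n.+1 w).
Proof.
rewrite /additive_functional /S_path big_nat [RHS]big_nat; apply: eq_bigr => k /andP[k0 kn].
by rewrite !ffunE !inordK// ltnS// ltnW.
Qed.

(** The pair of accumulated sum and current state is itself a Markov chain; n is positive because
    the sums start at index 1. *)
Lemma Exp_additive_step xi (F : R -> 'I_N -> R) n : (0 < n)%N ->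
  Exp Pr (fun w => F (additive_functional xi n.+1 w) (X n.+1 w)) =
  Exp Pr (fun w => \sum_j P (X n w) j * F (additive_functional xi n w + xi (X n w) j) j).
Proof.
move=> n0.
have := Exp_path_step (fun x j => F (S_path xi x + xi (x ord_max) j) j).
move=> e; etransitivity; last (etransitivity; [exact: e|]).
  congr Exp; apply/funext => w; rewrite {1}/additive_functional big_nat_recr//=.
  by rewrite -/(additive_functional xi n w) additive_functional_path ffunE.
congr Exp; apply/funext => w; apply: eq_bigr => j _.
by rewrite additive_functional_path ffunE.
Qed.

End MarkovChains.

Section RandomlyObservedChain.
Context {d : measure_display} {Omega : measurableType d} {R : realType}.
Variables (Pr : probability Omega R) (N : nat).
Variables (X : nat -> Omega -> 'I_N) (P : 'M[R]_N).
Hypothesis hX : markov_chain Pr X P.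
Variables (tau : nat -> {RV Pr >-> nat}) (mu : probability nat R).
Hypotheses (htau : iid tau mu) (hindep : independent_processes X tau).

Let Y := obs X tau.

Lemma measurable_tau k (B : set nat) : measurable (tau k @^-1` B).
Proof. by rewrite -[X in measurable X]setTI; exact: measurable_funPT. Qed.

Lemma measurable_taus n (B : nat -> set nat) : measurable (\bigcap_(k < n) tau k @^-1` B k).
Proof. by apply: bigcap_measurableType => k _; exact: measurable_tau. Qed.

Lemma measurable_obs_time k t : measurable [set w | obs_time tau k w = t].
Proof.
elim: k t => [|k IH] t.
  rewrite (_ : [set _ | _] = if t == 0%N then setT else set0).
    by case: ifP => _; [exact: measurableT|exact: measurable0].
  by apply/seteqP; split => w /=; rewrite /obs_time big_ord0 eq_sym; case: eqP.
rewrite (_ : [set _ | _] = \bigcup_s ([set w | obs_time tau k w = s] `&`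
    tau k @^-1` [set u | (s + u)%N = t])).
  by apply: bigcupT_measurable => s; apply: measurableI => //; exact: measurable_tau.
apply/seteqP; split => [w <-|w [s _ [/= <- <-]]]; last by rewrite /obs_time big_ord_recr.
by exists (obs_time tau k w) => //=; split => //=; rewrite /obs_time big_ord_recr.
Qed.

Lemma finval_obs k : finval (Y k).
Proof.
move=> i; rewrite (_ : _ @^-1` _ = \bigcup_t ([set w | obs_time tau k w = t] `&` X t @^-1` [set i])).
  by apply: bigcupT_measurable => t; apply: measurableI; [exact: measurable_obs_time|exact: (finval_chain hX)].
apply/seteqP; split => [w <-|w [t _ [/= <- <-]]]; last by [].
by exists (obs_time tau k w).
Qed.

(** A sequence of naturals is encoded by a natural number through [pickle], so that conditioning on
    the gaps becomes a series. *)
Definition gaps k w : seq nat := [seq (tau l w : nat) | l <- iota 0 k].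

Definition partial_time (s : seq nat) l := (\sum_(i < l) nth 0 s i)%N.

Lemma gaps_time k w l : (l <= k)%N -> obs_time tau l w = partial_time (gaps k w) l.
Proof.
move=> lk; apply: eq_bigr => i _; rewrite (nth_map 0%N) ?size_iota ?nth_iota//.
  exact: leq_trans (ltn_ord i) lk.
exact: leq_trans (ltn_ord i) lk.
Qed.

Lemma gaps_event k (s : seq nat) : size s = k ->
  [set w | gaps k w = s] = \bigcap_(l < k) tau l @^-1` [set nth 0%N s l].
Proof.
move=> sk; apply/seteqP; split => [w <- l lk|w ws] /=.
  by rewrite (nth_map 0%N) ?size_iota ?nth_iota.
apply: (@eq_from_nth _ 0%N); rewrite size_map size_iota ?sk// => l lk.
by rewrite (nth_map 0%N) ?size_iota ?nth_iota//; exact: ws.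
Qed.

Lemma partial_time_mono s l l' : (l <= l')%N -> (partial_time s l <= partial_time s l')%N.
Proof.
move=> ll; rewrite /partial_time -!(big_mkord xpredT (nth 0%N s)).
by rewrite (big_cat_nat (leq0n l) ll) /= leq_addr.
Qed.

(* The prescribed positions are at the times [partial_time s l], which may repeat. *)
Definition visits s k (y : nat -> 'I_N) (m : nat) : set 'I_N :=
  [set x | forall l, (l <= k)%N -> partial_time s l = m -> x = y l].

(** Once the gaps are fixed, the observation times are deterministic and the observed path becomes
    an event of X alone, to which independence applies. *)
Lemma gaps_visits k s (y : nat -> 'I_N) : size s = k ->
  (\bigcap_(l < k.+1) Y l @^-1` [set y l]) `&` [set w | gaps k w = s] =
  cylinder X (visits s k y) (partial_time s k).+1 `&` [set w | gaps k w = s].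
Proof.
move=> sk; apply/seteqP; split => [w [wy ws]|w [wc ws]]; split => // l.
  move=> /= _ j jk <-; rewrite -ws -gaps_time//.
  by rewrite -(wy j jk).
rewrite /= ltnS => lk; rewrite /Y /obs (gaps_time _ lk) ws.
by apply: wc => //=; rewrite ltnS partial_time_mono.
Qed.

(** Independence separates the event of X from that of the gaps; the former yields the power of P,
    by the Markov property at the deterministic time [t], the latter the mass at g, because the gaps
    are i.i.d. *)
Lemma prb_gap_step k s (y : nat -> 'I_N) g j : size s = k ->
  prb Pr (((\bigcap_(l < k.+1) Y l @^-1` [set y l]) `&` [set w | gaps k w = s]) `&`
      ((tau k @^-1` [set g]) `&` Y k.+1 @^-1` [set j])) =
  prb Pr ((\bigcap_(l < k.+1) Y l @^-1` [set y l]) `&` [set w | gaps k w = s]) *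
    (mass mu g * (P ^+ g) (y k) j).
Proof.
move=> sk; rewrite gaps_visits//; set C := visits s k y; set t := partial_time s k.
have Ct x : C t x -> x = y k by move=> /(_ k (leqnn k) erefl).
pose B l : set nat := [set nth 0%N s l]; pose B' l : set nat := if l == k then [set g] else B l.
pose C' m : set 'I_N := [set x | ((m <= t)%N -> C m x) /\ (m = (t + g)%N -> x = j)].
have e1 : cylinder X C' (t + g).+1 = cylinder X C t.+1 `&` X (t + g)%N @^-1` [set j].
  apply/seteqP; split => [w wC|w [wC wl] m mn /=].
    split; last by have [] := wC (t + g)%N (ltnSn _) => _; exact.
    move=> m /= mn; have [] := wC m (leq_trans mn (leq_addr g t.+1)).
    by move=> + _; apply.
  by split=> [mn'|->]; [exact: wC|].
have e2 : \bigcap_(l < k.+1) tau l @^-1` B' l =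
    (\bigcap_(l < k) tau l @^-1` B l) `&` tau k @^-1` [set g].
  apply/seteqP; split => [w wB|w [wB wg] l /=].
    split; last by have := wB k (ltnSn k); rewrite /B' eqxx.
    by move=> l lk; have := wB l (ltnW lk); rewrite /B' (ltn_eqF lk).
  by rewrite ltnS leq_eqVlt /B'; case: eqP => [-> //|_ /=]; exact: wB.
have e3 : (cylinder X C t.+1 `&` [set w | gaps k w = s]) `&`
    ((tau k @^-1` [set g]) `&` Y k.+1 @^-1` [set j]) =
    cylinder X C' (t + g).+1 `&` \bigcap_(l < k.+1) tau l @^-1` B' l.
  rewrite e1 e2 (gaps_event sk); apply/seteqP; split => [w [[wC ws] [wg wj]]|w [[wC wj] [ws wg]]].
    split => //; split => //=; rewrite -wj /Y /obs /obs_time big_ord_recr/= wg.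
    have := wg; have := ws; rewrite -(gaps_event sk) => /= ws' _.
    by rewrite -/(obs_time tau k w) (gaps_time w (leqnn k)) ws'.
  split => //; split => //=; rewrite -[RHS]wj /Y /obs /obs_time big_ord_recr/= wg.
  have := ws; rewrite -(gaps_event sk) => /= ws'.
  by rewrite -/(obs_time tau k w) (gaps_time w (leqnn k)) ws'.
rewrite e3 (gaps_event sk) /prb hindep hindep !fineM ?fin_num_measure//; last 4 first.
- by first [exact: measurable_taus | exact: (measurable_cylinder hX)].
- by first [exact: measurable_taus | exact: (measurable_cylinder hX)].
- by first [exact: measurable_taus | exact: (measurable_cylinder hX)].
- by first [exact: measurable_taus | exact: (measurable_cylinder hX)].
have -> : fine (Pr (\bigcap_(l < k.+1) tau l @^-1` B' l)) =
    fine (Pr (\bigcap_(l < k) tau l @^-1` B l)) * mass mu g.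
  rewrite htau.2 big_ord_recr/= fineM; last 2 first.
  - by apply/prode_fin_num => l _; exact: fin_num_measure (measurable_tau _ _).
  - exact: fin_num_measure (measurable_tau _ _).
  rewrite {2}/B' eqxx; congr (_ * _); last by have := htau.1 k [set g]; rewrite /distribution /pushforward => ->.
  rewrite htau.2; congr fine; apply: eq_bigr => l _; by rewrite /B' (ltn_eqF (ltn_ord l)).
have := prb_cylinder_steps hX g j Ct; rewrite -e1 /prb => ->; ring.
Qed.

Lemma finval_gaps k s : measurable [set w | gaps k w = s].
Proof.
have [sk|sk] := eqVneq (size s) k; first by rewrite gaps_event//; exact: measurable_taus.
rewrite (_ : [set _ | _] = set0)// -subset0 => w /= ws.
by move/eqP: sk; apply; rewrite -ws size_map size_iota.
Qed.

Lemma Pr_partition (c : Omega -> nat) (A : set Omega) : measurable A ->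
  (forall n, measurable [set w | c w = n]) ->
  Pr A = (\sum_(n <oo) Pr (A `&` [set w | c w = n]))%E.
Proof.
move=> mA mc; rewrite -measure_semi_bigcup.
- by congr (Pr _); apply/seteqP; split => [w Aw|w [n _ []]//]; exists (c w).
- by move=> n; exact: measurableI.
- by move=> n n' _ _ [w [[_ <-] [_ <-]]].
- by apply: bigcupT_measurable => n; exact: measurableI.
Qed.

(** The first k gaps and then the next one are summed out. For each value of the first k, the sum
    over the next gap produces the same factor, an entry of Q. *)
Lemma obs_markov_chain (Q : 'M[R]_N) :
  (forall i j, (\sum_(g <oo) (mass mu g * (P ^+ g) i j)%:E = (Q i j)%:E)%E) ->
  (forall g i j, 0 <= (P ^+ g) i j) ->
  markov_chain Pr Y Q.
Proof.
move=> hQ P0; split=> [k i|k y]; first exact: finval_obs.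
set j := y k.+1; pose A := \bigcap_(l < k.+1) Y l @^-1` [set y l].
have mA : measurable A by apply: bigcap_measurableType => l _; exact: finval_obs.
have -> : \bigcap_(l < k.+2) Y l @^-1` [set y l] = A `&` Y k.+1 @^-1` [set j].
  apply/seteqP; split => [w wy|w [wA wj] l /=].
    by split; [move=> l lk; exact: (wy l (ltnW lk))|exact: (wy k.+1 (ltnSn _))].
  by rewrite ltnS leq_eqVlt => /orP[/eqP->|lk]; [exact: wj|exact: wA].
have Qj : (0 <= (Q (y k) j)%:E)%E.
  rewrite -hQ; apply: nneseries_ge0 => g _ _.
  by rewrite lee_fin mulr_ge0// fine_ge0.
pose c w := pickle (gaps k w).
have mc n : measurable [set w | c w = n].
  have [[s sn]|nex] := pselect (exists s : seq nat, pickle s = n).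
    rewrite (_ : [set _ | _] = [set w | gaps k w = s]); first exact: finval_gaps.
    apply/seteqP; split => w /=; rewrite /c -sn; last by move=> ->.
    by move/(pcan_inj pickleK).
  rewrite (_ : [set _ | _] = set0)// -subset0 => w /= wn.
  by apply: nex; exists (gaps k w).
have mAj : measurable (A `&` Y k.+1 @^-1` [set j]).
  by apply: measurableI => //; exact: finval_obs.
rewrite (Pr_partition mAj mc) (Pr_partition mA mc) muleC -nneseriesZl//.
apply: eq_eseriesr => n _; rewrite muleC.
have [[w0 w0n]|emp] := pselect (exists w, c w = n); last first.
  have e0 : [set w | c w = n] = set0 by rewrite -subset0 => w wn; apply: emp; exists w.
  by rewrite e0 !setI0 measure0 mul0e.
pose s := gaps k w0.
have sk : size s = k by rewrite size_map size_iota.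
have es : [set w | c w = n] = [set w | gaps k w = s].
  apply/seteqP; split => w /=; rewrite -w0n /c; last by move=> ->.
  by move/(pcan_inj pickleK).
rewrite es setIAC.
have mAs : measurable (A `&` [set w | gaps k w = s]).
  by apply: measurableI => //; exact: finval_gaps.
have mt g : measurable [set w | (tau k w : nat) = g] by exact: (measurable_tau k [set g]).
rewrite (Pr_partition (c := tau k) (measurableI _ _ mAs (@finval_obs k.+1 j)) mt).
rewrite (prbE Pr mAs) -hQ -nneseriesZl; last first.
  by move=> g _; rewrite lee_fin mulr_ge0// fine_ge0.
apply: eq_eseriesr => g _.
rewrite -setIA [X in _ `&` X]setIC -EFinM -prb_gap_step// prbE//.
by apply: measurableI => //; apply: measurableI => //; exact: finval_obs.
Qed.

End RandomlyObservedChain.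

(** * Central limit theorem for additive functionals of a Markov chain *)

Section TaylorBounds.
Context {R : realType}.

Lemma ge0_of_derive_ge0 (f f' : R -> R) : (forall x : R, is_derive x 1 f (f' x)) ->
  f 0 = 0 -> (forall x, 0 <= x -> 0 <= f' x) -> forall x, 0 <= x -> 0 <= f x.
Proof.
move=> df f0 f'0 x x0; rewrite -f0.
have cf : {within `[0, x], continuous f}.
  apply: continuous_subspaceT => y; apply: differentiable_continuous.
  by apply/derivable1_diffP; exact: (@ex_derive _ _ _ _ _ _ _ (df y)).
apply: (@ger0_derive1_le_cc _ f 0 x) => //.
- move=> y; rewrite in_itv/= => /andP[y0 _].
  by rewrite derive1E (@derive_val _ _ _ _ _ _ _ (df y)) f'0// ltW.
- by rewrite in_itv/= lexx.
- by rewrite in_itv/= x0 lexx.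
Qed.

Lemma sin_le_id (u : R) : 0 <= u -> sin u <= u.
Proof.
move=> u0; rewrite -subr_ge0.
apply: (@ge0_of_derive_ge0 (fun u => u - sin u) (fun u => 1 - cos u)) => //.
by rewrite sin0 subr0.
Qed.

Lemma cos_ge_taylor (u : R) : 1 - u ^+ 2 / 2 <= cos u.
Proof.
wlog u0 : u / 0 <= u => [H|].
  by have [/H//|/ltW] := leP 0 u; rewrite -oppr_ge0 => /H; rewrite sqrrN cosN.
have -> : cos u = 1 - sin (u / 2) ^+ 2 *+ 2.
  rewrite [u in LHS](_ : u = (u / 2) *+ 2); last by rewrite mulr2n; field.
  by rewrite cos_mulr2n cos2sin2; ring.
have s1 := sin_le_id (divr_ge0 u0 (ler0n R 2)).
have : `|sin (u / 2)| <= u / 2.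
  rewrite ler_norml s1 andbT; have := ler_norm (- sin (u / 2)).
  have [u4|u4] := leP (u / 2) pi; first by have := @sin_ge0_pi R (u / 2); rewrite divr_ge0//= u4; lra.
  by have := sin_geN1 (u / 2); have := pi_ge2 R; lra.
move=> sa; have : sin (u / 2) ^+ 2 <= (u / 2) ^+ 2.
  by rewrite -[leLHS]real_normK ?num_real// ler_pXn2r ?nnegrE ?divr_ge0.
by rewrite exprMn; lra.
Qed.

Lemma sin_ge_taylor (u : R) : 0 <= u -> u - u ^+ 3 / 6 <= sin u.
Proof.
move=> u0; rewrite -subr_ge0.
apply: (@ge0_of_derive_ge0 (fun u => sin u - (u - u ^+ 3 / 6)) (fun u => cos u - (1 - u ^+ 2 / 2))) => //.
- by move=> x; apply: is_derive_eq; rewrite /GRing.scale/=; field.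
- by rewrite sin0 expr0n/= mul0r !subr0.
- by move=> x _; rewrite subr_ge0 cos_ge_taylor.
Qed.

Lemma sin_taylor (u : R) : `|sin u - u| <= `|u| ^+ 3.
Proof.
wlog u0 : u / 0 <= u => [H|].
  have [/H//|/ltW] := leP 0 u; rewrite -oppr_ge0 => /H.
  by rewrite sinN opprK normrN addrC -opprB normrN.
have := sin_le_id u0; have := sin_ge_taylor u0.
rewrite (ger0_norm u0) ler_norml => h1 h2.
have : 0 <= u ^+ 3 by rewrite exprn_ge0.
by move=> h3; apply/andP; split; lra.
Qed.

Lemma cos_taylor (u : R) : `|u| <= 1 -> `|cos u - (1 - u ^+ 2 / 2)| <= `|u| ^+ 3.
Proof.
wlog u0 : u / 0 <= u => [H|].
  have [/H//|/ltW] := leP 0 u; rewrite -oppr_ge0 => /H.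
  by rewrite sqrrN cosN normrN.
rewrite (ger0_norm u0) => u1; rewrite ger0_norm ?subr_ge0 ?cos_ge_taylor//.
have -> : cos u = 1 - sin (u / 2) ^+ 2 *+ 2.
  rewrite [u in LHS](_ : u = (u / 2) *+ 2); last by rewrite mulr2n; field.
  by rewrite cos_mulr2n cos2sin2; ring.
pose v := u / 2; have v0 : 0 <= v by rewrite divr_ge0.
have v1 : v <= 1 / 2 by rewrite /v; lra.
have uv : u = v * 2 by rewrite /v; field.
have := sin_ge_taylor v0; rewrite -/v uv => h.
have v2 : v ^+ 2 <= 1 / 4 by nra.
have h0 : 0 <= v - v ^+ 3 / 6 by nra.
have : (v - v ^+ 3 / 6) ^+ 2 <= sin v ^+ 2 by rewrite ler_pXn2r ?nnegrE// (le_trans h0).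
have v3 : 0 <= v ^+ 3 by rewrite exprn_ge0.
nra.
Qed.

Lemma cosD_taylor (x u : R) : `|u| <= 1 ->
  `|cos (x + u) - (cos x - u * sin x - u ^+ 2 / 2 * cos x)| <= 2 * `|u| ^+ 3.
Proof.
move=> u1.
rewrite (_ : _ - _ = cos x * (cos u - (1 - u ^+ 2 / 2)) - sin x * (sin u - u)); last by rewrite cosD; ring.
rewrite (le_trans (ler_normB _ _))// mulr_natl mulr2n !normrM.
apply: lerD; rewrite -[leRHS]mul1r ler_pM ?cos_max ?sin_max ?sin_taylor//.
exact: cos_taylor.
Qed.

(** From 1 + y <= exp y at y = x and y = - x: exp (- x) lies between 1 - x and 1 / (1 + x). *)
Lemma expRN_taylor (x : R) : 0 <= x -> `|1 - expR (- x) - x| <= x ^+ 2.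
Proof.
move=> x0; have h1 := expR_ge1Dx (- x); have h2 := expR_ge1Dx x.
have e : expR x * expR (- x) = 1 by rewrite -expRD subrr expR0.
have p := expR_gt0 (- x).
rewrite ler_norml; apply/andP; split; nra.
Qed.

End TaylorBounds.

Lemma cvg_inv_sqrt (R : realType) : (Num.sqrt n%:R)^-1 @[n --> \oo] --> (0 : R).
Proof.
apply/cvgrPdist_le => /= e e0; near=> n; rewrite sub0r normrN ger0_norm ?invr_ge0 ?sqrtr_ge0//.
have n0 : 0 < n%:R :> R by rewrite ltr0n; near: n; exists 1%N.
rewrite -[leRHS]invrK lef_pV2 ?posrE ?invr_gt0 ?sqrtr_gt0//.
have ei : 0 <= e^-1 by rewrite invr_ge0 ltW.
rewrite -(ger0_norm ei) -sqrtr_sqr ler_wsqrtr//.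
rewrite (le_trans (ltW (truncnS_gt _)))// ler_nat.
by near: n; exact: nbhs_infty_ge.
Unshelve. all: by end_near. Qed.

Section ChainCLT.
Context {d : measure_display} {Omega : measurableType d} {R : realType}.
Variables (Pr : probability Omega R) (N : nat).
Variables (Y : nat -> Omega -> 'I_N) (Q : 'M[R]_N) (pi : 'rV[R]_N).
Hypotheses (hY : markov_chain Pr Y Q) (hQ : stochastic_mx Q).
Hypothesis hpi : invariant_distribution Q pi.
Hypothesis harm : forall h : 'cV[R]_N, Q *m h = h -> forall i j, h i 0 = h j 0.

Let Q0 i j : 0 <= Q i j. Proof. exact: hQ.1. Qed.
Let Q1 i : \sum_j Q i j = 1. Proof. exact: hQ.2. Qed.

Lemma stochastic_mean_le (f : 'I_N -> R) C i : (forall j, `|f j| <= C) ->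
  `|\sum_j Q i j * f j| <= C.
Proof.
move=> fC; rewrite (le_trans (ler_norm_sum _ _ _))// -[leRHS]mul1r -(Q1 i) mulr_suml.
by apply: ler_sum => j _; rewrite normrM ger0_norm// ler_wpM2l.
Qed.

(* The matrix [1 - Q + 1 pi] is invertible, and its inverse solves the equation when [pi g = 0]. *)
Lemma poisson_equation (g : 'cV[R]_N) : pi *m g = 0 -> exists h : 'cV[R]_N, h - Q *m h = g.
Proof.
move=> pg; pose E : 'cV[R]_N := const_mx 1; pose K := 1%:M - Q + E *m pi.
have pE : pi *m E = 1%:M.
  apply/matrixP => a c; rewrite !ord1 !mxE -[RHS](_ : \sum_i pi 0 i = _); last by case: hpi.
  by apply: eq_bigr => i _; rewrite !mxE mulr1.
have pK : pi *m K = pi.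
  by case: hpi => _ _ pQ; rewrite /K mulmxDr mulmxBr mulmx1 pQ subrr add0r mulmxA pE mul1mx.
have Ku : K \in unitmx.
  rewrite -unitmx_tr -row_free_unit -kermx_eq0; apply/rowV0P => v /sub_kermxP vK.
  have Kv : K *m v^T = 0 by rewrite -[K]trmxK -trmx_mul vK trmx0.
  have pv : pi *m v^T = 0 by rewrite -pK -mulmxA Kv mulmx0.
  have Qv : Q *m v^T = v^T.
    move: Kv; rewrite /K mulmxDl mulmxBl mul1mx -mulmxA pv mulmx0 addr0 => /eqP.
    by rewrite subr_eq0 => /eqP.
  apply/rowP => i; rewrite mxE.
  have : \sum_j pi 0 j * v 0 j = 0.
    transitivity ((pi *m v^T) 0 0); last by rewrite pv mxE.
    by rewrite mxE; apply: eq_bigr => j _; rewrite mxE.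
  have vij j : v 0 j = v 0 i by have := harm Qv j i; rewrite !mxE.
  under eq_bigr do rewrite vij.
  by rewrite -mulr_suml; case: hpi => _ -> _; rewrite mul1r.
exists (invmx K *m g); set h := invmx K *m g.
have Kh : K *m h = g by rewrite mulKVmx.
have ph : pi *m h = 0 by rewrite -pK -mulmxA Kh.
by move: Kh; rewrite /K mulmxDl mulmxBl mul1mx -mulmxA ph mulmx0 addr0.
Qed.

Lemma poisson_function (g : 'I_N -> R) : \sum_i pi 0 i * g i = 0 ->
  exists h : 'I_N -> R, forall i, h i - \sum_j Q i j * h j = g i.
Proof.
move=> pg; have [|h hg] := @poisson_equation (\col_i g i).
  by apply/matrixP => a b; rewrite !ord1 !mxE -[RHS]pg; apply: eq_bigr => i _; rewrite mxE.
exists (fun i => h i 0) => i; have := congr1 (fun M : 'cV[R]_N => M i 0) hg.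
by rewrite !mxE.
Qed.

Lemma finval_additive (xi : 'I_N -> 'I_N -> R) (F : R -> 'I_N -> R) n :
  bounded_rv (fun w => F (additive_functional Y xi n w) (Y n w)).
Proof.
have := finval_bounded (fun x : {ffun 'I_n.+1 -> 'I_N} =>
  F (\sum_(1 <= k < n) xi (x (inord k)) (x (inord k.+1))) (x ord_max)) (finval_path hY (n := n.+1)).
congr bounded_rv; apply/funext => w /=; rewrite ffunE; congr F.
exact/esym/additive_functional_path.
Qed.

(** Martingale increments are orthogonal: the cross term vanishes by centring, and each step adds at
    most C^2. *)
Lemma second_moment_additive (xi : 'I_N -> 'I_N -> R) C n : (0 < n)%N ->
  (forall i j, `|xi i j| <= C) -> (forall i, \sum_j Q i j * xi i j = 0) ->
  Exp Pr (fun w => additive_functional Y xi n w ^+ 2) <= C ^+ 2 * n%:R.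
Proof.
move=> + xiC xi0; elim: n => // -[_ _|n IH _].
  rewrite (_ : (fun w => _) = cst 0); last by apply/funext => w; rewrite /additive_functional big_nil expr0n.
  by rewrite Exp_cst mulr_ge0// sqr_ge0.
rewrite (Exp_additive_step hY xi (fun s _ => s ^+ 2)) //.
rewrite -natr1 mulrDr mulr1; apply: le_trans (lerD (IH isT) (lexx _)).
have b1 := finval_additive xi (fun s _ => s ^+ 2) n.+1.
rewrite -[X in _ <= _ + X](Exp_cst Pr) -ExpD//; last exact: bounded_rv_cst.
apply: Exp_le.
- exact: (finval_additive xi (fun s y => \sum_j Q y j * (s + xi y j) ^+ 2)).
- exact: bounded_rvD b1 (bounded_rv_cst _).
move=> w; set s := additive_functional _ _ _ _; set y := Y _ _ => /=.
rewrite (eq_bigr (fun j => s ^+ 2 * Q y j + s *+ 2 * (Q y j * xi y j) + Q y j * xi y j ^+ 2)); last by move=> j _; ring.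
rewrite !big_split/= -!mulr_sumr Q1 xi0 mulr1 mulr0 addr0 lerD2l.
rewrite (le_trans (ler_norm _))// stochastic_mean_le// => j.
by rewrite normrX ler_pXn2r ?nnegrE// (le_trans _ (xiC y j)).
Qed.


Let pi0 i : 0 <= pi 0 i. Proof. by case: hpi. Qed.
Let pi1 : \sum_i pi 0 i = 1. Proof. by case: hpi. Qed.

Section CenteredFunctional.
Variables (xi : 'I_N -> 'I_N -> R) (C : R).
Hypotheses (xiC : forall i j, `|xi i j| <= C) (xi0 : forall i, \sum_j Q i j * xi i j = 0).

Let v i := \sum_j Q i j * xi i j ^+ 2.
(** The increments are martingale differences, so no covariance between distinct times enters: only
    the stationary mean of the conditional variances remains. *)
Definition asymptotic_variance : R := \sum_i pi 0 i * v i.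
Notation vbar := asymptotic_variance.

Let C0 (i : 'I_N) : 0 <= C. Proof. exact: le_trans (xiC i i). Qed.

Let xi2 i j : `|xi i j ^+ 2| <= C ^+ 2.
Proof. by rewrite normrX ler_pXn2r ?nnegrE// (C0 i). Qed.

Lemma asymptotic_variance_ge0 : 0 <= vbar.
Proof. by apply: sumr_ge0 => i _; rewrite mulr_ge0// sumr_ge0// => j _; rewrite mulr_ge0// sqr_ge0. Qed.

Lemma asymptotic_variance_le : vbar <= C ^+ 2.
Proof.
rewrite -[leRHS]mul1r -pi1 mulr_suml; apply: ler_sum => i _; rewrite ler_wpM2l//.
by rewrite (le_trans (ler_norm _))// stochastic_mean_le.
Qed.

Variables (h : 'I_N -> R) (H : R).
Hypotheses (hh : forall i, h i - \sum_j Q i j * h j = v i - vbar) (hH : forall i, `|h i| <= H).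

(* The corrector [1 - s^2 h / 2] makes the conditional variance of each step equal to [vbar],
   up to terms of order [s^3]. *)
Lemma corrected_cos_step (s x : R) i : 0 <= s -> s <= 1 -> s * C <= 1 ->
  `|\sum_j Q i j * (cos (x + s * xi i j) * (1 - h j * s ^+ 2 / 2)) -
    expR (- (vbar * s ^+ 2 / 2)) * (cos x * (1 - h i * s ^+ 2 / 2))| <=
  (2 * C ^+ 3 * (1 + H) + C * H + C ^+ 2 * H + C ^+ 4 + C ^+ 2 * H) * s ^+ 3.
Proof.
move=> s0 s1 sC; have C0' := C0 i; have H0 : 0 <= H := le_trans (normr_ge0 _) (hH i).
have s20 : 0 <= s ^+ 2 by rewrite sqr_ge0.
have s21 : s ^+ 2 <= 1 by rewrite expr_le1.
have s32 : s ^+ 3 <= s ^+ 2 by rewrite exprS ler_piMl.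
have s43 : s ^+ 4 <= s ^+ 3 by rewrite exprS ler_piMl// exprn_ge0.
have s30 : 0 <= s ^+ 3 by rewrite exprn_ge0.
have s40 : 0 <= s ^+ 4 by rewrite exprn_ge0.
pose A j := cos x - s * xi i j * sin x - (s * xi i j) ^+ 2 / 2 * cos x.
pose c j := 1 - h j * s ^+ 2 / 2.
have sxi j : `|s * xi i j| <= s * C by rewrite normrM (ger0_norm s0) ler_wpM2l.
(* Third-order Taylor remainder of the cosine, times the corrector, which is at most 1 + H. *)
have T1 : `|\sum_j Q i j * ((cos (x + s * xi i j) - A j) * c j)| <= 2 * C ^+ 3 * (1 + H) * s ^+ 3.
  apply: stochastic_mean_le => j; rewrite normrM.
  rewrite (_ : 2 * C ^+ 3 * (1 + H) * s ^+ 3 = (2 * (s * C) ^+ 3) * (1 + H)); last by ring.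
  apply: ler_pM => //.
    apply: le_trans (cosD_taylor _ (le_trans (sxi j) sC)) _.
    by rewrite ler_wpM2l// ler_pXn2r ?nnegrE// mulr_ge0.
  rewrite (le_trans (ler_normB _ _))// normr1 lerD2l -mulrA normrM -[leRHS]mulr1.
  by apply: ler_pM => //; rewrite ger0_norm ?divr_ge0//; lra.
pose a1 := \sum_j Q i j * (xi i j * h j); pose a2 := \sum_j Q i j * (xi i j ^+ 2 * h j).
have a1H : `|a1| <= C * H by apply: stochastic_mean_le => j; rewrite normrM ler_pM.
have a2H : `|a2| <= C ^+ 2 * H by apply: stochastic_mean_le => j; rewrite normrM ler_pM.
(* The second-order part contains v i and the mean of h; by the Poisson equation [hh] their sum is h
   i + vbar, so that the state i enters this order only through the corrector. *)
have T2 : \sum_j Q i j * (A j * c j) = cos x * (1 - h i * s ^+ 2 / 2 - vbar * s ^+ 2 / 2) +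
    s ^+ 3 / 2 * sin x * a1 + s ^+ 4 / 4 * cos x * a2.
  have hE : \sum_j Q i j * h j = h i - v i + vbar by have := hh i; lra.
  rewrite (eq_bigr (fun j => cos x * Q i j - s * sin x * (Q i j * xi i j)
     - s ^+ 2 / 2 * cos x * (Q i j * xi i j ^+ 2) - s ^+ 2 / 2 * cos x * (Q i j * h j)
     + s ^+ 3 / 2 * sin x * (Q i j * (xi i j * h j))
     + s ^+ 4 / 4 * cos x * (Q i j * (xi i j ^+ 2 * h j)))); last first.
    by move=> j _; rewrite /A /c; field.
  rewrite !big_split/= !sumrN -!mulr_sumr Q1 xi0 hE -/(v i) -/a1 -/a2.
  by field.
have vb := asymptotic_variance_le; have vb0 := asymptotic_variance_ge0.
have V0 : 0 <= vbar * s ^+ 2 / 2 by rewrite divr_ge0// mulr_ge0.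
set lam := expR _.
(* The factor 1 - vbar s^2 / 2 is exchanged for an exponential, so that the factors of successive
   steps multiply exactly. *)
have T3 : `|(1 - h i * s ^+ 2 / 2 - vbar * s ^+ 2 / 2) - lam * (1 - h i * s ^+ 2 / 2)|
    <= (C ^+ 4 + C ^+ 2 * H) * s ^+ 3.
  have e1 := expRN_taylor V0; rewrite -/lam in e1.
  have e2 : `|1 - lam| <= vbar * s ^+ 2 / 2.
    rewrite ger0_norm ?subr_ge0; last by rewrite -[leRHS]expR0 ler_expR oppr_le0.
    by have := expR_ge1Dx (- (vbar * s ^+ 2 / 2)); rewrite -/lam; lra.
  rewrite (_ : _ - _ = (1 - lam - vbar * s ^+ 2 / 2) - h i * (s ^+ 2 / 2) * (1 - lam)); last by field.
  rewrite (le_trans (ler_normB _ _))// mulrDl; apply: lerD.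
    apply: le_trans e1 _.
    rewrite (_ : _ ^+ 2 = vbar ^+ 2 / 4 * s ^+ 4); last by field.
    apply: ler_pM => //; first by rewrite divr_ge0// sqr_ge0.
    rewrite (_ : C ^+ 4 = (C ^+ 2) ^+ 2); last by ring.
    have : vbar ^+ 2 <= (C ^+ 2) ^+ 2 by rewrite ler_pXn2r ?nnegrE ?sqr_ge0.
    by have q := sqr_ge0 vbar; lra.
  rewrite normrM; apply: (@le_trans _ _ (H * (s ^+ 2 / 2) * (C ^+ 2 * s ^+ 2 / 2))).
    apply: ler_pM => //.
      rewrite normrM [X in _ * X]ger0_norm ?divr_ge0// ler_wpM2r// divr_ge0//.
    by apply: le_trans e2 _; rewrite ler_pM2r// ler_wpM2r.
  rewrite (_ : H * _ * _ = C ^+ 2 * H * (s ^+ 4 / 4)); last by field.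
  by apply: ler_wpM2l; [rewrite mulr_ge0// sqr_ge0|lra].
pose E := cos x * ((1 - h i * s ^+ 2 / 2 - vbar * s ^+ 2 / 2) - lam * (1 - h i * s ^+ 2 / 2)).
rewrite (_ : _ - _ = \sum_j Q i j * ((cos (x + s * xi i j) - A j) * c j) +
  s ^+ 3 / 2 * sin x * a1 + s ^+ 4 / 4 * cos x * a2 + E); last first.
  have -> : \sum_j Q i j * (cos (x + s * xi i j) * c j) =
    \sum_j Q i j * ((cos (x + s * xi i j) - A j) * c j) + \sum_j Q i j * (A j * c j).
    by rewrite -big_split/=; apply: eq_bigr => j _; ring.
  by rewrite T2 /E; ring.
have B1 : `|s ^+ 3 / 2 * sin x * a1| <= C * H * s ^+ 3.
  rewrite (_ : _ * a1 = (sin x * a1) * (s ^+ 3 / 2)); last by ring.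
  rewrite normrM [`|sin x * _|]normrM [X in _ * X]ger0_norm ?divr_ge0//.
  have : `|sin x| * `|a1| <= 1 * (C * H) by rewrite ler_pM// sin_max.
  rewrite mul1r => B1; apply: ler_pM => //; rewrite ?mulr_ge0 ?divr_ge0//; lra.
have B2 : `|s ^+ 4 / 4 * cos x * a2| <= C ^+ 2 * H * s ^+ 3.
  rewrite (_ : _ * a2 = (cos x * a2) * (s ^+ 4 / 4)); last by ring.
  rewrite normrM [`|cos x * _|]normrM [X in _ * X]ger0_norm ?divr_ge0//.
  have : `|cos x| * `|a2| <= 1 * (C ^+ 2 * H) by rewrite ler_pM// cos_max.
  rewrite mul1r => B2; apply: ler_pM => //; rewrite ?mulr_ge0 ?divr_ge0//; lra.
have B3 : `|E| <= (C ^+ 4 + C ^+ 2 * H) * s ^+ 3.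
  rewrite normrM; apply: le_trans T3; rewrite -[leRHS]mul1r ler_wpM2r// cos_max//.
rewrite (le_trans (ler_normD _ _))// (le_trans (lerD (ler_normD _ _) (lexx _)))//.
rewrite (le_trans (lerD (lerD (ler_normD _ _) (lexx _)) (lexx _)))//.
rewrite (le_trans (lerD (lerD (lerD T1 B1) B2) B3))//.
by rewrite -!mulrDl !addrA.
Qed.

(** Errors of order s^3 over n steps accumulate to order s, since s^2 n = 1. The three remaining
    errors come from the corrector at both ends and from one missing factor [lam]. *)
Lemma cos_clt_rate th : exists D, forall n s, (0 < n)%N -> 0 <= s -> s ^+ 2 * n%:R = 1 -> s * C <= 1 ->
  `|Exp Pr (fun w => cos (s * additive_functional Y xi n w + th)) - cos th * expR (- (vbar / 2))| <= D * s.
Proof.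
pose K := 2 * C ^+ 3 * (1 + H) + C * H + C ^+ 2 * H + C ^+ 4 + C ^+ 2 * H.
exists (K + H + H + C ^+ 2) => -[//|n] s _ s0 sn sC.
have i0 : 'I_N := Y 0%N point.
have C0' := C0 i0; have H0 : 0 <= H := le_trans (normr_ge0 _) (hH i0).
have K0 : 0 <= K by rewrite /K !addr_ge0 ?mulr_ge0 ?exprn_ge0// addr_ge0.
have s2 : s ^+ 2 <= 1 by rewrite -sn ler_peMr ?sqr_ge0// ler1n.
have s1 : s <= 1 by rewrite -(@ler_pXn2r _ 2) ?nnegrE// expr1n.
have s20 : 0 <= s ^+ 2 by exact: sqr_ge0.
have s21 : s ^+ 2 <= s by rewrite expr2 ler_piMl.
pose lam := expR (- (vbar * s ^+ 2 / 2)).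
have vb := asymptotic_variance_le; have vb0 := asymptotic_variance_ge0.
have V0 : 0 <= vbar * s ^+ 2 / 2 by rewrite divr_ge0// mulr_ge0.
have lam0 : 0 <= lam by exact: expR_ge0.
have lam1 : lam <= 1 by rewrite -[leRHS]expR0 ler_expR oppr_le0.
pose F (S : R) y := cos (th + s * S) * (1 - h y * s ^+ 2 / 2).
pose a k := Exp Pr (fun w => F (additive_functional Y xi k w) (Y k w)).
have bF k : bounded_rv (fun w => F (additive_functional Y xi k w) (Y k w)) by exact: finval_additive.
have step k : (0 < k)%N -> `|a k.+1 - lam * a k| <= K * s ^+ 3.
  move=> k0; rewrite /a (Exp_additive_step hY xi F k0).
  have b1 := finval_additive xi (fun S y => \sum_j Q y j * F (S + xi y j) j) k.
  rewrite -(ExpZ Pr _ (bF k)) -(ExpB Pr b1 (bounded_rvZ _ (bF k))).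
  apply: Exp_le_cst; first exact: bounded_rvB b1 (bounded_rvZ _ (bF k)).
  move=> w; have := corrected_cos_step (th + s * additive_functional Y xi k w) (Y k w) s0 s1 sC.
  apply: le_trans; rewrite le_eqVlt; apply/orP; left; apply/eqP; congr (`|_ - _|).
  by apply: eq_bigr => j _; rewrite /F; congr (_ * (cos _ * _)); ring.
have ak k : `|a k.+1 - lam ^+ k * a 1%N| <= k%:R * (K * s ^+ 3).
  elim: k => [|k IH]; first by rewrite expr0 mul1r subrr normr0 mul0r.
  rewrite (_ : _ - _ = (a k.+2 - lam * a k.+1) + lam * (a k.+1 - lam ^+ k * a 1%N)); last by rewrite exprS; ring.
  rewrite (le_trans (ler_normD _ _))// -natr1 mulrDl mul1r addrC lerD ?step//.
  by rewrite normrM (ger0_norm lam0) (le_trans _ IH)// ler_piMl.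
have close k : `|Exp Pr (fun w => cos (th + s * additive_functional Y xi k w)) - a k| <= H * s.
  have b1 := finval_additive xi (fun S y => cos (th + s * S)) k.
  rewrite -(ExpB Pr b1 (bF k)); apply: Exp_le_cst; first exact: bounded_rvB b1 (bF k).
  move=> w; rewrite /F; set c := cos _; set hy := h _.
  rewrite (_ : _ - _ = c * (hy * (s ^+ 2 / 2))); last by field.
  rewrite normrM -[leRHS]mul1r ler_pM ?cos_max// normrM ler_pM ?hH//.
  by rewrite ger0_norm ?divr_ge0//; lra.
have a1 : `|cos th - a 1%N| <= H * s.
  have := close 1%N; rewrite (_ : (fun w => cos _) = cst (cos th)) ?Exp_cst//.
  by apply/funext => w; rewrite /additive_functional big_nil mulr0 addr0.
have lamn : lam ^+ n.+1 = expR (- (vbar / 2)).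
  rewrite -expRM_natl; congr expR.
  rewrite (_ : n.+1%:R * _ = - (vbar * (s ^+ 2 * n.+1%:R) / 2)); last by field.
  by rewrite sn mulr1.
(* The sum with upper index n + 1 starts at 1, hence has only n steps: one factor [lam] is missing
   from exp (- vbar / 2). *)
have e3 : `|lam ^+ n - lam ^+ n.+1| <= C ^+ 2 * s.
  rewrite exprS -[X in `|X - _|]mul1r -mulrBl normrM [X in _ * X]ger0_norm ?exprn_ge0//.
  apply: (@le_trans _ _ (`|1 - lam| * 1)); first by rewrite ler_wpM2l// exprn_ile1.
  rewrite mulr1 ger0_norm ?subr_ge0//.
  have := expR_ge1Dx (- (vbar * s ^+ 2 / 2)); rewrite -/lam => e4.
  apply: (@le_trans _ _ (vbar * s ^+ 2 / 2)); first lra.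
  have : vbar * s ^+ 2 <= C ^+ 2 * s by apply: ler_pM.
  have : 0 <= vbar * s ^+ 2 by rewrite mulr_ge0.
  by move: (vbar * s ^+ 2) (C ^+ 2 * s) => u1 u2; lra.
have e5 : n%:R * (K * s ^+ 3) <= K * s.
  rewrite (_ : _ * (K * s ^+ 3) = (s ^+ 2 * n%:R) * (K * s)); last by ring.
  have sn1 : s ^+ 2 * n%:R <= 1 
    by apply: (@le_trans _ _ (s ^+ 2 * n.+1%:R)); [rewrite ler_wpM2l// ler_nat|rewrite sn].
  by have := ler_wpM2r (mulr_ge0 K0 s0) sn1; rewrite mul1r.
under eq_fun do rewrite addrC.
rewrite -lamn (_ : _ - _ = (Exp Pr (fun w => cos (th + s * additive_functional Y xi n.+1 w)) - a n.+1)
  + (a n.+1 - lam ^+ n * a 1%N) + lam ^+ n * (a 1%N - cos th) + cos th * (lam ^+ n - lam ^+ n.+1)); last by ring.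
have e6 : `|lam ^+ n * (a 1%N - cos th)| <= H * s.
  by rewrite normrM distrC ger0_norm ?exprn_ge0// -[leRHS]mul1r ler_pM ?exprn_ge0// exprn_ile1.
have e7 : `|cos th * (lam ^+ n - lam ^+ n.+1)| <= C ^+ 2 * s.
  by rewrite normrM -[leRHS]mul1r ler_pM// cos_max.
have e8 := le_trans (ak n) e5; have e9 := close n.+1.
rewrite (le_trans (ler_normD _ _))// (le_trans (lerD (ler_normD _ _) (lexx _)))//.
rewrite (le_trans (lerD (lerD (ler_normD _ _) (lexx _)) (lexx _)))//.
rewrite (le_trans (lerD (lerD (lerD e9 e8) e6) e7))//.
by rewrite -!mulrDl ler_wpM2r//; lra.
Qed.

End CenteredFunctional.

Lemma bounded_fin (I : finType) (f : I -> R) : exists2 C, 0 <= C & forall i, `|f i| <= C.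
Proof.
exists (\sum_i `|f i|); first exact: sumr_ge0.
by move=> i; rewrite (bigD1 i)//= lerDl sumr_ge0.
Qed.

Lemma cos_clt (xi : 'I_N -> 'I_N -> R) th : (forall i, \sum_j Q i j * xi i j = 0) ->
  Exp Pr (fun w => cos ((Num.sqrt n%:R)^-1 * additive_functional Y xi n w + th)) @[n --> \oo]
    --> cos th * expR (- (asymptotic_variance xi / 2)).
Proof.
move=> xi0; have [C C0 xiC'] := bounded_fin (fun ij : 'I_N * 'I_N => xi ij.1 ij.2).
have xiC i j : `|xi i j| <= C := xiC' (i, j).
have [|h hh] := @poisson_function (fun i => \sum_j Q i j * xi i j ^+ 2 - asymptotic_variance xi).
  under eq_bigr do rewrite mulrBr.
  by rewrite sumrB -mulr_suml pi1 mul1r subrr.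
have [H H0 hH] := bounded_fin h.
have [D HD] := cos_clt_rate xiC xi0 hh hH th.
have c0 : D * (Num.sqrt n%:R)^-1 @[n --> \oo] --> (0 : R).
  by rewrite -(mulr0 D); apply: cvgM; [exact: cvg_cst|exact: cvg_inv_sqrt].
have c1 : (Num.sqrt n%:R)^-1 * C @[n --> \oo] --> (0 : R).
  by rewrite -(mul0r C); apply: cvgM; [exact: cvg_inv_sqrt|exact: cvg_cst].
apply/cvgrPdist_le => /= e e0; near=> n.
have n0 : (0 < n)%N by near: n; exists 1%N.
have nR : 0 < n%:R :> R by rewrite ltr0n.
rewrite distrC; apply: le_trans (HD n (Num.sqrt n%:R)^-1 n0 _ _ _) _.
- by rewrite invr_ge0 sqrtr_ge0.
- by rewrite exprVn sqr_sqrtr ?ltW// mulVf// gt_eqF.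
- rewrite (le_trans (ler_norm _))// -[X in `|X|]subr0 distrC.
  by near: n; move/cvgrPdist_le : c1; apply.
- rewrite (le_trans (ler_norm _))// -[X in `|X|]subr0 distrC.
  by near: n; move/cvgrPdist_le : c0; apply.
Unshelve. all: by end_near. Qed.

Definition visit_count (i : 'I_N) n w : nat := (\sum_(1 <= k < n) (Y k w == i))%N.

Definition visits_of (i : 'I_N) n (x : {ffun 'I_n.+1 -> 'I_N}) : nat :=
  (\sum_(1 <= k < n) (x (inord k) == i))%N.

Lemma visit_count_path i n w : visit_count i n w = visits_of i (path_of Y n.+1 w).
Proof.
rewrite /visit_count /visits_of big_nat [RHS]big_nat; apply: eq_bigr => k /andP[k0 kn].
by rewrite !ffunE inordK// ltnS ltnW.
Qed.

(** With h solving the Poisson equation for the centred indicator of i, the count minus n pi_i is a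
    martingale up to boundary terms; Chebyshev's inequality uses its second moment, of order n. *)
Lemma occupation_lln i (eta e : R) : 0 < eta -> 0 < e -> \forall n \near \oo,
  prb Pr [set w | eta < `|(visit_count i n w)%:R / n%:R - pi 0 i|] <= e.
Proof.
move=> eta0 e0.
have [|h hh] := @poisson_function (fun j => (j == i)%:R - pi 0 i).
  under eq_bigr do rewrite mulrBr.
  rewrite sumrB -mulr_suml pi1 mul1r (bigD1 i)//= eqxx mulr1 big1 ?addr0 ?subrr// => j /negbTE ->.
  by rewrite mulr0.
have [H H0 hH] := bounded_fin h.
pose xi a b := h b - \sum_j Q a j * h j.
have [C C0 xiC'] := bounded_fin (fun ij : 'I_N * 'I_N => xi ij.1 ij.2).
have xiC a b : `|xi a b| <= C := xiC' (a, b).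
have xi0 a : \sum_j Q a j * xi a j = 0.
  under eq_bigr do rewrite mulrBr.
  by rewrite sumrB -mulr_suml Q1 mul1r subrr.
have p1 : pi 0 i <= 1 by rewrite -pi1 (bigD1 i)//= lerDl sumr_ge0.
(* The boundary terms are h at both ends, at most H each, and one extra pi_i, because the count has
   n - 1 summands. *)
have key n w : (0 < n)%N -> `|(visit_count i n w)%:R - n%:R * pi 0 i| <=
    `|additive_functional Y xi n w| + (H *+ 2 + 1).
  move=> n0; have e1 : (visit_count i n w)%:R - n%:R * pi 0 i =
    additive_functional Y xi n w + (h (Y 1%N w) - h (Y n w) - pi 0 i).
    elim: n n0 => // -[_ _|n IH _].
      by rewrite /visit_count /additive_functional !big_nil; ring.
    rewrite /visit_count /additive_functional !(big_nat_recr n.+1)//= natrD.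
    have := IH isT; rewrite /visit_count /additive_functional.
    have := hh (Y n.+1 w); rewrite -[n.+2%:R]natr1 /xi.
    set c := (\sum_(_ <= _ < _) _)%:R; set S := \sum_(_ <= _ < _) _.
    lra.
  rewrite e1 (le_trans (ler_normD _ _))// lerD2l (le_trans (ler_normB _ _))// lerD//.
    by rewrite (le_trans (ler_normB _ _))// mulr2n lerD.
  by rewrite ger0_norm.
pose g n (x : {ffun 'I_n.+1 -> 'I_N}) := (\sum_(1 <= k < n) xi (x (inord k)) (x (inord k.+1))) ^+ 2.
have gE n : g n \o path_of Y n.+1 = (fun w => additive_functional Y xi n w ^+ 2).
  by apply/funext => w; rewrite /g/= -additive_functional_path.
near=> n'; have [n n'E] : exists n, n' = n.+1.
  by exists n'.-1; rewrite prednK//; near: n'; exists 1%N.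
have nR : 0 < n.+1%:R :> R by rewrite ltr0n.
(* The boundary terms take at most half of the deviation, which leaves the other half to the
   martingale and explains the 4 in [small]. *)
have big : (H *+ 2 + 1) <= eta * n.+1%:R / 2.
  rewrite ler_pdivlMr// -ler_pdivrMl// -n'E (le_trans (ltW (truncnS_gt _)))// ler_nat.
  by near: n'; exact: nbhs_infty_ge.
have small : C ^+ 2 * 4 / eta ^+ 2 * (n.+1%:R)^-1 <= e.
  rewrite ler_pdivrMr// [leRHS]mulrC -ler_pdivrMr// -n'E (le_trans (ltW (truncnS_gt _)))// ler_nat.
  by near: n'; exact: nbhs_infty_ge.
rewrite n'E; pose a := (eta * n.+1%:R / 2) ^+ 2.
have a0 : 0 < a by rewrite exprn_gt0// divr_gt0// mulr_gt0.
have mS := finval_path hY (n := n.+2).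
apply: (@le_trans _ _ (prb Pr (path_of Y n.+2 @^-1` [set x | a < g n.+1 x]))).
  apply: prb_le.
  - rewrite (_ : [set _ | _] = path_of Y n.+2 @^-1` [set x |
      eta < `|(visits_of i x)%:R / n.+1%:R - pi 0 i|]); first exact: finval_set.
    by apply/seteqP; split => w; rewrite /= visit_count_path.
  - exact: finval_set.
  - move=> w /= hw; rewrite -[g _ _]/((g n.+1 \o path_of Y n.+2) w) gE.
    have b0 : 0 <= eta * n.+1%:R / 2 by rewrite divr_ge0// mulr_ge0// ltW.
    rewrite -[ltRHS]real_normK ?num_real// ltr_pXn2r ?nnegrE//.
    have := key n.+1 w isT.
    have : eta * n.+1%:R < `|(visit_count i n.+1 w)%:R - n.+1%:R * pi 0 i|.
      rewrite -ltr_pdivlMr// -[X in _ / X](ger0_norm (ltW nR)) -normf_div mulrBl.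
      by rewrite mulrAC divff ?mul1r// gt_eqF.
    by rewrite -/a; lra.
apply: le_trans (prb_markov Pr mS (g := g n.+1) (fun x => sqr_ge0 _) a0) _.
rewrite -/(g n.+1 \o path_of Y n.+2) gE ler_pdivrMr//.
apply: le_trans (@second_moment_additive xi C n.+1 isT xiC xi0) _.
apply: le_trans (ler_wpM2r (ltW a0) small).
rewrite le_eqVlt; apply/orP; left; apply/eqP; rewrite /a; field.
by rewrite (gt_eqF eta0) gt_eqF.
Unshelve. all: by end_near. Qed.

End ChainCLT.

(** * Powers of matrices close to a primitive stochastic matrix *)

(** The least positive difference d between two elements divides every element, hence is 1; two
    consecutive elements a and a + 1 then represent every m >= a^2. *)
Lemma numerical_semigroup (S : nat -> Prop) : S 0%N ->
  (forall a b, S a -> S b -> S (a + b)%N) ->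
  (forall g, (forall k, (0 < k)%N -> S k -> (g %| k)%N) -> g = 1%N) ->
  exists m0, forall m, (m0 <= m)%N -> S m.
Proof.
move=> S0 SD Sgcd.
have SM q a : S a -> S (q * a)%N by move=> Sa; elim: q => // q IH; rewrite mulSn; exact: SD.
pose D d := (0 < d)%N /\ exists2 a, S a & S (a + d)%N.
have exD : exists d, `[< D d >].
  have [k [k0 Sk]] : exists k, (0 < k)%N /\ S k.
    apply: contrapT => nex; have := Sgcd 0%N; suff: forall k, (0 < k)%N -> S k -> (0 %| k)%N.
      by move=> h /(_ h).
    by move=> k k0 Sk; exfalso; apply: nex; exists k.
  by exists k; apply/asboolP; split => //; exists 0%N.
case: (ex_minnP exD) => d /asboolP[d0 [a Sa Sad]] dmin.
have d1 : d = 1%N.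
  apply: Sgcd => k k0 Sk; rewrite /dvdn; apply: contrapT => /negP; rewrite -lt0n => r0.
  have : (d <= k %% d)%N.
    (* With q the quotient of k by d, the elements q (a + d) and q a + k differ by the remainder,
       which would be a smaller positive difference. *)
    apply: dmin; apply/asboolP; split => //; exists (k %/ d * (a + d))%N; first exact: SM.
    rewrite mulnDr -addnA -divn_eq addnC; apply: SD => //; exact: SM.
  by rewrite leqNgt ltn_mod d0.
move: Sad; rewrite {}d1 addn1 => Sa1.
exists (a * a)%N => m am; have [a0|a0] := posnP a.
  by rewrite a0 in Sa1; have := SM m 1%N Sa1; rewrite muln1.
have rq : (m %% a <= m %/ a)%N by rewrite (leq_trans (ltnW (ltn_pmod m a0)))// leq_divRL.
rewrite (_ : m = ((m %/ a - m %% a) * a + m %% a * a.+1)%N); first by apply: SD; exact: SM.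
by rewrite mulnS addnCA -mulnDl subnK// addnC -divn_eq.
Qed.

Section NonnegativeMatrices.
Context {R : realType} {N : nat}.
Implicit Types (P M : 'M[R]_N).

Lemma mul_ge0_entry P M : (forall i j, 0 <= P i j) -> (forall i j, 0 <= M i j) ->
  forall i j, 0 <= (P * M) i j.
Proof. by move=> P0 M0 i j; rewrite mxE sumr_ge0// => k _; rewrite mulr_ge0. Qed.

Lemma exp_ge0_entry P k : (forall i j, 0 <= P i j) -> forall i j, 0 <= (P ^+ k) i j.
Proof.
move=> P0; elim: k => [|k IH] i j; first by rewrite expr0 mxE ler0n.
by rewrite exprS; exact: mul_ge0_entry.
Qed.

Lemma mul_entry_ge P M i k j : (forall i j, 0 <= P i j) -> (forall i j, 0 <= M i j) ->
  P i k * M k j <= (P * M) i j.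
Proof.
move=> P0 M0; rewrite mxE (bigD1 k)//= lerDl sumr_ge0// => l _; exact: mulr_ge0.
Qed.

(** The return times to a state form a numerical semigroup, whose gcd is 1 by aperiodicity; finitely
    many states allow common bounds on return and connection times. *)
Lemma primitive_of_aperiodic P : stochastic_mx P -> irreducible_mx P -> aperiodic_mx P ->
  exists m0, forall m, (m0 <= m)%N -> forall i j, 0 < (P ^+ m) i j.
Proof.
move=> [P0 P1] irr aper; have P0k k := exp_ge0_entry k P0.
have /choice[s Hs] : forall i, exists s, forall m, (s <= m)%N -> 0 < (P ^+ m) i i.
  move=> i; apply: (numerical_semigroup (S := fun k => 0 < (P ^+ k) i i)).
  - by rewrite expr0 mxE eqxx ltr01.
  - move=> a b Sa Sb; rewrite exprD; apply: lt_le_trans (mul_entry_ge i i i (P0k a) (P0k b)).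
    exact: mulr_gt0.
  - by move=> g Hg; apply: (aper i g) => k k0 Pk; exact: Hg.
have /choice[t Ht] : forall ij : 'I_N * 'I_N, exists k : nat, 0 < (P ^+ k) ij.1 ij.2.
  by move=> [i j]; exact: irr.
exists (\max_ij t ij + \max_i s i)%N => m mm i j.
have tm : (t (i, j) <= \max_ij t ij)%N by exact: (leq_bigmax (i, j)).
have sm : (s i <= \max_i s i)%N by exact: leq_bigmax.
rewrite -(@subnK (t (i, j)) m); last by rewrite (leq_trans tm)// (leq_trans _ mm)// leq_addr.
rewrite exprD; apply: lt_le_trans (mul_entry_ge i i j (P0k _) (P0k _)).
apply: mulr_gt0; last exact: (Ht (i, j)).
apply: Hs; rewrite (leq_trans sm)// leq_subRL; last by rewrite (leq_trans tm)// (leq_trans _ mm)// leq_addr.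
by rewrite (leq_trans _ mm)// leq_add2r.
Qed.

(** A bound on the operator norm for the sup norm, kept as a predicate: bounds multiply, and a
    stochastic matrix has bound 1, so powers of P cost nothing. *)
Definition rowbound M (c : R) := forall i, \sum_j `|M i j| <= c.

Lemma rowbound_entry M c i j : rowbound M c -> `|M i j| <= c.
Proof. by move=> /(_ i); apply: le_trans; rewrite (bigD1 j)//= lerDl sumr_ge0. Qed.

Lemma rowbound_ge0 M c (i : 'I_N) : rowbound M c -> 0 <= c.
Proof. by move=> /(_ i); apply: le_trans; rewrite sumr_ge0. Qed.

Lemma rowboundM M P a b : rowbound M a -> rowbound P b -> rowbound (M * P) (a * b).
Proof.
move=> Ma Pb i; apply: (@le_trans _ _ (\sum_j \sum_k `|M i k| * `|P k j|)).
  apply: ler_sum => j _; rewrite mxE (le_trans (ler_norm_sum _ _ _))//.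
  by apply: ler_sum => k _; rewrite normrM.
rewrite exchange_big/=; apply: (@le_trans _ _ (\sum_k `|M i k| * b)).
  by apply: ler_sum => k _; rewrite -mulr_sumr ler_wpM2l.
by rewrite -mulr_suml ler_wpM2r// (rowbound_ge0 i Pb).
Qed.

Lemma rowboundD M P a b : rowbound M a -> rowbound P b -> rowbound (M + P) (a + b).
Proof.
move=> Ma Pb i; apply: le_trans (lerD (Ma i) (Pb i)); rewrite -big_split/=.
by apply: ler_sum => j _; rewrite mxE ler_normD.
Qed.

Lemma rowboundN M a : rowbound M a -> rowbound (- M) a.
Proof. by move=> Ma i; under eq_bigr do rewrite mxE normrN. Qed.

Lemma rowbound0 a : 0 <= a -> rowbound 0 a.
Proof. by move=> a0 i; rewrite big1// => j _; rewrite mxE normr0. Qed.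

Lemma rowbound_sum (I : Type) (r : seq I) (F : I -> 'M[R]_N) (b : I -> R) :
  (forall i, 0 <= b i) -> (forall i, rowbound (F i) (b i)) ->
  rowbound (\sum_(i <- r) F i) (\sum_(i <- r) b i).
Proof.
move=> b0 Fb; elim: r => [|i r IH]; first by rewrite !big_nil; exact: rowbound0.
by rewrite !big_cons; exact: rowboundD.
Qed.

Lemma rowbound_le M a b : a <= b -> rowbound M a -> rowbound M b.
Proof. by move=> ab Ma i; exact: le_trans ab. Qed.

Lemma rowbound1 : rowbound 1 1.
Proof.
move=> i; rewrite (bigD1 i)//= big1 ?addr0 ?mxE ?eqxx ?normr1// => j ji.
by rewrite mxE eq_sym (negbTE ji) normr0.
Qed.

Lemma rowboundX M a k : rowbound M a -> rowbound (M ^+ k) (a ^+ k).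
Proof.
move=> Ma; elim: k => [|k IH]; first by rewrite !expr0; exact: rowbound1.
by rewrite !exprS; exact: rowboundM.
Qed.

Lemma rowbound_stochastic P : stochastic_mx P -> rowbound P 1.
Proof. by move=> [P0 P1] i; rewrite -(P1 i); apply: ler_sum => j _; rewrite ger0_norm. Qed.

Lemma rowboundX_stochastic P k : stochastic_mx P -> rowbound (P ^+ k) 1.
Proof. by move=> /rowbound_stochastic/(rowboundX k); rewrite expr1n. Qed.

Lemma stochastic_mulmx1 P : stochastic_mx P -> P *m const_mx 1 = const_mx 1 :> 'cV[R]_N.
Proof.
move=> sP; apply/matrixP => a b; rewrite mxE [RHS]mxE -[RHS](sP.2 a).
by apply: eq_bigr => c _; rewrite mxE mulr1.
Qed.

Lemma exprB_telescope P M k :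
  M ^+ k - P ^+ k = \sum_(1 <= j < k.+1) P ^+ (k - j) * (M - P) * M ^+ j.-1.
Proof.
elim: k => [|k IH]; first by rewrite !expr0 subrr big_nil.
rewrite big_nat_recr//= subnn expr0 mul1r.
rewrite big_nat (eq_bigr (fun j => P * (P ^+ (k - j) * (M - P) * M ^+ j.-1))); last first.
  by move=> j /andP[_ jk]; rewrite subSn// exprS !mulrA.
rewrite -big_nat -mulr_sumr -IH !exprS mulrBr mulrBl [in RHS]addrC addrA subrK.
by [].
Qed.

(** Each of the k telescoped terms has a power of P on the left, of norm at most 1, and a power of M
    on the right, bounded by [c k] thanks to monotonicity. *)
Lemma rowbound_exprB P M (c : nat -> R) (dl : R) k : stochastic_mx P ->
  (forall l, rowbound (M ^+ l) (c l)) -> {homo c : a b / (a <= b)%N >-> a <= b} ->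
  rowbound (M - P) dl -> (0 <= dl) -> rowbound (M ^+ k - P ^+ k) (dl * (k%:R * c k)).
Proof.
move=> sP Mc cm MP dl0; rewrite exprB_telescope => i.
have c0 l : 0 <= c l by exact: (rowbound_ge0 i (Mc l)).
rewrite [leRHS](_ : _ = \sum_(1 <= j < k.+1) 1 * dl * c k); last first.
  by rewrite sumr_const_nat subn1/= mul1r -[RHS]mulr_natl mulrCA.
have h : rowbound (\sum_(1 <= j < k.+1) P ^+ (k - j) * (M - P) * M ^+ j.-1)
    (\sum_(1 <= j < k.+1) 1 * dl * c j.-1).
  apply: rowbound_sum => [j|j]; first by rewrite mul1r mulr_ge0.
  by apply: rowboundM => //; apply: rowboundM => //; exact: rowboundX_stochastic.
apply: le_trans (h i) _; rewrite big_nat [leRHS]big_nat; apply: ler_sum => j /andP[_ jk].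
by rewrite ler_wpM2l ?mul1r// cm// (leq_trans (leq_pred _)).
Qed.

End NonnegativeMatrices.

Section PowersNearStochastic.
Context {R : realType} {N : nat}.
Implicit Types (P M : 'M[R]_N) (mu : probability nat R).

Lemma rowbound_near P M (dl : R) : stochastic_mx P -> rowbound (M - P) dl -> rowbound M (1 + dl).
Proof.
move=> sP MP; rewrite -(subrK P M) addrC; apply: rowboundD => //.
exact: rowbound_stochastic.
Qed.

Lemma exprB_near P (e : R) t : stochastic_mx P -> 0 < e ->
  exists2 dl : R, 0 < dl & forall M, rowbound (M - P) dl -> rowbound (M ^+ t - P ^+ t) e.
Proof.
move=> sP e0; have h0 : 0 < t%:R * 2 ^+ t + 1 + e :> R.
  by rewrite ltr_wpDl// addr_ge0// mulr_ge0// ?exprn_ge0.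
(* The summand e forces dl <= 1, so that M has norm at most 2, and the summand t 2^t absorbs the
   telescoping bound. *)
exists (e / (t%:R * 2 ^+ t + 1 + e)); first by rewrite divr_gt0.
set dl := e / _ => M MP; have dl0 : 0 <= dl by rewrite divr_ge0 ?ltW.
have dl1 : dl <= 1 by rewrite ler_pdivrMr// mul1r lerDr addr_ge0// mulr_ge0// exprn_ge0.
have := @rowbound_exprB R N P M (fun l => 2 ^+ l) dl t sP.
have M2 : rowbound M 2.
  by apply: rowbound_le (rowbound_near sP MP); rewrite [leRHS](_ : 2 = 1 + 1)// lerD2l.
move=> /(_ (fun l => rowboundX l M2)) h; apply: rowbound_le (h _ MP dl0).
  rewrite /dl mulrAC ler_pdivrMr// ler_pM2l// -addrA lerDl; apply: addr_ge0 => //; exact: ltW.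
by move=> a b ab; rewrite ler_weXn2l// ler1n.
Qed.

Lemma mulmx_gt0_entry P M : (forall i j, 0 < P i j) -> (forall i j, 0 < M i j) ->
  forall i j, 0 < (P * M) i j.
Proof.
move=> P0 M0 i j; apply: lt_le_trans (mul_entry_ge i i j _ _); first exact: mulr_gt0.
  by move=> *; exact: ltW.
by move=> *; exact: ltW.
Qed.

(** Every exponent >= m is a multiple of m plus an exponent of the window [m, 2m). Positivity of all
    large powers thus reduces to finitely many conditions, stable under perturbation. *)
Lemma exp_gt0_entry M m : (0 < m)%N ->
  (forall t, (m <= t < m + m)%N -> forall i j, 0 < (M ^+ t) i j) ->
  forall l, (m <= l)%N -> forall i j, 0 < (M ^+ l) i j.
Proof.
move=> m0 Mt; elim/ltn_ind => l IH ml; have [lm|ml2] := ltnP l (m + m)%N.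
  by apply: Mt; rewrite ml.
rewrite -(subnKC ml) exprD; apply: mulmx_gt0_entry.
  by apply: Mt; rewrite leqnn -[ltnLHS]addn0 ltn_add2l.
by apply: IH; lia.
Qed.

(** By nonnegativity the entry (i, j) of M^(L + l) is at least (M^L)_ii (M^l)_ij, so L steps
    multiply an entry by at least e = th^L, with th = exp (1 / L). [K] starts the induction on the
    window [m, m + L), and [K'] covers the exponents below m, where entries may be negative. *)
Lemma geometric_growth M m L : (0 < L)%N ->
  (forall l, (m <= l)%N -> forall i j, 0 < (M ^+ l) i j) ->
  (forall i j, expR 1 <= (M ^+ L) i j) ->
  exists th K K' : R, [/\ 1 < th, 0 <= K &
    forall l i j, th ^+ l <= K * (M ^+ l) i j + K'].
Proof.
move=> L0 Mp ML; pose th : R := expR L%:R^-1.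
have th1 : 1 < th by rewrite /th expR_gt1 invr_gt0 ltr0n.
have thL : th ^+ L = expR 1 by rewrite /th -expRM_natl mulrV// unitfE pnatr_eq0 -lt0n.
have th0 l : 0 <= th ^+ l by rewrite exprn_ge0// ltW// (lt_trans _ th1).
pose K := \sum_(l < m + L) \sum_i \sum_j th ^+ l / `|(M ^+ l) i j|.
have K0 : 0 <= K by rewrite !sumr_ge0// => l _; rewrite sumr_ge0// => i _; rewrite sumr_ge0// => j _; rewrite divr_ge0.
have KM l : (m <= l)%N -> forall i j, th ^+ l <= K * (M ^+ l) i j.
  elim/ltn_ind: l => l IH ml i j; have [lm|ml2] := ltnP l (m + L)%N.
    rewrite -ler_pdivrMr; last exact: Mp.
    rewrite /K (bigD1 (Ordinal lm))//= (bigD1 i)//= (bigD1 j)//= gtr0_norm; last exact: Mp.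
    rewrite -!addrA lerDl !addr_ge0//; do 3? (apply: sumr_ge0 => ? _); by rewrite divr_ge0.
  have -> : l = (L + (l - L))%N by lia.
  have lL : (m <= l - L)%N by lia.
  rewrite !exprD thL; apply: le_trans (_ : K * ((M ^+ L) i i * (M ^+ (l - L)) i j) <= _).
    by rewrite [leRHS]mulrCA; apply: ler_pM => //; apply: IH => //; lia.
  rewrite ler_wpM2l//; apply: mul_entry_ge => a b; last by rewrite ltW// Mp.
  by rewrite (le_trans _ (ML a b))// expR_ge0.
exists th, K, (th ^+ m + \sum_(l < m) \sum_i \sum_j K * `|(M ^+ l) i j|); split => // l i j.
have [ml|lm] := leqP m l.
  rewrite (le_trans (KM l ml i j))// lerDl addr_ge0// !sumr_ge0// => ? _.
  by do 2 (apply: sumr_ge0 => ? _); rewrite mulr_ge0.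
apply: (@le_trans _ _ (th ^+ m)); first by apply: ler_weXn2l; [exact: ltW | exact: ltnW].
rewrite addrCA lerDl (bigD1 (Ordinal lm))//= (bigD1 i)//= (bigD1 j)//= -!addrA addrA.
rewrite addr_ge0//; first by rewrite -mulrDr mulr_ge0// -lerBlDl sub0r -normrN ler_norm.
by rewrite !addr_ge0//; do 3? (apply: sumr_ge0 => ? _); rewrite mulr_ge0.
Qed.

Lemma mass_ge0 mu l : 0 <= mass mu l.
Proof. by rewrite fine_ge0. Qed.

Lemma sum_mass_le1 mu n : \sum_(0 <= l < n) mass mu l <= 1.
Proof.
rewrite /mass -lee_fin -sumEFin.
rewrite (eq_bigr (fun l => mu [set l])); last by move=> l _; rewrite fineK// fin_num_measure.
rewrite big_mkord -(@measure_bigsetU _ _ _ mu)//; first exact: probability_le1.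
by apply/trivIsetP => a b _ _ ab; rewrite -subset0 => x [/= -> /= ab']; rewrite ab' eqxx in ab.
Qed.

Lemma cvgn_G_series_bounded mu M i j : cvgn (G_series mu M) ->
  exists C : R, forall n, \sum_(0 <= l < n) mass mu l * (M ^+ l) i j <= C.
Proof.
move=> cG; have : cvgn (fun n => G_series mu M n i j).
  apply/cvg_ex; exists (limn (G_series mu M) i j).
  exact: (cvg_comp _ _ cG (@coord_continuous _ _ _ i j (limn (G_series mu M)))).
move=> /cvg_seq_bounded/bounded_fun_has_ubound[C HC]; exists C => n.
apply: HC; exists n => //; rewrite /G_series seriesEnat/= summxE.
by apply: eq_bigr => l _; rewrite mxE.
Qed.

Section MomentBound.
Variables (P : 'M[R]_N) (mu : probability nat R).
Hypotheses (sP : stochastic_mx P) (irrP : irreducible_mx P) (aperP : aperiodic_mx P).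
Hypothesis mom : exists C : R, forall n, \sum_(0 <= l < n) mass mu l * l%:R <= C.

(** With s = sqrt th, a matrix at distance s - 1 from P has norm at most s; as l (s - 1) <= s^l, the
    quantity l s^l is at most th^l / (s - 1). *)
Lemma powers_bounded_small_radius (th : R) : 1 < th ->
  (exists C : R, forall n, \sum_(0 <= l < n) mass mu l * th ^+ l <= C) ->
  exists (dl : R) (c : nat -> R), [/\ 0 < dl, {homo c : a b / (a <= b)%N >-> a <= b},
    forall M, rowbound (M - P) dl -> forall l, rowbound (M ^+ l) (c l) &
    exists C : R, forall n, \sum_(0 <= l < n) mass mu l * (l%:R * c l) <= C].
Proof.
move=> th1 [C HC]; pose s := Num.sqrt th.
have s1 : 1 < s by rewrite -sqrtr1 ltr_sqrt// (lt_trans _ th1).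
have ss : s * s = th by rewrite -expr2 sqr_sqrtr// ltW// (lt_trans _ th1).
exists (s - 1), (fun l => s ^+ l); split.
- by rewrite subr_gt0.
- by move=> a b ab; rewrite ler_weXn2l// ltW.
- by move=> M MP l; apply: rowboundX; have := rowbound_near sP MP; rewrite addrC subrK.
exists ((s - 1)^-1 * C) => n; rewrite mulrC ler_pdivlMr ?subr_gt0//.
apply: le_trans (HC n); rewrite mulr_suml; apply: ler_sum => l _.
rewrite -mulrA ler_wpM2l ?mass_ge0// -ss exprMn mulrAC ler_wpM2r//.
  by rewrite exprn_ge0// ltW// (lt_trans _ s1).
elim: l => [|l IH]; first by rewrite mul0r.
rewrite -natr1 mulrDl mul1r exprS.
have : 1 <= s ^+ l by rewrite exprn_ege1// ltW.
nra.
Qed.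

(** The majorant [c] must serve all admissible M near P at once and be summable against l mu(l);
    when the radius is 1 it is a constant, for which the first moment suffices. *)
Lemma powers_bounded_near :
  exists (dl : R) (c : nat -> R), [/\ 0 < dl, {homo c : a b / (a <= b)%N >-> a <= b},
    forall M, rowbound (M - P) dl -> M *m const_mx 1 = const_mx 1 :> 'cV[R]_N \/ cvgn (G_series mu M) ->
      forall l, rowbound (M ^+ l) (c l) &
    exists C : R, forall n, \sum_(0 <= l < n) mass mu l * (l%:R * c l) <= C].
Proof.
have [[th [th1 HC]]|noth] := pselect (exists th : R, 1 < th /\
    exists C : R, forall n, \sum_(0 <= l < n) mass mu l * th ^+ l <= C).
  have [dl [c [dl0 cm Mc HC']]] := powers_bounded_small_radius th1 HC.
  by exists dl, c; split => // M MP _; exact: Mc.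
have [m [m0 Pm]] : exists m, (0 < m)%N /\ forall t, (m <= t)%N -> forall i j, 0 < (P ^+ t) i j.
  have [m Pm] := primitive_of_aperiodic sP irrP aperP; exists m.+1; split => // t mt.
  by apply: Pm; exact: ltnW.
have [c c0 Pc] : exists2 c : R, 0 < c & forall t, (m <= t < m + m)%N -> forall i j, c + c <= (P ^+ t) i j.
  (* The inverse of a sum of inverses is a lower bound for all entries over the window; halving it
     leaves a margin c for the perturbation. *)
  pose Z := \sum_(t < m + m) \sum_i \sum_j `|(P ^+ t) i j|^-1 + 1.
  have Z0 : 0 < Z.
    by rewrite ltr_wpDl// !sumr_ge0// => ? _; do 2 (apply: sumr_ge0 => ? _); rewrite invr_ge0.
  exists ((Z + Z)^-1); first by rewrite invr_gt0 addr_gt0.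
  move=> t /andP[mt tm] i j; rewrite -mulr2n -[_ *+ 2]mulr_natr -[Z + Z]mulr2n -[Z *+ 2]mulr_natr.
  rewrite invfM -mulrA mulVf// mulr1 invf_ple ?posrE ?Pm//.
  rewrite /Z (bigD1 (Ordinal tm))//= (bigD1 i)//= (bigD1 j)//= gtr0_norm ?Pm//.
  rewrite -!addrA lerDl !addr_ge0//; do 3? (apply: sumr_ge0 => ? _); by rewrite invr_ge0.
have /choice[dlt Hdlt] : forall t : 'I_(m + m), exists dl : R, 0 < dl /\ forall M, rowbound (M - P) dl -> rowbound (M ^+ t - P ^+ t) c.
  by move=> t; have [dl dl0 H] := exprB_near t sP c0; exists dl.
pose dl := \big[Num.min/1]_t dlt t.
have dl0 : 0 < dl by apply: lt_bigmin => // t _; case: (Hdlt t).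
have dl1 : dl <= 1 by exact: bigmin_le_id.
have Mpos M : rowbound (M - P) dl -> forall t, (m <= t < m + m)%N -> forall i j, c <= (M ^+ t) i j.
  move=> MP t /andP[mt tm] i j.
  have /rowbound_entry : rowbound (M ^+ t - P ^+ t) c.
    apply: (Hdlt (Ordinal tm)).2; apply: rowbound_le MP; exact: bigmin_le_cond.
  move=> /(_ i j); rewrite ler_norml !mxE => /andP[+ _].
  by have := @Pc t; rewrite mt tm => /(_ isT i j); lra.
have Mgt0 M : rowbound (M - P) dl -> forall l, (m <= l)%N -> forall i j, 0 < (M ^+ l) i j.
  move=> MP; apply: exp_gt0_entry => // t tm i j; apply: lt_le_trans (Mpos _ MP _ tm i j); exact: c0.
(* An entry (i, j) of M^l above e / c^2 makes all entries of M^(m + l + m) at least e: paths go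
   through i and j, with factors c on both sides. When the rows sum to 1, the entries of a positive
   power are at most 1 <= D. *)
pose D := expR 1 / (c * c) + 1.
exists dl, (fun=> 2 ^+ m + N%:R * D); split => //.
  move=> M MP good l.
  have [lm|ml] := ltnP l m.
    have M2 : rowbound M 2.
      by apply: rowbound_le (rowbound_near sP MP); rewrite [leRHS](_ : 2 = 1 + 1)// lerD2l.
    apply: rowbound_le (rowboundX l M2); apply: (@le_trans _ _ (2 ^+ m)).
      by rewrite ler_weXn2l ?ler1n// ltnW.
    by rewrite lerDl mulr_ge0// addr_ge0// divr_ge0 ?expR_ge0// ltW// mulr_gt0.
  have Mpl := Mgt0 _ MP.
  suff Ml : forall i j, (M ^+ l) i j <= D.
    apply: rowbound_le (_ : rowbound _ (N%:R * D)); first by rewrite lerDr exprn_ge0.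
    move=> i; rewrite mulr_natl -[X in _ *+ X]card_ord -sumr_const; apply: ler_sum => j _.
    by rewrite gtr0_norm// Mpl.
  case: good => [M1|cG] i j.
    have Ml1 : forall k, M ^+ k *m const_mx 1 = const_mx 1 :> 'cV[R]_N.
      elim=> [|k IH]; first by rewrite expr0 mul1mx.
      by rewrite exprS -mulmxA IH M1.
    have /matrixP/(_ i 0) := Ml1 l; rewrite !mxE; under eq_bigr do rewrite mxE mulr1.
    rewrite (bigD1 j)//= => Hs; apply: (@le_trans _ _ 1).
      by rewrite -[leRHS]Hs lerDl sumr_ge0// => k _; rewrite ltW// Mpl.
    by rewrite lerDr divr_ge0 ?expR_ge0// ltW// mulr_gt0.
  (* Geometric growth of the entry (i, j), compared with the convergent series at M, bounds the sums
     of mu(k) th^k, against [noth]. *)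
  rewrite leNgt; apply/negP => big; apply: noth.
  have [|a b|th [K [K' [th1 K0 HK]]]] := @geometric_growth M m (m + l + m) _ Mpl.
  - by rewrite -addnA ltn_addr.
  - rewrite -[X in X <= _](_ : c * (expR 1 / (c * c)) * c = _); last by field; rewrite gt_eqF.
    have Mm := Mpos _ MP m; rewrite leqnn -[ltnLHS]addn0 ltn_add2l m0 in Mm.
    have M0 k : (m <= k)%N -> forall i j, 0 <= (M ^+ k) i j by move=> mk ? ?; rewrite ltW// Mpl.
    rewrite !exprD; apply: le_trans (mul_entry_ge a j b _ _); last 2 first.
    + by apply: mul_ge0_entry; exact: M0.
    + exact: M0.
    have cc0 : 0 <= expR 1 / (c * c) by rewrite divr_ge0 ?expR_ge0// mulr_ge0// ltW.
    apply: ler_pM; rewrite ?(mulr_ge0 (ltW c0) cc0)// ?(ltW c0)//; last exact: Mm.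
    apply: le_trans (mul_entry_ge a i j _ _); last 2 first.
    + exact: M0.
    + exact: M0.
    apply: ler_pM => //; rewrite ?(ltW c0)//; first exact: Mm.
    by apply: le_trans (ltW big); rewrite lerDl.
  exists th; split => //.
  have [C HC] := cvgn_G_series_bounded i j cG.
  exists (K * C + `|K'|) => n.
  apply: (@le_trans _ _ (\sum_(0 <= k < n) (K * (mass mu k * (M ^+ k) i j) + mass mu k * `|K'|))).
    apply: ler_sum => k _; rewrite mulrCA -mulrDr ler_wpM2l ?mass_ge0//.
    by apply: le_trans (HK k i j) _; rewrite lerD2l ler_norm.
  rewrite big_split/= -mulr_sumr -mulr_suml lerD// ?ler_wpM2l//.
  by rewrite -[leRHS]mul1r ler_wpM2r// sum_mass_le1.
have [C HC] := mom; exists (C * (2 ^+ m + N%:R * D)) => n.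
rewrite (eq_bigr _ (fun l _ => mulrA _ _ _)) -mulr_suml ler_wpM2r//.
by rewrite addr_ge0 ?exprn_ge0// mulr_ge0// addr_ge0// divr_ge0 ?expR_ge0// ltW// mulr_gt0.
Qed.

End MomentBound.

End PowersNearStochastic.

(** * First-order expansion of the matrix power series *)

Section MatrixLimits.
Context {R : realType}.

Lemma cvg_mx (T : Type) (F : set_system T) {FF : Filter F} m n (u : T -> 'M[R]_(m, n)) (l : 'M[R]_(m, n)) :
  (forall i j, u x i j @[x --> F] --> l i j) -> u x @[x --> F] --> l.
Proof.
move=> h A [Pn Pl sPA]; rewrite nbhs_filterE/= /fmap/=.
have : \forall x \near F, forall ij : 'I_m * 'I_n, Pn ij.1 ij.2 (u x ij.1 ij.2).
  by apply: filter_forall => -[i j]; exact: h (Pl i j).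
by apply: filterS => x Hx; apply: sPA => i j; exact: (Hx (i, j)).
Qed.

Lemma cvg_mx_entry (T : Type) (F : set_system T) {FF : Filter F} m n (u : T -> 'M[R]_(m, n)) (l : 'M[R]_(m, n)) i j :
  u x @[x --> F] --> l -> u x i j @[x --> F] --> l i j.
Proof. by move=> ul; exact: (cvg_comp _ _ ul (@coord_continuous _ _ _ i j l)). Qed.

Arguments cvg_mx_entry {T F FF m n u l} i j.

Lemma cvg_mulmx (T : Type) (F : set_system T) {FF : Filter F} m n p
    (u : T -> 'M[R]_(m, n)) (v : T -> 'M[R]_(n, p)) (a : 'M[R]_(m, n)) (b : 'M[R]_(n, p)) :
  u x @[x --> F] --> a -> v x @[x --> F] --> b -> (u x *m v x) @[x --> F] --> a *m b.
Proof.
move=> ua vb; apply: cvg_mx => i j; rewrite mxE.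
under eq_cvg do rewrite mxE.
apply: (@cvg_sumr R R^o) => k; apply: cvgM; exact: cvg_mx_entry.
Qed.

Lemma cvg_mxB (T : Type) (F : set_system T) {FF : Filter F} m n
    (u v : T -> 'M[R]_(m, n)) (a b : 'M[R]_(m, n)) :
  u x @[x --> F] --> a -> v x @[x --> F] --> b -> (u x - v x) @[x --> F] --> a - b.
Proof.
move=> ua vb; apply: cvg_mx => i j; rewrite mxE [(- b) i j]mxE.
under eq_cvg do rewrite mxE [(- v _) i j]mxE.
by apply: (@cvgB _ R^o); exact: cvg_mx_entry.
Qed.

Lemma cvg_unique_mx m n (u : nat -> 'M[R]_(m, n)) (a b : 'M[R]_(m, n)) :
  u k @[k --> \oo] --> a -> u k @[k --> \oo] --> b -> a = b.
Proof.
move=> ua ub; apply/matrixP => i j; rewrite -(cvg_lim (@Rhausdorff R) (cvg_mx_entry i j ua)).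
by rewrite -(cvg_lim (@Rhausdorff R) (cvg_mx_entry i j ub)).
Qed.

Lemma tail_small (a : nat -> R) (C e : R) : (forall k, 0 <= a k) ->
  (forall n, \sum_(0 <= k < n) a k <= C) -> 0 < e ->
  exists K, forall n, \sum_(K <= k < n) a k <= e.
Proof.
move=> a0 aC e0.
have nd : nondecreasing_seq (series a) by apply/nondecreasing_series => k _.
have cs : cvgn (series a).
  by apply: nondecreasing_is_cvgn => //; exists C => _ [n _ <-]; rewrite seriesEnat/=.
have /cvgrPdist_le/(_ _ e0)[K _ HK] := cs.
exists K => n; have [nK|Kn] := leqP n K; first by rewrite big_geq// ltW.
have := HK K (leqnn K); rewrite ler_norml => /andP[_]; apply: le_trans.
have -> : \sum_(K <= k < n) a k = series a n - series a K.
  by rewrite !seriesEnat/= (@big_cat_nat _ _ _ K 0 n)//=; [rewrite addrAC subrr add0r|exact: ltnW].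
by rewrite lerB// nondecreasing_cvgn_le.
Qed.

Lemma is_cvg_series_mx m n (u : nat -> 'M[R]_(m, n)) :
  (forall i j, exists C : R, forall N, \sum_(0 <= k < N) `|u k i j| <= C) -> cvgn (series u).
Proof.
move=> hC; have h i j : cvgn (fun n => series u n i j).
  have -> : (fun n => series u n i j) = series (fun k => u k i j).
    by apply/funext => k; rewrite !seriesEnat/= summxE.
  apply: (@normed_cvg _ R^o); have [C HC] := hC i j.
  apply: nondecreasing_is_cvgn; first by apply/nondecreasing_series => k _ _; exact: normr_ge0.
  by exists C => _ [k _ <-]; rewrite /normed_series_of seriesEnat/=.
apply/cvg_ex; exists (\matrix_(i, j) limn (fun n => series u n i j)).
by apply: cvg_mx => i j; rewrite mxE; exact: h.
Qed.

Lemma norm_cvg_le (T : Type) (F : set_system T) {FF : ProperFilter F} (u : T -> R) (l C : R) :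
  u x @[x --> F] --> l -> (\forall x \near F, `|u x| <= C) -> `|l| <= C.
Proof.
move=> /cvg_norm ul uC; rewrite -(cvg_lim (@Rhausdorff R) ul).
apply: limr_le => //; by apply/cvg_ex; exists `|l|.
Qed.

End MatrixLimits.

(** * Vectorization, Kronecker products and commutators *)

Section VecAlgebra.
Context {R : realType} {N : nat}.
Implicit Types M K L : 'M[R]_N.

Lemma vecE M s : vec M s 0 = M (mxtens_unindex s).2 (mxtens_unindex s).1.
Proof. by rewrite mxE. Qed.

Lemma vecK : cancel (@vec R N) (@unvec R N).
Proof. by move=> M; apply/matrixP => i j; rewrite mxE vecE mxtens_indexK. Qed.

Lemma unvecK : cancel (@unvec R N) (@vec R N).
Proof.
move=> v; apply/matrixP => s j; rewrite ord1 vecE mxE.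
by rewrite -[in RHS](mxtens_unindexK s); case: (mxtens_unindex s).
Qed.

Lemma vecD M K : vec (M + K) = vec M + vec K.
Proof. by apply/matrixP => s j; rewrite !mxE. Qed.

Lemma vecN M : vec (- M) = - vec M.
Proof. by apply/matrixP => s j; rewrite !mxE. Qed.

Lemma vecB M K : vec (M - K) = vec M - vec K.
Proof. by rewrite vecD vecN. Qed.

Lemma vecZ c M : vec (c *: M) = c *: vec M.
Proof. by apply/matrixP => s j; rewrite !mxE. Qed.

Lemma vec_sum (I : Type) (r : seq I) (F : I -> 'M[R]_N) :
  vec (\sum_(i <- r) F i) = \sum_(i <- r) vec (F i).
Proof.
elim/big_rec2: _ => [|i y x _ <-]; last by rewrite vecD.
by apply/matrixP => s j; rewrite !mxE.
Qed.

Lemma sum_mxtens (F : 'I_N -> 'I_N -> R) :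
  \sum_(s < N * N) F (mxtens_unindex s).1 (mxtens_unindex s).2 = \sum_a \sum_b F a b.
Proof.
rewrite pair_big (reindex (@mxtens_index N N)).
  by apply: eq_big => // p _; rewrite mxtens_indexK.
by exists (@mxtens_unindex N N) => x _; [exact: mxtens_indexK|exact: mxtens_unindexK].
Qed.

Lemma vec_mul L M K : vec (L *m M *m K) = (K^T *t L) *m vec M.
Proof.
apply/matrixP => s j; rewrite ord1 vecE [in RHS]mxE.
under [in RHS]eq_bigr => t _ do rewrite vecE !mxE.
rewrite (sum_mxtens (fun a b => K a (mxtens_unindex s).1 * L (mxtens_unindex s).2 b * M b a)).
rewrite mxE; apply: eq_bigr => a _; rewrite mxE mulr_suml; apply: eq_bigr => b _.
by ring.
Qed.

Lemma Delta_vec M K : Delta M *m vec K = vec (M *m K - K *m M).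
Proof.
rewrite /Delta mulmxBl vecB; have := vec_mul M K 1%:M; rewrite trmx1 mulmx1 => ->.
by have := vec_mul 1%:M K M; rewrite mul1mx => ->.
Qed.

Lemma Delta_antisym M K : Delta M *m vec K = - (Delta K *m vec M).
Proof. by rewrite !Delta_vec -vecN opprB. Qed.

End VecAlgebra.

Section PowerSeries.
Context {R : realType} {N : nat}.
Variables (P : 'M[R]_N) (mu : probability nat R).
Hypotheses (sP : stochastic_mx P) (irrP : irreducible_mx P) (aperP : aperiodic_mx P).
Hypothesis mom : exists C : R, forall n, \sum_(0 <= l < n) mass mu l * l%:R <= C.
Implicit Types M : 'M[R]_N.

Lemma exprP_entry_le1 k i j : `|(P ^+ k) i j| <= 1.
Proof. by apply: rowbound_entry; exact: rowboundX_stochastic. Qed.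

Lemma is_cvg_Gamma_series : cvgn (Gamma_series mu P).
Proof.
have [C HC] := mom; apply: is_cvg_series_mx => s t; exists C => n.
apply: le_trans (HC n); apply: ler_sum => k _; rewrite mxE normrM ger0_norm ?mass_ge0//.
rewrite ler_wpM2l ?mass_ge0// summxE (le_trans (ler_norm_sum _ _ _))//.
rewrite [leRHS](_ : _ = \sum_(1 <= j < k.+1) 1); last by rewrite sumr_const_nat subn1.
apply: ler_sum => j _; rewrite !mxE normrM -[leRHS]mulr1 ler_pM ?exprP_entry_le1//.
Qed.

Lemma is_cvg_G_series M (c : nat -> R) (C : R) : (forall l, rowbound (M ^+ l) (c l)) ->
  (forall n, \sum_(0 <= l < n) mass mu l * (l%:R * c l) <= C) -> cvgn (G_series mu M).
Proof.
(* The majorant l c(l) vanishes at l = 0, hence the additional constant [c 0]. *)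
move=> Mc HC; apply: is_cvg_series_mx => i j; exists (C + `|c 0%N|) => n.
have c0 l : 0 <= c l by exact: (rowbound_ge0 i (Mc l)).
apply: (@le_trans _ _ (\sum_(0 <= l < n) (mass mu l * (l%:R * c l) + mass mu l * `|c 0%N|))).
  apply: ler_sum => l _; rewrite mxE normrM (ger0_norm (mass_ge0 mu l)) -mulrDr.
  rewrite ler_wpM2l ?mass_ge0// (le_trans (rowbound_entry i j (Mc l)))//.
  case: l => [|l]; first by rewrite mul0r add0r ler_norm.
  by rewrite (le_trans (_ : _ <= l.+1%:R * c l.+1)) ?lerDl// ler_peMl// ler1n.
by rewrite big_split/= -mulr_suml lerD// -[leRHS]mul1r ler_wpM2r// sum_mass_le1.
Qed.

Lemma is_cvg_G_series_stochastic : cvgn (G_series mu P).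
Proof.
have [C HC] := mom; apply: (@is_cvg_G_series P (fun=> 1) C); first by move=> l; exact: rowboundX_stochastic.
by move=> n; under eq_bigr do rewrite mulr1.
Qed.

Definition Gamma_term k : 'M[R]_(N * N) := \sum_(1 <= j < k.+1) (P ^+ j.-1)^T *t (P ^+ (k - j)).

Lemma Gamma_term_vec k M :
  Gamma_term k *m vec M = vec (\sum_(1 <= j < k.+1) P ^+ (k - j) * M * P ^+ j.-1).
Proof.
by rewrite vec_sum mulmx_suml; apply: eq_bigr => j _; rewrite -vec_mul.
Qed.

(** The error is relative to the actual size [dm] of the perturbation, as differentiability
    requires. When the powers of M are replaced by those of P in the telescoping sum, the term of
    index k changes by at most dm times the minimum of 2 k c(k) and dm k^2 c(k): the second bound
    serves below a cutoff K, the first beyond it. *)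
Lemma G_expansion (e : R) : 0 < e -> exists2 dl : R, 0 < dl &
  forall M, M *m const_mx 1 = const_mx 1 :> 'cV[R]_N \/ cvgn (G_series mu M) ->
  forall dm : R, dm <= dl -> rowbound (M - P) dm ->
  forall s, `|(vec (G mu M) - vec (G mu P) - Gamma mu P *m vec (M - P)) s 0| <= e * dm.
Proof.
move=> e0; have [dl [c [dl0 cm Mc [C HC]]]] := powers_bounded_near sP irrP aperP mom.
have Pc l : rowbound (P ^+ l) (c l).
  by apply: Mc; [rewrite subrr; apply: rowbound0; exact: ltW|left; exact: stochastic_mulmx1].
have [N0|i0] : (N = 0%N) \/ inhabited 'I_N.
  case: N => [|n]; [by left|right; exact: (inhabits ord0)].
  by exists 1 => // M _ dm _ _ s; exfalso; case: s => s; rewrite N0.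
have c0 l : 0 <= c l by case: i0 => i; exact: (rowbound_ge0 i (Pc l)).
(* The tail gets e / 4 because of the factor 2 in the crude bound; head and tail then contribute e /
   2 each. *)
have [K HK] := @tail_small R (fun k => mass mu k * (k%:R * c k)) C (e / 4) (fun k => mulr_ge0 (mass_ge0 mu k) (mulr_ge0 (ler0n _ _) (c0 k))) HC (divr_gt0 e0 (ltr0n _ 4)).
pose D := \sum_(0 <= k < K) mass mu k * (k%:R * (k%:R * c k)) + 1.
have D0 : 0 < D by rewrite ltr_wpDl// sumr_ge0// => k _; rewrite !mulr_ge0 ?mass_ge0.
exists (Num.min dl (e / (2 * D))); first by rewrite lt_min dl0 divr_gt0// mulr_gt0.
move=> M good dm; rewrite le_min => /andP[dmdl dme] MP s.
have dm0 : 0 <= dm by case: i0 => i; exact: (rowbound_ge0 i MP).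
have {}Mc := Mc M (rowbound_le dmdl MP) good.
have cM : cvgn (G_series mu M) by exact: is_cvg_G_series Mc HC.
have cP := is_cvg_G_series_stochastic.
pose Rn n := G_series mu M n - G_series mu P n - unvec (Gamma_series mu P n *m vec (M - P)).
have term k : rowbound (M ^+ k - P ^+ k - \sum_(1 <= j < k.+1) P ^+ (k - j) * (M - P) * P ^+ j.-1)
    (dm * Num.min (2 * (k%:R * c k)) (dm * (k%:R * (k%:R * c k)))).
  rewrite exprB_telescope -sumrB.
  rewrite (eq_bigr (fun j => P ^+ (k - j) * (M - P) * (M ^+ j.-1 - P ^+ j.-1))); last first.
    by move=> j _; rewrite -mulrBr.
  pose w l := Num.min (2 * c l) (dm * (l%:R * c l)).
  have w0 l : 0 <= w l by rewrite /w le_min !mulr_ge0.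
  apply: (@rowbound_le _ _ _ (\sum_(1 <= j < k.+1) 1 * dm * w j.-1)).
    apply: (@le_trans _ _ (\sum_(1 <= j < k.+1) dm * w k)).
      rewrite big_nat [leRHS]big_nat; apply: ler_sum => j /andP[j1 jk].
      have jk' : (j.-1 <= k)%N by rewrite (leq_trans (leq_pred _)).
      rewrite mul1r ler_wpM2l// /w le_min !ge_min ler_wpM2l ?cm//=.
      by rewrite [X in _ || X]ler_wpM2l ?orbT// ler_pM ?ler_nat ?cm.
    rewrite sumr_const_nat subn1/= -mulrnAr ler_wpM2l// -mulr_natl /w minr_pMr//.
    by rewrite mulrCA [_ * (dm * _)]mulrCA.
  apply: rowbound_sum => j; first by rewrite mul1r mulr_ge0.
  apply: rowboundM; first by apply: rowboundM => //; exact: rowboundX_stochastic.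
  move=> i; rewrite /w le_min; apply/andP; split; last exact: rowbound_exprB.
  by have := rowboundD (Mc j.-1) (rowboundN (Pc j.-1)) i; rewrite -mulr2n mulr_natl.
have Rn_le n : rowbound (Rn n) (dm * e).
  have -> : Rn n = \sum_(0 <= k < n) mass mu k *: (M ^+ k - P ^+ k - \sum_(1 <= j < k.+1) P ^+ (k - j) * (M - P) * P ^+ j.-1).
    rewrite /Rn /G_series /Gamma_series !seriesEnat/= mulmx_suml.
    apply: (can_inj vecK); rewrite vecB unvecK vec_sum !vecB !vec_sum -!sumrB.
    apply: eq_bigr => k _; rewrite -!vecB -scalemxAl -/(Gamma_term k) Gamma_term_vec.
    by rewrite -vecZ -vecB !scalerBr.
  pose w k := mass mu k * (dm * Num.min (2 * (k%:R * c k)) (dm * (k%:R * (k%:R * c k)))).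
  have w0 k : 0 <= w k by rewrite /w !mulr_ge0 ?mass_ge0// le_min !mulr_ge0.
  apply: (@rowbound_le _ _ _ (\sum_(0 <= k < n) w k)); last first.
    apply: rowbound_sum => k //; move=> i; under eq_bigr do rewrite mxE normrM (ger0_norm (mass_ge0 mu k)).
    by rewrite -mulr_sumr ler_wpM2l ?mass_ge0//; exact: term.
  have wK : \sum_(0 <= k < K) w k <= dm * (e / 2).
    apply: (@le_trans _ _ (\sum_(0 <= k < K) dm * (dm * (mass mu k * (k%:R * (k%:R * c k)))))).
      apply: ler_sum => k _; rewrite /w [leLHS]mulrCA ler_wpM2l// [leRHS]mulrCA ler_wpM2l ?mass_ge0//.
      by rewrite ge_min lexx orbT.
    rewrite -!mulr_sumr ler_wpM2l//; apply: (@le_trans _ _ (dm * D)).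
      by rewrite ler_wpM2l// lerDl.
    by rewrite -ler_pdivlMr// -mulrA -invfM.
  have wt : \sum_(K <= k < n) w k <= dm * (e / 2).
    apply: (@le_trans _ _ (\sum_(K <= k < n) dm * (2 * (mass mu k * (k%:R * c k))))).
      apply: ler_sum => k _; rewrite /w [leLHS]mulrCA ler_wpM2l// [leRHS]mulrCA ler_wpM2l ?mass_ge0//.
      by rewrite ge_min lexx.
    rewrite -!mulr_sumr ler_wpM2l//; have := HK n; lra.
  have [nK|Kn] := leqP n K.
    apply: (@le_trans _ _ (\sum_(0 <= k < K) w k)).
      by rewrite (@big_cat_nat _ _ _ n 0 K)//= lerDl sumr_ge0.
    by apply: le_trans wK _; rewrite ler_wpM2l//; lra.
  by rewrite (@big_cat_nat _ _ _ K 0 n)//=; [lra|exact: ltnW].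
set vs := (_ - _ - _).
have : vec (Rn n) s 0 @[n --> \oo] --> vs s 0.
  have cv (u : nat -> 'M[R]_N) l : u n @[n --> \oo] --> l -> vec (u n) @[n --> \oo] --> vec l.
    by move=> ul; apply: cvg_mx => a b; rewrite ord1 vecE; under eq_cvg do rewrite vecE; exact: cvg_mx_entry.
  have -> : (fun n => vec (Rn n) s 0) = (fun n => (vec (G_series mu M n) - vec (G_series mu P n)
      - Gamma_series mu P n *m vec (M - P)) s 0).
    by apply/funext => n; rewrite /Rn [vec (_ - unvec _)]vecB unvecK [vec (_ - G_series _ _ _)]vecB.
  have h1 : vec (G_series mu M n) - vec (G_series mu P n) @[n --> \oo] --> vec (G mu M) - vec (G mu P).
    exact: cvg_mxB (cv _ _ cM) (cv _ _ cP).
  have h2 : Gamma_series mu P n *m vec (M - P) @[n --> \oo] --> Gamma mu P *m vec (M - P).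
    by apply: cvg_mulmx; [exact: is_cvg_Gamma_series|exact: cvg_cst].
  have h3 : vec (G_series mu M n) - vec (G_series mu P n) -
      Gamma_series mu P n *m vec (M - P) @[n --> \oo] --> vs by exact: cvg_mxB h1 h2.
  by apply: cvg_mx_entry; exact: h3.
move=> /norm_cvg_le; apply; apply: nearW => n; rewrite vecE mulrC.
exact: (rowbound_entry _ _ (Rn_le n)).
Qed.

Lemma G_cvg : G_series mu P n @[n --> \oo] --> G mu P.
Proof. exact: is_cvg_G_series_stochastic. Qed.

Lemma G_entry_cvg i j : \sum_(0 <= l < n) mass mu l * (P ^+ l) i j @[n --> \oo] --> G mu P i j.
Proof.
have -> : (fun n => \sum_(0 <= l < n) mass mu l * (P ^+ l) i j) = (fun n => G_series mu P n i j).
  by apply/funext => n; rewrite /G_series seriesEnat/= summxE; apply: eq_bigr => l _; rewrite mxE.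
exact: cvg_mx_entry G_cvg.
Qed.

Lemma G_entry_ereal i j :
  (\sum_(g <oo) (mass mu g * (P ^+ g) i j)%:E = (G mu P i j)%:E)%E.
Proof.
apply/cvg_lim => //; rewrite (_ : (fun n => _) = (fun n => (\sum_(0 <= l < n) mass mu l * (P ^+ l) i j)%:E)).
  by apply: cvg_EFin; [exact: nearW|exact: G_entry_cvg].
by apply/funext => n; rewrite sumEFin.
Qed.

Lemma mass_cvg1 : \sum_(0 <= l < n) mass mu l @[n --> \oo] --> (1 : R).
Proof.
have : (\sum_(l <oo) (mass mu l)%:E = 1)%E.
  have <- : mu (\bigcup_l [set l]) = 1%E.
    by rewrite (_ : \bigcup_l [set l] = setT) ?probability_setT//; apply/seteqP; split => // x _; exists x.
  rewrite measure_bigcup//; last first.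
    by apply/trivIsetP => a b _ _ ab; rewrite -subset0 => x [/= -> /= ab']; rewrite ab' eqxx in ab.
  rewrite [RHS](eq_eseriesl _ (Q := xpredT)); last by move=> l; rewrite in_setT.
  apply: eq_eseriesr => l _; by rewrite /mass fineK// fin_num_measure.
move=> h; have : (\sum_(0 <= l < n) (mass mu l)%:E)%E @[n --> \oo] --> 1%E.
  by rewrite -h; apply: is_cvg_nneseries => n _ _; rewrite lee_fin mass_ge0.
move=> /fine_cvg; rewrite /comp; under eq_cvg do rewrite sumEFin.
exact.
Qed.

Lemma G_ge0 i j : 0 <= G mu P i j.
Proof.
rewrite -(cvg_lim (@Rhausdorff R) (@G_entry_cvg i j)); apply: limr_ge.
  by apply/cvg_ex; exists (G mu P i j); exact: G_entry_cvg.
by apply: nearW => n; apply: sumr_ge0 => l _; rewrite mulr_ge0 ?mass_ge0// exp_ge0_entry//; exact: sP.1.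
Qed.

Lemma cvg_mass_mx m n (l : 'M[R]_(m, n)) : (\sum_(0 <= k < i) mass mu k) *: l @[i --> \oo] --> l.
Proof.
apply: cvg_mx => i j; under eq_cvg do rewrite mxE.
have := cvgM mass_cvg1 (@cvg_cst _ (l i j) _ \oo _); rewrite mul1r; exact.
Qed.

Lemma stochastic_G : stochastic_mx (G mu P).
Proof.
split=> [|i]; first exact: G_ge0.
have P1 k : P ^+ k *m const_mx 1 = const_mx 1 :> 'cV[R]_N.
  by elim: k => [|k IH]; rewrite ?expr0 ?mul1mx// exprSr -mulmxA stochastic_mulmx1.
have : G mu P *m const_mx 1 = const_mx 1 :> 'cV[R]_N.
  apply: (@cvg_unique_mx _ _ _ (fun n => (\sum_(0 <= k < n) mass mu k) *: const_mx 1)); last exact: cvg_mass_mx.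
  have -> : (fun n => (\sum_(0 <= k < n) mass mu k) *: const_mx 1) =
      (fun n => G_series mu P n *m (const_mx 1 : 'cV[R]_N)).
    apply/funext => n; rewrite /G_series seriesEnat/= mulmx_suml scaler_suml.
    by apply: eq_bigr => k _; rewrite -scalemxAl P1.
  by apply: cvg_mulmx; [exact: G_cvg|exact: cvg_cst].
move=> /matrixP/(_ i 0); rewrite !mxE => <-; apply: eq_bigr => j _; by rewrite mxE mulr1.
Qed.

Lemma invariant_G (pi : 'rV[R]_N) : pi *m P = pi -> pi *m G mu P = pi.
Proof.
move=> piP; have piPk k : pi *m P ^+ k = pi.
  by elim: k => [|k IH]; rewrite ?expr0 ?mulmx1// exprS mulmxA piP.
apply: (@cvg_unique_mx _ _ _ (fun n => (\sum_(0 <= k < n) mass mu k) *: pi)); last exact: cvg_mass_mx.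
have -> : (fun n => (\sum_(0 <= k < n) mass mu k) *: pi) = (fun n => pi *m G_series mu P n).
  apply/funext => n; rewrite /G_series seriesEnat/= mulmx_sumr scaler_suml.
  by apply: eq_bigr => k _; rewrite -scalemxAr piPk.
by apply: cvg_mulmx; [exact: cvg_cst|exact: G_cvg].
Qed.

Lemma comm_mx_G : comm_mx P (G mu P).
Proof.
apply: (@cvg_unique_mx _ _ _ (fun n => P *m G_series mu P n)).
  by apply: cvg_mulmx; [exact: cvg_cst|exact: G_cvg].
have -> : (fun n => P *m G_series mu P n) = (fun n => G_series mu P n *m P).
  apply/funext => n; rewrite /G_series seriesEnat/= mulmx_suml mulmx_sumr.
  by apply: eq_bigr => k _; rewrite -scalemxAl -scalemxAr -[_ *m P]/(_ * P) -exprSr exprS.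
by apply: cvg_mulmx; [exact: G_cvg|exact: cvg_cst].
Qed.

(** An atom l > 0 of mu gives Q >= mu(l) P^l entrywise, hence Q^k >= mu(l)^k P^(l k), and l k
    exceeds the primitivity threshold of P as soon as k does. *)
Lemma G_exp_gt0 : (mu : set nat -> \bar R) <> \d_(0%N) ->
  exists2 m, forall i j, 0 < (G mu P ^+ m) i j & (0 < m)%N.
Proof.
move=> mu0; have [l l0 ml] : exists2 l, (0 < l)%N & 0 < mass mu l.
  apply: contrapT => nol; apply: mu0; apply/funext => A.
  have m0 l : (0 < l)%N -> mass mu l = 0.
    move=> l0; apply/eqP; rewrite eq_le mass_ge0 andbT leNgt; apply/negP => ml; apply: nol; by exists l.
  have mass0 : mass mu 0 = 1.
    have h : (fun n => \sum_(0 <= l < n.+1) mass mu l) = (fun=> mass mu 0).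
      by apply/funext => n; rewrite big_nat_recl// big1 ?addr0// => l _; rewrite m0.
    have := mass_cvg1; rewrite -cvg_shiftS h => h1.
    by rewrite -(cvg_lim (@Rhausdorff R) h1) lim_cst.
  have mu0' : mu [set 0%N] = 1%E by rewrite -[LHS]fineK ?fin_num_measure// -/(mass mu 0) mass0.
  rewrite diracE; case: (pselect (A 0%N)) => A0; rewrite ?(mem_set A0) ?(memNset A0)/=.
    apply/eqP; rewrite eq_le probability_le1//= -mu0' le_measure ?inE// => x ->; exact: A0.
  apply/eqP; rewrite eq_le measure_ge0 andbT.
  rewrite [leRHS](_ : _ = mu (~` [set 0%N])); last by rewrite probability_setC// mu0' subee.
  by rewrite le_measure ?inE// => x Ax /= x0; apply: A0; rewrite -x0.
have GP i j : mass mu l * (P ^+ l) i j <= G mu P i j.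
  rewrite -(cvg_lim (@Rhausdorff R) (@G_entry_cvg i j)); apply: limr_ge.
    by apply/cvg_ex; exists (G mu P i j); exact: G_entry_cvg.
  near=> n; have ln : (l < n)%N by near: n; exists l.+1.
  rewrite big_mkord (bigD1 (Ordinal ln))//= lerDl sumr_ge0// => k _.
  by rewrite mulr_ge0 ?mass_ge0// exp_ge0_entry//; exact: sP.1.
have GPk k i j : mass mu l ^+ k * (P ^+ (l * k)) i j <= (G mu P ^+ k) i j.
  elim: k i j => [|k IH] i j; first by rewrite muln0 !expr0 mul1r.
  rewrite mulnS exprD !exprS !mxE mulr_sumr; apply: ler_sum => a _.
  rewrite mulrACA ler_pM ?mulr_ge0 ?mass_ge0 ?exprn_ge0 ?mass_ge0//; apply: exp_ge0_entry; exact: sP.1.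
have [m0 Pm] := primitive_of_aperiodic sP irrP aperP.
exists m0.+1 => // i j; apply: lt_le_trans (GPk _ i j); rewrite mulr_gt0 ?exprn_gt0// Pm//.
by rewrite (leq_trans (leqnSn _))// leq_pmull.
Unshelve. all: by end_near. Qed.

End PowerSeries.

(** Minimum principle: at a minimum j, the mean of h - h j under the positive weights of row j of
    Q^m is 0, while every term is nonnegative. *)
Lemma harmonic_const {R : realType} {N : nat} (Q : 'M[R]_N) m : stochastic_mx Q ->
  (forall i j, 0 < (Q ^+ m) i j) ->
  forall h : 'cV[R]_N, Q *m h = h -> forall i j, h i 0 = h j 0.
Proof.
move=> sQ Qm h Qh.
have Qkh k : Q ^+ k *m h = h.
  by elim: k => [|k IH]; rewrite ?expr0 ?mul1mx// exprSr -mulmxA Qh.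
have Qk1 k : Q ^+ k *m const_mx 1 = const_mx 1 :> 'cV[R]_N.
  by elim: k => [|k IH]; rewrite ?expr0 ?mul1mx// exprSr -mulmxA stochastic_mulmx1.
suff H : forall i j, h i 0 <= h j 0 by move=> i j; apply/eqP; rewrite eq_le !H.
move=> i0 j0; have [j jmin] : exists j, forall k, h j 0 <= h k 0.
  by case: (arg_minP (fun k => h k 0) (isT : xpredT i0)) => j _ jm; exists j => k; exact: jm.
suff : h i0 0 <= h j 0 by move=> /le_trans; apply.
have : \sum_k (Q ^+ m) j k * (h k 0 - h j 0) = 0.
  under eq_bigr do rewrite mulrBr; rewrite sumrB -mulr_suml.
  have /matrixP/(_ j 0) := Qkh m; rewrite mxE => ->.
  have /matrixP/(_ j 0) := Qk1 m; rewrite !mxE; under eq_bigr do rewrite mxE mulr1.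
  by move=> ->; rewrite mul1r subrr.
move=> /psumr_eq0P; have h0 k : 0 <= (Q ^+ m) j k * (h k 0 - h j 0).
  by apply: mulr_ge0; rewrite ?subr_ge0// ltW.
move=> /(_ (fun k _ => h0 k) i0 isT)/eqP; rewrite mulf_eq0 gt_eqF ?Qm//= subr_eq0 => /eqP ->.
exact: lexx.
Qed.

(** In pi = pi Q^m, a vanishing pi_i would force every pi_k to vanish. *)
Lemma invariant_gt0 {R : realType} {N : nat} (Q : 'M[R]_N) m (pi : 'rV[R]_N) :
  invariant_distribution Q pi -> (forall i j, 0 < (Q ^+ m) i j) -> forall i, 0 < pi 0 i.
Proof.
move=> [pi0 pi1 piQ] Qm i.
have piQk k : pi *m Q ^+ k = pi.
  by elim: k => [|k IH]; rewrite ?expr0 ?mulmx1// exprS mulmxA piQ.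
have /matrixP/(_ 0 i) := piQk m; rewrite mxE => <-.
have S0 k : 0 <= pi 0 k * (Q ^+ m) k i by rewrite mulr_ge0// ltW.
rewrite lt_neqAle sumr_ge0// andbT eq_sym; apply/negP => /eqP/psumr_eq0P H.
have : \sum_k pi 0 k = 0.
  apply: big1 => k _; have /eqP := H (fun k _ => S0 k) k isT.
  by rewrite mulf_eq0 [X in _ || X]gt_eqF ?Qm// orbF => /eqP.
by rewrite pi1 => /eqP; rewrite oner_eq0.
Qed.


(** * The constrained estimator *)

Section MatrixNorm.
Context {R : realType}.

Lemma mx_entry_le m n (M : 'M[R]_(m, n)) i j : `|M i j| <= `|M|.
Proof.
rewrite [leRHS]/Num.norm/= mx_normrE; exact: (le_bigmax _ (fun ij => `|M ij.1 ij.2|) (i, j)).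
Qed.

Lemma mx_norm_leP m n (M : 'M[R]_(m, n)) c : 0 <= c -> (forall i j, `|M i j| <= c) -> `|M| <= c.
Proof.
by move=> c0 Mc; rewrite [leLHS]/Num.norm/= mx_normrE; apply: bigmax_le => // -[i j] _; exact: Mc.
Qed.

Lemma mx_norm_mulmx m n p (M : 'M[R]_(m, n)) (K : 'M[R]_(n, p)) : `|M *m K| <= n%:R * `|M| * `|K|.
Proof.
apply: mx_norm_leP => [|i j]; first by rewrite !mulr_ge0.
rewrite mxE (le_trans (ler_norm_sum _ _ _))// -mulrA mulr_natl -[X in _ *+ X]card_ord -sumr_const.
by apply: ler_sum => k _; rewrite normrM ler_pM// mx_entry_le.
Qed.

Lemma cvg_trmx (T : Type) (F : set_system T) {FF : Filter F} m n
    (u : T -> 'M[R]_(m, n)) (a : 'M[R]_(m, n)) :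
  u x @[x --> F] --> a -> (u x)^T @[x --> F] --> a^T.
Proof.
move=> ua; apply: cvg_mx => i j; rewrite mxE.
under eq_cvg do rewrite mxE.
exact: cvg_mx_entry.
Qed.

Lemma cvg_tensmx (T : Type) (F : set_system T) {FF : Filter F} m n p q
    (u : T -> 'M[R]_(m, n)) (v : T -> 'M[R]_(p, q)) (a : 'M[R]_(m, n)) (b : 'M[R]_(p, q)) :
  u x @[x --> F] --> a -> v x @[x --> F] --> b -> (u x *t v x) @[x --> F] --> a *t b.
Proof.
move=> ua vb; apply: cvg_mx => i j; rewrite mxE.
under eq_cvg do rewrite mxE.
by apply: cvgM; exact: cvg_mx_entry.
Qed.

Lemma cvg_Delta (T : Type) (F : set_system T) {FF : Filter F} N
    (u : T -> 'M[R]_N) (a : 'M[R]_N) :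
  u x @[x --> F] --> a -> Delta (u x) @[x --> F] --> Delta a.
Proof.
move=> ua; rewrite /Delta; apply: cvg_mxB; apply: cvg_tensmx; try exact: cvg_cst; first exact: ua.
exact: cvg_trmx.
Qed.

Lemma cvg_prodr (T : Type) (F : set_system T) {FF : Filter F} (I : Type) (r : seq I)
    (u : I -> T -> R) (a : I -> R) :
  (forall i, u i x @[x --> F] --> a i) -> \prod_(i <- r) u i x @[x --> F] --> \prod_(i <- r) a i.
Proof.
move=> ua; elim: r => [|i r IH].
  by rewrite big_nil; under eq_cvg do rewrite big_nil; exact: cvg_cst.
by rewrite big_cons; under eq_cvg do rewrite big_cons; exact: cvgM.
Qed.

Lemma cvg_det (T : Type) (F : set_system T) {FF : Filter F} n
    (u : T -> 'M[R]_n) (a : 'M[R]_n) :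
  u x @[x --> F] --> a -> \det (u x) @[x --> F] --> \det a.
Proof.
move=> ua; rewrite /determinant; apply: (@cvg_sumr R R^o) => s.
apply: cvgM; first exact: cvg_cst.
by apply: cvg_prodr => i; exact: cvg_mx_entry.
Qed.

Lemma cvg_adj (T : Type) (F : set_system T) {FF : Filter F} n
    (u : T -> 'M[R]_n) (a : 'M[R]_n) :
  u x @[x --> F] --> a -> \adj (u x) @[x --> F] --> \adj a.
Proof.
move=> ua; apply: cvg_mx => i j; rewrite mxE /cofactor.
under eq_cvg do rewrite mxE /cofactor.
apply: cvgM; first exact: cvg_cst.
apply: cvg_det; apply: cvg_mx => k l; rewrite !mxE.
under eq_cvg do rewrite !mxE.
exact: cvg_mx_entry.
Qed.

Lemma near_unitmx (T : Type) (F : set_system T) {FF : Filter F} n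
    (u : T -> 'M[R]_n) (a : 'M[R]_n) :
  u x @[x --> F] --> a -> a \in unitmx -> \forall x \near F, u x \in unitmx.
Proof.
move=> ua; rewrite unitmxE unitfE => a0.
have : \forall x \near F, \det (u x) != 0 by exact: (cvgr_neq0 (\det a) (cvg_det ua) a0).
by apply: filterS => x; rewrite unitmxE unitfE.
Qed.

Lemma cvg_invmx (T : Type) (F : set_system T) {FF : Filter F} n
    (u : T -> 'M[R]_n) (a : 'M[R]_n) :
  u x @[x --> F] --> a -> a \in unitmx -> invmx (u x) @[x --> F] --> invmx a.
Proof.
move=> ua au; have ux : \forall x \near F, u x \in unitmx by exact: near_unitmx ua au.
(* [invmx] is the adjugate divided by the determinant only on invertible matrices, but these are
   reached eventually; adjugate and determinant are polynomials. *)
apply: (@cvg_trans _ ((\det (u x))^-1 *: \adj (u x) @[x --> F])).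
  by apply: near_eq_cvg; apply: filterS ux => x; rewrite /invmx => ->.
rewrite /invmx au; apply: cvg_mx => i j; rewrite mxE.
under eq_cvg do rewrite mxE.
apply: cvgM; last by apply: cvg_mx_entry; exact: cvg_adj.
by apply: cvgV; [rewrite -unitfE -unitmxE|exact: cvg_det].
Qed.

End MatrixNorm.

Section Estimator.
Context {R : realType} {N : nat}.
Variables (P Q : 'M[R]_N) (r d : nat) (A : 'M[R]_(r, N * N)) (b : 'cV[R]_r).
Variables (Phi : 'M[R]_(N * N, d)) (p0 : 'cV[R]_(N * N)).
Hypotheses (hPhi : column_basis_of_ker A Phi) (hPA : A *m vec P = b) (hp0 : A *m p0 = b).
Hypotheses (hid : identifiable A Q) (PQ : comm_mx P Q).

Definition normal_mx Q' : 'M[R]_d := Phi^T *m (Delta Q')^T *m Delta Q' *m Phi.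

Lemma mul_constraint_basis : A *m Phi = 0.
Proof.
apply: trmx_inj; rewrite trmx_mul trmx0; apply/eqP.
by rewrite -sub_kermx hPhi.2 submx_refl.
Qed.

(** A kernel vector v satisfies |Delta(Q) Phi v|^2 = 0, so the matrix with vectorization Phi v
    commutes with Q and is killed by A; identifiability makes it 0, and Phi is injective. *)
Lemma normal_mx_unit : normal_mx Q \in unitmx.
Proof.
rewrite -row_free_unit -kermx_eq0; apply/eqP/row_matrixP => i; rewrite row0.
set v := row i _; have vH : v *m normal_mx Q = 0.
  by apply/eqP; rewrite -sub_kermx row_sub.
have Dv : Delta Q *m Phi *m v^T = 0.
  set w := _ *m v^T; have ww : \sum_s w s 0 ^+ 2 = 0.
    have : (w^T *m w) 0 0 = 0.
      rewrite /w !trmx_mul trmxK !mulmxA; move: vH; rewrite /normal_mx !mulmxA => ->.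
      by rewrite mul0mx mxE.
    by rewrite mxE; under eq_bigr do rewrite mxE -expr2.
  apply/matrixP => s j; rewrite ord1 [RHS]mxE; apply/eqP; rewrite -sqrf_eq0; apply/eqP.
  by apply: (psumr_eq0P _ ww) => // t _; exact: sqr_ge0.
have : unvec (Phi *m v^T) = 0.
  apply: hid.
    apply/eqP; rewrite -subr_eq0; apply/eqP/(can_inj vecK).
    have := Delta_vec Q (unvec (Phi *m v^T)); rewrite unvecK mulmxA Dv.
    rewrite -opprB vecN => <-; rewrite oppr0; apply/matrixP => s j; by rewrite !mxE.
  by rewrite unvecK mulmxA mul_constraint_basis mul0mx.
move=> /(congr1 (@vec R N)); rewrite unvecK => Pv.
have vP : v *m Phi^T = 0.
  apply: trmx_inj; rewrite trmx_mul trmxK Pv; apply/matrixP => s j; by rewrite !mxE.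
by apply: (row_free_inj hPhi.1); rewrite vP mul0mx.
Qed.

Lemma p_estimator_constraint Q' : A *m p_estimator Phi p0 Q' = b.
Proof.
by rewrite /p_estimator mulmxA mulmxBr mulmx1 !mulmxA mul_constraint_basis !mul0mx subr0.
Qed.

Lemma p_estimator_expansion Q' : normal_mx Q' \in unitmx ->
  p_estimator Phi p0 Q' - vec P = Bmx Phi P Q' *m (vec Q' - vec Q).
Proof.
(* [p0] and vec P satisfy the same constraint, hence differ by some Phi u, which the projection in
   the estimator annihilates. *)
move=> Hu; have [u pu] : exists u, p0 = vec P + Phi *m u.
  have : ((p0 - vec P)^T <= Phi^T)%MS.
    by rewrite hPhi.2 sub_kermx -trmx_mul mulmxBr hPA hp0 subrr trmx0.
  move=> /submxP[D HD]; exists D^T; rewrite -[Phi]trmxK -trmx_mul -HD trmxK addrC subrK //.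
have DPQ : Delta P *m vec Q = 0.
  by rewrite Delta_vec PQ subrr; apply/matrixP => s j; rewrite !mxE.
rewrite mulmxBr /Bmx -[_ *m vec Q]mulmxA DPQ mulmx0 subr0.
rewrite -[RHS]mulmxA -[Delta P *m _]opprK -Delta_antisym mulmxN.
rewrite /p_estimator -/(normal_mx Q'); set K := invmx _.
rewrite pu mulmxDr !(mulmxBl 1%:M) !mul1mx -!mulmxA.
have -> : Phi^T *m ((Delta Q')^T *m (Delta Q' *m (Phi *m u))) = normal_mx Q' *m u.
  by rewrite /normal_mx -!mulmxA.
by rewrite mulKmx// subrr addr0 addrAC subrr add0r.
Qed.

Lemma cvg_normal_mx (T : Type) (F : set_system T) {FF : Filter F} (u : T -> 'M[R]_N) :
  u x @[x --> F] --> Q -> normal_mx (u x) @[x --> F] --> normal_mx Q.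
Proof.
move=> uQ; have uD := cvg_Delta uQ; rewrite /normal_mx; apply: cvg_mulmx; last exact: cvg_cst.
apply: cvg_mulmx; last exact: cvg_Delta.
by apply: cvg_mulmx; [exact: cvg_cst|apply: cvg_trmx; exact: cvg_Delta].
Qed.

Lemma cvg_Bmx (T : Type) (F : set_system T) {FF : Filter F} (u : T -> 'M[R]_N) :
  u x @[x --> F] --> Q -> Bmx Phi P (u x) @[x --> F] --> Bmx Phi P Q.
Proof.
move=> uQ; rewrite /Bmx; apply: cvg_mulmx; last exact: cvg_cst.
apply: cvg_mulmx; last by apply: cvg_trmx; exact: cvg_Delta.
apply: cvg_mulmx; last exact: cvg_cst.
apply: cvg_mulmx; first exact: cvg_cst.
by apply: cvg_invmx; [exact: cvg_normal_mx|exact: normal_mx_unit].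
Qed.

End Estimator.

(** The exact formula for p' - p is fed into the expansion of G_mu, and B(Q') is replaced by B(Q) by
    continuity. The row-sum alternative passes to the estimated matrix because the estimator
    satisfies the constraint exactly. *)
Lemma plugin_expansion {R : realType} {N : nat} (P : 'M[R]_N) (mu : probability nat R)
    (r d : nat) (A : 'M[R]_(r, N * N)) (b : 'cV[R]_r)
    (Phi : 'M[R]_(N * N, d)) (p0 : 'cV[R]_(N * N)) :
  stochastic_mx P -> irreducible_mx P -> aperiodic_mx P ->
  (exists C : R, forall n, \sum_(0 <= l < n) mass mu l * l%:R <= C) ->
  column_basis_of_ker A Phi -> A *m vec P = b -> A *m p0 = b -> identifiable A (G mu P) ->
  forall e : R, 0 < e -> exists2 dl : R, 0 < dl & forall Q', `|Q' - G mu P| <= dl ->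
    contains_row_sum_constraint A b \/ cvgn (G_series mu (unvec (p_estimator Phi p0 Q'))) ->
    `|vec Q' - vec (G mu (unvec (p_estimator Phi p0 Q')))
      - (1%:M - Gamma mu P *m Bmx Phi P (G mu P)) *m (vec Q' - vec (G mu P))|
    <= e * `|vec Q' - vec (G mu P)|.
Proof.
move=> sP irrP aperP mom hPhi hPA hp0 hid e e0.
set Q := G mu P; set B := Bmx Phi P Q; set Gam := Gamma mu P.
have PQ : comm_mx P Q by exact: comm_mx_G.
(* [n2] is the cost of a matrix product in the entrywise maximum norm; [Cb] turns |B'| <= |B| + 1
   into a row-sum bound for M - P. *)
pose n2 : R := (N * N)%:R; pose Cb := N%:R * (n2 * (`|B| + 1)) + 1.
have Cb0 : 0 < Cb by rewrite ltr_wpDl// !mulr_ge0// addr_ge0.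
have g0 : 0 < n2 * `|Gam| * n2 + 1 by rewrite ltr_wpDl// !mulr_ge0.
pose e1 := Num.min 1 (e / 2 / (n2 * `|Gam| * n2 + 1)).
have e10 : 0 < e1 by rewrite lt_min ltr01 !divr_gt0.
have [d1 d10 Hd1] := G_expansion sP irrP aperP mom (divr_gt0 (divr_gt0 e0 (ltr0n _ 2)) Cb0).
have hu := normal_mx_unit hPhi hid.
have : \forall Q' \near Q, normal_mx Phi Q' \in unitmx /\ `|B - Bmx Phi P Q'| < e1.
  have n1 : normal_mx Phi x @[x --> Q] --> normal_mx Phi Q by apply: (@cvg_normal_mx _ _ _ _ _ _ (nbhs Q) (nbhs_filter Q)); exact: cvg_id.
  have n2' : Bmx Phi P x @[x --> Q] --> B by apply: (@cvg_Bmx _ _ _ _ _ _ _ _ hPhi hid _ (nbhs Q) (nbhs_filter Q)); exact: cvg_id.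
  near=> Q'; split.
    by near: Q'; exact: near_unitmx n1 hu.
  by near: Q'; move/cvgrPdist_lt : n2'; apply.
rewrite -nbhs_nearE => /nbhs_ballP[d2 /= d20 Hd2].
exists (Num.min (d2 / 2) (d1 / Cb)) => [|Q'].
  by rewrite lt_min !divr_gt0.
rewrite le_min => /andP[Qd2 Qd1] good.
have [Q'u QB] : normal_mx Phi Q' \in unitmx /\ `|B - Bmx Phi P Q'| < e1.
  apply: Hd2; rewrite mx_norm_ball /ball_/= distrC (le_lt_trans Qd2)//.
  by rewrite ltr_pdivrMr// ltr_pMr// ltr1n.
set x := vec Q' - vec Q; set B' := Bmx Phi P Q' in QB.
set M := unvec (p_estimator Phi p0 Q').
have vM : vec (M - P) = B' *m x.
  by rewrite vecB unvecK (p_estimator_expansion hPhi hPA hp0 PQ Q'u).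
have QB' : `|B' - B| <= e1 by rewrite distrC; exact: ltW.
have B'B : `|B'| <= `|B| + 1.
  rewrite -[B'](subrK B) addrC (le_trans (ler_normD _ _))// lerD2l distrC.
  by rewrite (le_trans (ltW QB))// ge_min lexx.
have Mb : rowbound (M - P) (Cb * `|x|).
  move=> i; apply: (@le_trans _ _ (\sum_(j < N) n2 * (`|B| + 1) * `|x|)).
    apply: ler_sum => j _.
    have -> : (M - P) i j = (B' *m x) (mxtens_index (j, i)) 0 by rewrite -vM vecE mxtens_indexK.
    apply: le_trans (mx_entry_le _ _ _) _; apply: le_trans (mx_norm_mulmx _ _) _.
    by rewrite ler_wpM2r// ler_wpM2l.
  by rewrite sumr_const card_ord -[leLHS]mulr_natl mulrA ler_wpM2r// lerDl.
have x_le : `|x| <= `|Q' - Q|.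
  apply: mx_norm_leP => // s t; rewrite ord1 /x -vecB vecE; exact: mx_entry_le.
have goodM : M *m const_mx 1 = const_mx 1 :> 'cV[R]_N \/ cvgn (G_series mu M).
  case: good => [rs|]; last by right.
  by left; apply: rs; rewrite unvecK (p_estimator_constraint hPhi hp0).
have Cbx : Cb * `|x| <= d1.
  by rewrite mulrC -ler_pdivlMr// (le_trans x_le).
have := Hd1 M goodM _ Cbx Mb; rewrite vM -/Q -/Gam => HG.
have -> : vec Q' - vec (G mu M) - (1%:M - Gam *m B) *m x =
    - (vec (G mu M) - vec Q - Gam *m (B' *m x)) - Gam *m ((B' - B) *m x).
  rewrite (mulmxBl 1%:M) mul1mx -mulmxA (mulmxBl B') [Gam *m (_ - _)]mulmxBr.
  move: (Gam *m (B *m x)) (Gam *m (B' *m x)) => y1 y2; rewrite /x.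
  by apply/matrixP => s t; rewrite !mxE; ring.
apply: le_trans (ler_normB _ _) _; rewrite normrN.
rewrite [leRHS](_ : _ = e / 2 * `|x| + e / 2 * `|x|); last by rewrite -mulrDl -splitr.
apply: lerD.
  apply: mx_norm_leP => [|s t]; first by rewrite mulr_ge0// divr_ge0// ltW.
  by rewrite ord1; apply: le_trans (HG s) _; rewrite mulrA divfK ?gt_eqF.
apply: le_trans (mx_norm_mulmx _ _) _.
apply: (@le_trans _ _ (n2 * `|Gam| * (n2 * e1 * `|x|))).
  rewrite ler_wpM2l ?mulr_ge0//; apply: le_trans (mx_norm_mulmx _ _) _.
  by apply: (ler_wpM2r (normr_ge0 x)); exact: (ler_wpM2l (ler0n R (N * N)) QB').
rewrite mulrA ler_wpM2r// mulrA; apply: (@le_trans _ _ ((n2 * `|Gam| * n2 + 1) * e1)).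
  by apply: ler_wpM2r; [exact: ltW|rewrite lerDl].
by rewrite mulrC -ler_pdivlMr// ge_min lexx orbT.
Unshelve. all: by end_near. Qed.

(** * Delta method for the empirical transition matrix *)

Section UnionBound.
Context {d : measure_display} {Omega : measurableType d} {R : realType}.
Variable Pr : probability Omega R.

Lemma prb_bigcup (I : finType) (A : I -> set Omega) : (forall i, measurable (A i)) ->
  prb Pr (\bigcup_i A i) <= \sum_i prb Pr (A i).
Proof.
move=> mA; have mU : measurable (\bigcup_i A i).
  by apply: fin_bigcup_measurable => //; exact: finite_finset.
have bi i : bounded_rv (\1_(A i) : Omega -> R) by exact: bounded_rv_indic.
rewrite /prb -(Exp_indic Pr mU); under eq_bigr do rewrite -(Exp_indic Pr (mA _)).
rewrite -Exp_sum//; apply: Exp_le => [||w]; [exact: bounded_rv_indic|exact: bounded_rv_sum|].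
rewrite indicE; case: (pselect ((\bigcup_i A i) w)) => [[i _ Ai]|nA].
  rewrite mem_set; last by exists i.
  rewrite (bigD1 i)//= indicE mem_set// lerDl sumr_ge0// => j _; by rewrite indicE.
by rewrite memNset// sumr_ge0// => j _; rewrite indicE.
Qed.

Lemma prb_setU (A B : set Omega) : measurable A -> measurable B ->
  prb Pr (A `|` B) <= prb Pr A + prb Pr B.
Proof.
move=> mA mB; rewrite -lee_fin EFinD -!prbE//; last exact: measurableU.
exact: measureU2.
Qed.

End UnionBound.

Section SigmaFactor.
Context {R : realType} {N : nat}.
Variables (Q : 'M[R]_N) (pi : 'rV[R]_N).

(** The column of a transition from a to b is its contribution to the score, a centred indicator
    over pi_i, times the square root of its stationary frequency pi_a Q_ab; a = i leaves the root of
    Q_ab / pi_a. *)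
Definition Sigma_factor : 'M[R]_(N * N) :=
  \matrix_(s, t)
    let (j, i) := mxtens_unindex s in
    let (b, a) := mxtens_unindex t in
    Num.sqrt (Q a b / pi 0 a) * ((a == i)%:R * ((b == j)%:R - Q i j)).

Lemma Sigma_factorE s t : Sigma_factor s t =
  Num.sqrt (Q (mxtens_unindex t).2 (mxtens_unindex t).1 / pi 0 (mxtens_unindex t).2) *
  (((mxtens_unindex t).2 == (mxtens_unindex s).2)%:R *
   (((mxtens_unindex t).1 == (mxtens_unindex s).1)%:R - Q (mxtens_unindex s).2 (mxtens_unindex s).1)).
Proof. by rewrite mxE; case: (mxtens_unindex s) => ? ?; case: (mxtens_unindex t). Qed.

Hypotheses (sQ : stochastic_mx Q) (pi0 : forall i, 0 < pi 0 i).

Lemma Sigma_factor_sqr : Sigma_factor *m Sigma_factor^T = Sigma Q pi.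
Proof.
apply/matrixP => s t; rewrite [RHS]mxE mxE.
under eq_bigr do rewrite [_^T _ _]mxE !Sigma_factorE.
case: (mxtens_unindex s) => j i; case: (mxtens_unindex t) => l k /=.
rewrite (sum_mxtens (fun b a => Num.sqrt (Q a b / pi 0 a) * ((a == i)%:R * ((b == j)%:R - Q i j)) *
  (Num.sqrt (Q a b / pi 0 a) * ((a == k)%:R * ((b == l)%:R - Q k l))))).
rewrite exchange_big (bigD1 i)//= [X in _ + X]big1 ?addr0; last first.
  by move=> a /negbTE ai; apply: big1 => b _; rewrite ai mul0r mulr0 mul0r.
have [<-|ik] := eqVneq i k; last first.
  by apply: big1 => b _; rewrite mul0r !mulr0.
have e b : Num.sqrt (Q i b / pi 0 i) * (1 * ((b == j)%:R - Q i j)) *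
    (Num.sqrt (Q i b / pi 0 i) * (1 * ((b == l)%:R - Q i l))) =
    (Q i b * (b == j)%:R * (b == l)%:R - Q i b * (b == j)%:R * Q i l
      - Q i j * (Q i b * (b == l)%:R) + Q i j * Q i l * Q i b) / pi 0 i.
  rewrite !mul1r mulrACA -expr2 sqr_sqrtr; last by rewrite divr_ge0 ?sQ.1// ltW.
  by ring.
rewrite eqxx; under eq_bigr do rewrite e.
rewrite -mulr_suml big_split/= !sumrB -!mulr_sumr sQ.2 -mulr_suml.
have pick (c : 'I_N) (f : 'I_N -> R) : \sum_b f b * (b == c)%:R = f c.
  rewrite (bigD1 c)//= eqxx mulr1 big1 ?addr0// => b /negbTE ->; by rewrite mulr0.
rewrite !pick; case: eqVneq => [->|_].
  by rewrite [true%:R](_ : _ = 1)//; congr (_ / _); ring.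
by rewrite mulr0; congr (_ / _); ring.
Qed.

End SigmaFactor.

Section EmpiricalMatrixCLT.
Context {d : measure_display} {Omega : measurableType d} {R : realType}.
Variables (Pr : probability Omega R) (N : nat).
Variables (Y : nat -> Omega -> 'I_N) (Q : 'M[R]_N) (pi : 'rV[R]_N).
Hypotheses (hY : markov_chain Pr Y Q) (sQ : stochastic_mx Q).
Hypothesis hpi : invariant_distribution Q pi.
Hypothesis harm : forall h : 'cV[R]_N, Q *m h = h -> forall i j, h i 0 = h j 0.
Hypothesis pi0 : forall i, 0 < pi 0 i.

Definition centered (i j a b : 'I_N) : R := (a == i)%:R * ((b == j)%:R - Q i j).

Lemma centered_mean i j a : \sum_b Q a b * centered i j a b = 0.
Proof.
rewrite /centered; have [->|ai] := eqVneq a i; last by apply: big1 => b _; rewrite mul0r mulr0.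
under eq_bigr do rewrite mul1r mulrBr; rewrite sumrB -mulr_suml sQ.2 mul1r.
by rewrite (bigD1 j)//= eqxx mulr1 big1 ?addr0 ?subrr// => b /negbTE ->; rewrite mulr0.
Qed.

Definition score n w : 'cV[R]_(N * N) :=
  \col_s (additive_functional Y (centered (mxtens_unindex s).2 (mxtens_unindex s).1) n w
    / pi 0 (mxtens_unindex s).2).

Definition scaled_score n w : 'cV[R]_(N * N) := (Num.sqrt n%:R)^-1 *: score n w.

Definition linear_form (u : 'cV[R]_(N * N)) (a b : 'I_N) : R :=
  \sum_s u s 0 / pi 0 (mxtens_unindex s).2 * centered (mxtens_unindex s).2 (mxtens_unindex s).1 a b.

Lemma linear_form_mean u a : \sum_b Q a b * linear_form u a b = 0.
Proof.
rewrite /linear_form; under eq_bigr do rewrite mulr_sumr.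
rewrite exchange_big big1// => s _; under eq_bigr do rewrite mulrCA.
by rewrite -mulr_sumr centered_mean mulr0.
Qed.

Lemma dot_score u n w : dot u (score n w) = additive_functional Y (linear_form u) n w.
Proof.
rewrite dotE /additive_functional exchange_big; apply: eq_bigr => s _.
by rewrite mxE mulrA mulrAC mulr_sumr.
Qed.

Lemma linear_formE u a b : linear_form u a b =
  (u (mxtens_index (b, a)) 0 - \sum_j Q a j * u (mxtens_index (j, a)) 0) / pi 0 a.
Proof.
rewrite /linear_form.
under eq_bigr => s _ do rewrite -[s in u s 0](mxtens_unindexK s) [mxtens_unindex s]surjective_pairing.
rewrite (sum_mxtens (fun j i => u (mxtens_index (j, i)) 0 / pi 0 i * centered i j a b)).
rewrite exchange_big (bigD1 a)//= [X in _ + X]big1 ?addr0; last first.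
  by move=> i ia; apply: big1 => j _; rewrite /centered eq_sym (negbTE ia) mul0r mulr0.
rewrite /centered eqxx; under eq_bigr do rewrite mul1r mulrAC mulrBr.
rewrite -mulr_suml sumrB; congr ((_ - _) / _).
  by rewrite (bigD1 b)//= eqxx mulr1 big1 ?addr0// => j jb; rewrite eq_sym (negbTE jb) mulr0.
by apply: eq_bigr => j _; rewrite mulrC.
Qed.

(** Through the factor of [Sigma], both sides are the same sum of squares over the transitions (a,
    b). *)
Lemma asymptotic_variance_linear_form u :
  asymptotic_variance Q pi (linear_form u) = (u^T *m Sigma Q pi *m u) 0 0.
Proof.
rewrite -(Sigma_factor_sqr sQ pi0) mulmxA -[_ *m u]mulmxA.
rewrite -[(Sigma_factor Q pi)^T *m u]trmxK trmx_mul trmxK mxE.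
rewrite /asymptotic_variance; under eq_bigr do rewrite mulr_sumr.
rewrite exchange_big -(sum_mxtens (fun b a => pi 0 a * (Q a b * linear_form u a b ^+ 2))).
apply: eq_bigr => t _; rewrite [(_ *m _)^T _ _]mxE -expr2.
set a := (mxtens_unindex t).2; set b := (mxtens_unindex t).1.
have -> : (u^T *m Sigma_factor Q pi) 0 t = Num.sqrt (Q a b / pi 0 a) *
    (u (mxtens_index (b, a)) 0 - \sum_j Q a j * u (mxtens_index (j, a)) 0).
  rewrite mxE; under eq_bigr => s _ do rewrite mxE Sigma_factorE -/a -/b.
  under eq_bigr => s _ do rewrite -[s in u s 0](mxtens_unindexK s) [mxtens_unindex s]surjective_pairing.
  rewrite (sum_mxtens (fun j i => u (mxtens_index (j, i)) 0 *
    (Num.sqrt (Q a b / pi 0 a) * ((a == i)%:R * ((b == j)%:R - Q i j))))).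
  rewrite exchange_big (bigD1 a)//= [X in _ + X]big1 ?addr0; last first.
    by move=> i ia; apply: big1 => j _; rewrite eq_sym (negbTE ia) mul0r !mulr0.
  rewrite eqxx; under eq_bigr do rewrite mul1r mulrCA mulrBr.
  rewrite -mulr_sumr sumrB; congr (_ * (_ - _)).
    by rewrite (bigD1 b)//= eqxx mulr1 big1 ?addr0// => j jb; rewrite eq_sym (negbTE jb) mulr0.
  by apply: eq_bigr => j _; rewrite mulrC.
rewrite linear_formE -/a -/b [RHS]exprMn sqr_sqrtr; last by rewrite divr_ge0 ?sQ.1// ltW.
by rewrite exprMn; field; rewrite gt_eqF.
Qed.

(** A linear form of the score is again an additive functional with centred increments, so the
    scalar limit theorem gives the joint characteristic function. *)
Lemma char_scaled_score (C : 'M[R]_(N * N)) (t : 'cV[R]_(N * N)) th :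
  Exp Pr (fun w => cos (dot t (C *m scaled_score n w) + th)) @[n --> \oo]
    --> cos th * expR (- ((t^T *m (C *m Sigma Q pi *m C^T) *m t) 0 0 / 2)).
Proof.
have -> : (t^T *m (C *m Sigma Q pi *m C^T) *m t) 0 0 =
    asymptotic_variance Q pi (linear_form (C^T *m t)).
  by rewrite asymptotic_variance_linear_form trmx_mul trmxK !mulmxA.
have -> : (fun n => Exp Pr (fun w => cos (dot t (C *m scaled_score n w) + th))) =
    (fun n => Exp Pr (fun w => cos ((Num.sqrt n%:R)^-1 * additive_functional Y (linear_form (C^T *m t)) n w + th))).
  apply/funext => n; congr (Exp Pr); apply/funext => w; congr (cos (_ + _)).
  rewrite -dot_score /scaled_score /dot -!scalemxAr mxE; congr (_ * _).
  by rewrite trmx_mul trmxK mulmxA.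
exact: (@cos_clt _ _ _ _ _ _ _ _ hY sQ hpi harm _ th (linear_form_mean _)).
Qed.

Lemma visit_count_gt0 i n w : 0 < (visit_count Y i n w)%:R :> R ->
  forall j, empirical_mx Y n w i j - Q i j =
    additive_functional Y (centered i j) n w / (visit_count Y i n w)%:R.
Proof.
move=> v0 j; set V := visit_count Y i n w; set cnt := (\sum_(1 <= k < n) ((Y k w == i) && (Y k.+1 w == j)))%N.
have -> : additive_functional Y (centered i j) n w = cnt%:R - Q i j * V%:R.
  rewrite /additive_functional /centered /V /visit_count /cnt !natr_sum mulr_sumr -sumrB.
  by apply: eq_bigr => k _; rewrite mulrBr -natrM mulnb [Q i j * _]mulrC.
by rewrite mxE mulrBl mulfK// gt_eqF.
Qed.


Lemma path_scaled_score n : exists g : {ffun 'I_n.+1 -> 'I_N} -> 'cV[R]_(N * N),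
  scaled_score n = g \o path_of Y n.+1.
Proof.
exists (fun x => (Num.sqrt n%:R)^-1 *: \col_s ((\sum_(1 <= k < n)
  centered (mxtens_unindex s).2 (mxtens_unindex s).1 (x (inord k)) (x (inord k.+1)))
  / pi 0 (mxtens_unindex s).2)).
apply/funext => w; congr (_ *: _); apply/matrixP => s j; rewrite !mxE.
by rewrite additive_functional_path.
Qed.

(** Through this factorisation every function of the empirical matrix is measurable, including the
    plug-in value at a point of divergence. *)
Lemma path_empirical_mx n : exists g : {ffun 'I_n.+1 -> 'I_N} -> 'M[R]_N,
  empirical_mx Y n = g \o path_of Y n.+1.
Proof.
exists (fun x : {ffun 'I_n.+1 -> 'I_N} => \matrix_(i, j)
  ((\sum_(1 <= k < n) ((x (inord k) == i) && (x (inord k.+1) == j)))%N%:R / (visits_of i x)%:R)).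
apply/funext => w; apply/matrixP => i j; rewrite !mxE -visit_count_path; congr (_%:R / _).
rewrite big_nat [RHS]big_nat; apply: eq_bigr => k /andP[k0 kn].
by rewrite !ffunE !inordK// ltnS// ltnW.
Qed.

Lemma tight_scaled_score (e : R) : 0 < e -> exists2 K : R, 0 < K &
  forall n, (0 < n)%N -> exists E, [/\ measurable E, prb Pr E <= e &
    forall w, ~ E w -> `|scaled_score n w| <= K].
Proof.
move=> e0; have [C C0 HC] := bounded_fin (fun p : ('I_N * 'I_N) * ('I_N * 'I_N) => centered p.1.1 p.1.2 p.2.1 p.2.2).
pose D := \sum_s C ^+ 2 / pi 0 (mxtens_unindex (s : 'I_(N * N))).2 ^+ 2.
have D0 : 0 <= D by apply: sumr_ge0 => s _; rewrite divr_ge0// exprn_ge0// ltW.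
(* Markov's inequality for the squared Euclidean norm, whose mean is at most D for every n; the
   summand 1 keeps [K2] positive. *)
pose K2 := (D + 1) / e; have K20 : 0 < K2 by rewrite divr_gt0// ltr_wpDl.
exists (Num.sqrt K2); first by rewrite sqrtr_gt0.
move=> n n0; have [g hg] := path_scaled_score n.
have bS s : bounded_rv (fun w => scaled_score n w s 0 ^+ 2).
  by rewrite hg; exact: (finval_bounded (fun x => g x s 0 ^+ 2) (finval_path hY (n := n.+1))).
exists [set w | K2 < \sum_s scaled_score n w s 0 ^+ 2].
have mE : [set w | K2 < \sum_s scaled_score n w s 0 ^+ 2] =
    path_of Y n.+1 @^-1` [set x | K2 < \sum_s g x s 0 ^+ 2] by rewrite hg.
split.
- by rewrite mE; apply: finval_set; exact (finval_path hY (n := n.+1)).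
- rewrite mE; apply: le_trans (prb_markov Pr (finval_path hY (n := n.+1)) _ K20) _.
    by move=> x; apply: sumr_ge0 => s _; exact: sqr_ge0.
  rewrite ler_pdivrMr// [_ * K2]mulrC /K2 divfK ?gt_eqF//.
  have -> : (fun x => \sum_s g x s 0 ^+ 2) \o path_of Y n.+1 = (fun w => \sum_s scaled_score n w s 0 ^+ 2).
    by rewrite hg.
  rewrite Exp_sum//; apply: (@le_trans _ _ D); last by rewrite lerDl.
  apply: ler_sum => s _; set i := (mxtens_unindex s).2; set j := (mxtens_unindex s).1.
  have -> : (fun w => scaled_score n w s 0 ^+ 2) =
      (fun w => (n%:R * pi 0 i ^+ 2)^-1 * additive_functional Y (centered i j) n w ^+ 2).
    apply/funext => w; rewrite !mxE -/i -/j exprMn exprVn sqr_sqrtr ?ler0n//.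
    by field; rewrite ?pnatr_eq0 -?lt0n ?n0 ?gt_eqF.
  rewrite ExpZ; last exact: (finval_additive hY (centered i j) (fun x _ => x ^+ 2)).
  rewrite mulrC ler_pdivrMr; last by rewrite mulr_gt0 ?ltr0n// exprn_gt0.
  apply: le_trans (second_moment_additive hY sQ n0 (fun a b => HC ((i, j), (a, b))) (centered_mean i j)) _.
  by rewrite [n%:R * _]mulrC mulrA divfK// gt_eqF// exprn_gt0.
move=> w /= /negP; rewrite -leNgt => Sw; apply: mx_norm_leP => [|s k]; first exact: sqrtr_ge0.
rewrite ord1 -sqrtr_sqr ler_wsqrtr//; apply: le_trans Sw.
by rewrite (bigD1 s)//= lerDl sumr_ge0// => t _; exact: sqr_ge0.
Qed.

Lemma occupation_uniform (eta e : R) : 0 < eta -> 0 < e -> \forall n \near \oo,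
  exists E, [/\ measurable E, prb Pr E <= e &
    forall w, ~ E w -> forall i, `|(visit_count Y i n w)%:R / n%:R - pi 0 i| <= eta].
Proof.
move=> eta0 e0; have e1 : 0 < e / (N%:R + 1) by rewrite divr_gt0// ltr_wpDl.
have : \forall n \near \oo, forall i, prb Pr [set w | eta < `|(visit_count Y i n w)%:R / n%:R - pi 0 i|] <= e / (N%:R + 1).
  by apply: filter_forall => i; exact: (occupation_lln hY sQ hpi harm).
apply: filterS => n Hn.
have mE i : measurable [set w | eta < `|(visit_count Y i n w)%:R / n%:R - pi 0 i|].
  rewrite (_ : [set w | _] = path_of Y n.+1 @^-1` [set x | eta < `|(visits_of i x)%:R / n%:R - pi 0 i|]).
    by apply: finval_set; exact (finval_path hY (n := n.+1)).
  by apply/seteqP; split => w /=; rewrite visit_count_path.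
exists (\bigcup_i [set w | eta < `|(visit_count Y i n w)%:R / n%:R - pi 0 i|]); split.
- by apply: fin_bigcup_measurable => [|i _]; [exact: finite_finset|exact: mE].
- apply: le_trans (prb_bigcup Pr mE) _; apply: (@le_trans _ _ (\sum_(i < N) e / (N%:R + 1))).
    by apply: ler_sum => i _; exact: Hn.
  rewrite sumr_const card_ord -[leLHS]mulr_natl mulrCA -[leRHS]mulr1 ler_wpM2l ?(ltW e0)//.
  by rewrite ler_pdivrMr ?ltr_wpDl// mul1r lerDl.
by move=> w nE i; rewrite leNgt; apply/negP => h; apply: nE; exists i.
Qed.

(** An entry of the scaled deviation is the score entry times pi_i / f, with f the observed
    frequency. The tolerance is a fraction of pi_i / 2 because f >= pi_i / 2 then makes |pi_i - f| /
    f at most eta. *)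
Lemma empirical_error (eta : R) n w : (0 < n)%N -> 0 <= eta ->
  (forall i, `|(visit_count Y i n w)%:R / n%:R - pi 0 i| <= eta * (pi 0 i / 2)) -> eta <= 1 ->
  `|Num.sqrt n%:R *: (vec (empirical_mx Y n w) - vec Q) - scaled_score n w| <= eta * `|scaled_score n w|.
Proof.
move=> n0 eta0 Hw eta1; have nR : 0 < n%:R :> R by rewrite ltr0n.
apply: mx_norm_leP => [|s k]; first by rewrite mulr_ge0.
rewrite ord1; set i := (mxtens_unindex s).2; set j := (mxtens_unindex s).1.
set f := (visit_count Y i n w)%:R / n%:R : R.
have fpi : `|f - pi 0 i| <= eta * (pi 0 i / 2) := Hw i.
have f2 : pi 0 i / 2 <= f.
  have : eta * (pi 0 i / 2) <= pi 0 i / 2 by rewrite ler_piMl// divr_ge0// ltW.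
  by move: fpi; rewrite ler_norml => /andP[+ _]; lra.
have p2 : 0 < pi 0 i / 2 by rewrite divr_gt0.
have f0 : 0 < f := lt_le_trans p2 f2.
have v0 : 0 < (visit_count Y i n w)%:R :> R by have := f0; rewrite /f pmulr_lgt0 ?invr_gt0.
have pin0 : pi 0 i != 0 by rewrite gt_eqF.
have -> : (Num.sqrt n%:R *: (vec (empirical_mx Y n w) - vec Q) - scaled_score n w) s 0 =
    ((pi 0 i - f) / f) * scaled_score n w s 0.
  rewrite mxE [(- scaled_score n w) s 0]mxE mxE [(vec _ - vec _) s 0]mxE [(- vec Q) s 0]mxE !vecE -/i -/j.
  rewrite visit_count_gt0// mulrBl divff ?gt_eqF// mulrBl mul1r; congr (_ - _).
  rewrite !mxE -/i -/j /f invf_div.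
  set r := Num.sqrt n%:R; have r0 : r != 0 by rewrite gt_eqF// sqrtr_gt0.
  have -> : n%:R = r * r by rewrite -expr2 sqr_sqrtr// ltW.
  by field; rewrite ?r0 ?pin0 ?(gt_eqF v0).
rewrite normrM; apply: ler_pM => //; last exact: mx_entry_le.
rewrite normrM normfV (gtr0_norm f0) ler_pdivrMr// distrC (le_trans fpi)//.
by rewrite ler_wpM2l.
Qed.

(** The statistic is compared with C times the scaled score, outside three events of probability e /
    3: large score, atypical occupation times, empirical matrix outside [good]. The map [f] can be
    arbitrary away from Q, being composed with a finite-valued variable. *)
Lemma empirical_delta_method (C : 'M[R]_(N * N)) (f : 'M[R]_N -> 'cV[R]_(N * N)) (good : set 'M[R]_N) :
  (forall e : R, 0 < e -> exists2 dl : R, 0 < dl & forall Q', `|Q' - Q| <= dl -> good Q' ->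
     `|vec Q' - f Q' - C *m (vec Q' - vec Q)| <= e * `|vec Q' - vec Q|) ->
  (forall e : R, 0 < e -> \forall n \near \oo, prb Pr [set w | ~ good (empirical_mx Y n w)] <= e) ->
  cvg_to_gaussian Pr
    (fun n w => Num.sqrt n%:R *: (vec (empirical_mx Y n w) - f (empirical_mx Y n w)))
    (C *m Sigma Q pi *m C^T).
Proof.
move=> hf hgood; have [nu nuG nuC] := @gaussian_law_exists R _ _ (C *m Sigma_factor Q pi).
have V : C *m Sigma_factor Q pi *m (C *m Sigma_factor Q pi)^T = C *m Sigma Q pi *m C^T.
  by rewrite trmx_mul -(Sigma_factor_sqr sQ pi0) !mulmxA.
rewrite V in nuG nuC; exists nu => //.
have hZ n : exists g : {ffun 'I_n.+1 -> 'I_N} -> 'cV[R]_(N * N),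
    (fun w => Num.sqrt n%:R *: (vec (empirical_mx Y n w) - f (empirical_mx Y n w))) = g \o path_of Y n.+1.
  by have [g ->] := path_empirical_mx n; exists (fun x => Num.sqrt n%:R *: (vec (g x) - f (g x))).
apply: (@cvg_in_law_of_trig R _ _ Pr _ _ (fun n w => C *m scaled_score n w)).
- by move=> n; have [g ->] := hZ n; apply: finval_cont_measurable; exact (finval_path hY (n := n.+1)).
- move=> n; have [g ->] := path_scaled_score n.
  by apply: (finval_cont_measurable (fun x => C *m g x)); exact (finval_path hY (n := n.+1)).
- by move=> t th; rewrite nuC mulNr; exact: char_scaled_score.
move=> e e0; have e3 : 0 < e / 3 by rewrite divr_gt0.
have [K K0 HK] := tight_scaled_score e3.
pose n2 : R := (N * N)%:R; pose cK := n2 * `|C| * K + 1.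
have cK0 : 0 < cK by rewrite ltr_wpDl// !mulr_ge0// ltW.
exists cK => eta eta0.
pose e1 := Num.min 1 (eta / 2 / cK).
have e10 : 0 < e1 by rewrite lt_min ltr01 !divr_gt0.
(* Off the exceptional events sqrt n |vec Qhat - vec Q| <= 2K, so a relative error eta / 2 / (2K)
   becomes eta / 2 after scaling; the other half pays for [e1]. *)
have [dl dl0 Hf] := hf (eta / 2 / (2 * K)) (divr_gt0 (divr_gt0 eta0 (ltr0n _ 2)) (mulr_gt0 (ltr0n _ 2) K0)).
have [pm pm0 Hpm] : exists2 pm : R, 0 < pm & forall i, pm <= pi 0 i.
  exists (\big[Num.min/1]_i pi 0 i); first by apply: lt_bigmin.
  by move=> i; exact: bigmin_le_cond.
have eta1 : 0 < e1 * (pm / 2) by rewrite mulr_gt0// divr_gt0.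
have small : \forall m \near \oo, `|0 - 2 * K / Num.sqrt m%:R| <= dl.
  have : (2 * K) * (Num.sqrt m%:R)^-1 @[m --> \oo] --> (2 * K) * 0.
    by apply: cvgM; [exact: cvg_cst|exact: cvg_inv_sqrt].
  by rewrite mulr0 => /cvgrPdist_le/(_ _ dl0).
near=> n.
have n0 : (0 < n)%N by near: n; exists 1%N.
have [E1 [mE1 pE1 HE1]] := HK n n0.
have [E2 [mE2 pE2 HE2]] : exists E, [/\ measurable E, prb Pr E <= e / 3 &
    forall w, ~ E w -> forall i, `|(visit_count Y i n w)%:R / n%:R - pi 0 i| <= e1 * (pm / 2)].
  by near: n; exact: occupation_uniform.
pose E3 := [set w | ~ good (empirical_mx Y n w)].
have mE3 : measurable E3.
  rewrite /E3; have [g ->] := path_empirical_mx n.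
  exact: (finval_set (fun x => ~ good (g x)) (finval_path hY (n := n.+1))).
have pE3 : prb Pr E3 <= e / 3 by rewrite /E3; near: n; exact: (hgood _ e3).
have sn0 : 0 < Num.sqrt n%:R :> R by rewrite sqrtr_gt0 ltr0n.
have snK : 2 * K / Num.sqrt n%:R <= dl.
  have : `|0 - 2 * K / Num.sqrt n%:R| <= dl by near: n; exact: small.
  by rewrite sub0r normrN; apply: le_trans; exact: ler_norm.
exists (E1 `|` E2 `|` E3); split.
- by apply: measurableU => //; exact: measurableU.
- rewrite -/(prb Pr _); apply: le_trans (prb_setU Pr (measurableU _ _ mE1 mE2) mE3) _.
  apply: le_trans (lerD (prb_setU Pr mE1 mE2) (lexx _)) _; lra.
move=> w nE; have nE1 : ~ E1 w by move=> h; apply: nE; left; left.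
have nE2 : ~ E2 w by move=> h; apply: nE; left; right.
have gw : good (empirical_mx Y n w) by apply: contrapT => h; apply: nE; right.
have SK := HE1 w nE1; set S := scaled_score n w in SK *.
have CS : `|C *m S| <= cK.
  apply: le_trans (mx_norm_mulmx _ _) _; rewrite /cK -/n2.
  by apply: (@le_trans _ _ (n2 * `|C| * K)); [rewrite ler_wpM2l// mulr_ge0|rewrite lerDl].
split => //; set Qh := empirical_mx Y n w.
pose x := Num.sqrt n%:R *: (vec Qh - vec Q).
have xS : `|x - S| <= e1 * `|S|.
  apply: empirical_error => //; first exact: ltW.
    move=> i; apply: le_trans (HE2 w nE2 i) _; rewrite ler_wpM2l ?(ltW e10)//.
    by rewrite ler_wpM2r// invr_ge0.
  by rewrite ge_min lexx.
have x2K : `|x| <= 2 * K.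
  rewrite -(subrK S x) (le_trans (ler_normD _ _))//.
  apply: (@le_trans _ _ (K + K)); last by rewrite mulr_natl mulr2n.
  apply: lerD => //; apply: le_trans xS _; apply: le_trans SK.
  by rewrite ler_piMl// ge_min lexx.
have Qx : vec Qh - vec Q = (Num.sqrt n%:R)^-1 *: x by rewrite /x scalerA mulVf ?gt_eqF// scale1r.
have nx : `|vec Qh - vec Q| = (Num.sqrt n%:R)^-1 * `|x|.
  by rewrite Qx normrZ ger0_norm// invr_ge0 ltW.
have Qd : `|Qh - Q| <= dl.
  apply: (@le_trans _ _ `|vec Qh - vec Q|).
    apply: mx_norm_leP => // i j.
    have -> : (Qh - Q) i j = (vec Qh - vec Q) (mxtens_index (j, i)) 0 by rewrite -vecB vecE mxtens_indexK.
    exact: mx_entry_le.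
  rewrite nx mulrC; apply: le_trans snK; rewrite ler_wpM2r// invr_ge0; exact: ltW.
have := Hf Qh Qd gw; rewrite nx => HfQ.
have -> : Num.sqrt n%:R *: (vec Qh - f Qh) - C *m S =
    Num.sqrt n%:R *: (vec Qh - f Qh - C *m (vec Qh - vec Q)) + C *m (x - S).
  by rewrite [C *m (x - S)]mulmxBr [in RHS]scalerBr [C *m x](_ : _ = Num.sqrt n%:R *: (C *m (vec Qh - vec Q))) -?scalemxAr// addrA subrK.
apply: le_trans (ler_normD _ _) _; rewrite [leRHS]splitr; apply: lerD.
  rewrite normrZ (gtr0_norm sn0).
  apply: (@le_trans _ _ (eta / 2 / (2 * K) * `|x|)).
    by rewrite -ler_pdivlMl// mulrCA.
  by rewrite mulrAC ler_pdivrMr ?mulr_gt0// ler_wpM2l// ltW// divr_gt0.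
apply: le_trans (mx_norm_mulmx _ _) _.
apply: (@le_trans _ _ (n2 * `|C| * (e1 * K))).
  apply: (ler_wpM2l (mulr_ge0 (ler0n R (N * N)) (normr_ge0 C))); apply: le_trans xS _.
  by rewrite ler_wpM2l// ltW.
apply: (@le_trans _ _ (cK * e1)).
  by rewrite mulrCA mulrC; apply: ler_wpM2r; [exact: ltW|rewrite /cK lerDl].
by rewrite mulrC -ler_pdivlMr// ge_min lexx orbT.
Unshelve. all: by end_near. Qed.

End EmpiricalMatrixCLT.

(** * The asymptotic law of the difference between empirical and plug-in transition matrices *)

Theorem proposition4p1 (R : realType) (N : nat) (hN : (3 <= N)%N)
    (d : measure_display) (Omega : measurableType d) (Pr : probability Omega R)
    (X : nat -> Omega -> 'I_N) (P : 'M[R]_N) (pi : 'rV[R]_N)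
    (hP : stochastic_mx P) (hirr : irreducible_mx P) (haper : aperiodic_mx P)
    (hpi : invariant_distribution P pi) (hX : markov_chain Pr X P)
    (tau : nat -> {RV Pr >-> nat}) (mu : probability nat R)
    (hmu : (mu : set nat -> \bar R) <> \d_(0%N)) (htau : iid tau mu)
    (hindep : independent_processes X tau)
    (r : nat) (A : 'M[R]_(r, N * N)) (b : 'cV[R]_r) (hA : \rank A = r)
    (hPA : A *m vec P = b)
    (p0 : 'cV[R]_(N * N)) (hp0 : A *m p0 = b)
    (Phi : 'M[R]_(N * N, N * N - r)) (hPhi : column_basis_of_ker A Phi) :
  let Q := G mu P in
  let Qhat := empirical_mx (obs X tau) in
  let Phat n w := unvec (p_estimator Phi p0 (Qhat n w)) in
  let B := Bmx Phi P Q in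
  identifiable A Q ->
  (\sum_(1 <= k <oo) (k%:R * mass mu k)%:E < +oo)%E ->
  cvgn (Gamma_series mu P) /\
  (contains_row_sum_constraint A b \/ plugin_defined Pr mu Phat ->
   cvg_to_gaussian Pr
     (fun n w => Num.sqrt n%:R *: (vec (Qhat n w) - vec (G mu (Phat n w))))
     ((1%:M - Gamma mu P *m B) *m Sigma Q pi *m (1%:M - Gamma mu P *m B)^T)).
Proof.
move=> Q Qhat Phat B hid hmom.
(* The moment condition is restated with real partial sums from index 0, whose additional term
   vanishes. *)
have mom : exists C : R, forall n, \sum_(0 <= l < n) mass mu l * l%:R <= C.
  exists (fine (\sum_(1 <= k <oo) (k%:R * mass mu k)%:E)%E) => n.
  have k0 k : (0%R <= (k%:R * mass mu k)%:E)%E by rewrite lee_fin mulr_ge0 ?mass_ge0.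
  have S0 : (0 <= \sum_(1 <= k <oo) (k%:R * mass mu k)%:E)%E by apply: nneseries_ge0 => k _ _.
  rewrite -lee_fin fineK ?ge0_fin_numE// -sumEFin.
  case: n => [|n]; first by rewrite big_nil.
  rewrite big_nat_recl// mulr0 add0e.
  have := @nneseries_lim_ge R (fun k => (k%:R * mass mu k)%:E) xpredT 1 n.+1 (fun k _ _ => k0 k).
  rewrite big_add1/=; apply: le_trans.
  by rewrite le_eqVlt; apply/orP; left; apply/eqP; apply: eq_bigr => k _; rewrite mulrC.
split; first exact: is_cvg_Gamma_series.
move=> hgood.
have sQ : stochastic_mx Q by exact: stochastic_G.
have [m Qm _] := G_exp_gt0 hP hirr haper mom hmu.
have harm := harmonic_const sQ Qm.
have hpiQ : invariant_distribution Q pi.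
  by case: hpi => pi_ge0 pi_sum piP; split => //; exact: invariant_G.
have pi0 := invariant_gt0 hpiQ Qm.
have hY : markov_chain Pr (obs X tau) Q.
  apply: (obs_markov_chain hX htau hindep); first exact: G_entry_ereal.
  by move=> g; apply: exp_ge0_entry; exact: hP.1.
(* Under the row-sum constraint this set is everything; otherwise its complement lies in the event
   of divergence, whose probability tends to 0. *)
pose good := [set Q' | contains_row_sum_constraint A b \/ cvgn (G_series mu (unvec (p_estimator Phi p0 Q')))].
apply: (@empirical_delta_method _ _ _ Pr _ _ _ _ hY sQ hpiQ harm pi0 (1%:M - Gamma mu P *m B)
  (fun Q' => vec (G mu (unvec (p_estimator Phi p0 Q')))) good).
  exact: plugin_expansion.
move=> e e0; case: hgood => [rs|pd].
  apply: nearW => n; rewrite (_ : [set w | _] = set0) ?prb0 ?ltW//.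
  by rewrite -subset0 => w /=; apply; left.
have : \forall n \near \oo, `|1 - prb Pr [set w | cvgn (G_series mu (Phat n w))]| <= e.
  by move: pd => /fine_cvg/cvgrPdist_le/(_ _ e0).
apply: filterS => n; rewrite ler_norml => /andP[_].
have [g hg] := path_empirical_mx (R := R) (obs X tau) n.
have mfin (S : set 'M[R]_N) : measurable [set w | S (Qhat n w)].
  by rewrite /Qhat hg; exact (finval_set (fun x => S (g x)) (finval_path hY (n := n.+1))).
apply: le_trans; set Cv := [set w | cvgn _].
have mCv : measurable Cv by exact: (mfin [set Q' | cvgn (G_series mu (unvec (p_estimator Phi p0 Q')))]).
rewrite -lee_fin EFinB -!prbE// -?probability_setC//; last exact: (mfin (~` good)).
apply: le_measure; rewrite ?inE; [exact: (mfin (~` good))|exact: measurableC|].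
by move=> w ngood cv; apply: ngood; right.
Qed.
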